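(* Let $k\geq 1$ be an integer and let $C_{2k}\subset\mathbb{P}^2$ be the complex projective plane curve of degree $d=2k$ defined by $$f_{2k}:=x^{2k}+y^{2k}+z^{2k}-2(x^ky^k+x^kz^k+y^kz^k)=0.$$ Then: (1) $\operatorname{Sing}(C_{2k})$ consists of exactly $3k$ singular points, each of type $\mathbb{A}_{k-1}$ (where for $k=1$ type $\mathbb{A}_0$ means a smooth point, so that $\operatorname{Sing}(C_2)=\emptyset$). (2) $C_{2k}$ is a nearly free divisor with exponents $d_1=d_2=d_3=k$, and total Tjurina number $\tau(C_{2k})=3k(k-1)$. (3) If $k$ is odd, $C_{2k}$ is irreducible of geometric genus $\frac{(k-1)(k-2)}{2}$; if $k$ is even, $C_{2k}$ has four irreducible components, all smooth of degree $\frac{k}{2}$.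
   Context: Let $S=\mathbb{C}[x,y,z]$ with its standard grading. For a homogeneous $f\in S$ of degree $d$ defining a reduced curve $C:f=0$ in $\mathbb{P}^2$ (over $\mathbb{C}$), let $J_f=(f_x,f_y,f_z)$ be the Jacobian ideal, $I_f$ its saturation with respect to $(x,y,z)$, $N(f)=I_f/J_f$ with homogeneous components $N(f)_m$, and let $\operatorname{AR}(f)=\{(a,b,c)\in S^3: af_x+bf_y+cf_z=0\}$, a graded $S$-submodule of $S^3$ (graded by the degree of the entries $a,b,c$). The curve $C:f=0$ is a nearly free divisor if $N(f)\neq 0$ and $\dim_{\mathbb{C}}N(f)_m\leq 1$ for every $m$; equivalently, there are three syzygies $\rho_1,\rho_2,\rho_3\in\operatorname{AR}(f)$, homogeneous of degrees $d_1$ and $d_2=d_3=d-d_1$ with $1\le d_1\leq d_2$, which form a minimal system of generators of $\operatorname{AR}(f)$. The integers $d_1\leq d_2$ $(=d_3)$ are called the exponents of $C$. The total Tjurina number $\tau(C)$ is the sum of the Tjurina numbers of all singular points of $C$. A singular point of type $\mathbb{A}_{n}$ is one locally analytically equivalent to $u^2-v^{n+1}=0$ at the origin. *)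

(* Defs.v *)
From HB Require Import structures.
From mathcomp Require Import all_boot all_order all_algebra.
From mathcomp Require Import complex mpoly.
From mathcomp Require Import classical_sets functions reals topology normedtype.
From mathcomp Require Import derive.

Set Implicit Arguments.
Unset Strict Implicit.
Unset Printing Implicit Defensive.

Import Order.TTheory GRing.Theory Num.Theory.
Import numFieldNormedType.Exports.

Local Open Scope ring_scope.

(* Everything is stated over a numClosedFieldType K and used for K = R[i] with
   R : realType, the field of complex numbers. *)

(* The K-vector space U / (U `&` W) has dimension n: the classes of e_1..e_n
   form a basis. *)
Definition quotient_dim (K : numClosedFieldType) (V : lmodType K)
    (U W : V -> Prop) (n : nat) : Prop :=
  exists e : 'I_n -> V,
    (forall i, U (e i)) /\
    (forall u, U u ->
       exists! c : 'rV[K]_n, W (u - \sum_(i < n) c 0 i *: e i)).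

Section Polynomials.
Variables (K : numClosedFieldType) (n : nat).
Implicit Types f q h : {mpoly K[n]}.

Definition irreducible_mpoly f : Prop :=
  [/\ f != 0, f \isn't a GRing.unit &
      forall a b, f = a * b -> a \is a GRing.unit \/ b \is a GRing.unit].

Definition square_free f : Prop :=
  f != 0 /\ forall a q, f = a * q ^+ 2 -> q \is a GRing.unit.

Definition principal_ideal f h : Prop := exists a, h = a * f.

Definition jacobian_ideal f h : Prop :=
  exists a : 'I_n -> {mpoly K[n]}, h = \sum_(i < n) a i * f^`M(i).

(* Saturation with respect to the ideal generated by the variables. *)
Definition saturation (I : {mpoly K[n]} -> Prop) h : Prop :=
  exists N : nat, forall m : 'X_{1..n}, mdeg m = N -> I ('X_[m] * h).

End Polynomials.

Section PlaneCurves.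
Variable K : numClosedFieldType.
Notation S := {mpoly K[3]}.
Implicit Types f : S.

Definition plane_curve_poly (k : nat) : S :=
  let x := 'X_0 : S in let y := 'X_1 : S in let z := 'X_2 : S in
  x ^+ (2 * k) + y ^+ (2 * k) + z ^+ (2 * k)
  - 2 * (x ^+ k * y ^+ k + x ^+ k * z ^+ k + y ^+ k * z ^+ k).

Definition reduced_curve (d : nat) f : Prop :=
  f \is d.-homog /\ square_free f.

(* The irreducible components of f = 0 are the curves q = 0 for the irreducible
   factors q of f, which are determined up to a nonzero scalar. *)
Definition irreducible_components (r : nat) f (q : 'I_r -> S) : Prop :=
  [/\ forall i, irreducible_mpoly (q i) /\ principal_ideal (q i) f,
      forall i j (c : K), q i = c *: q j -> i = j &
      forall p, irreducible_mpoly p -> principal_ideal p f ->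
        exists i (c : K), p = c *: q i].

Definition N_nonzero f : Prop :=
  exists h, saturation (jacobian_ideal f) h /\ ~ jacobian_ideal f h.

Definition N_dim f (m t : nat) : Prop :=
  quotient_dim (fun h : S => saturation (jacobian_ideal f) h /\ h \is m.-homog)
               (jacobian_ideal f) t.

Definition nearly_free f : Prop :=
  N_nonzero f /\ forall m, exists t, (t <= 1)%N /\ N_dim f m t.

Definition AR f (rho : 'rV[S]_3) : Prop :=
  \sum_(i < 3) rho 0 i * f^`M(i) = 0.

Definition minimal_generators (r : nat) (M : 'rV[S]_3 -> Prop)
    (rho : 'I_r -> 'rV[S]_3) : Prop :=
  [/\ forall i, M (rho i),
      forall v, M v -> exists c : 'I_r -> S, v = \sum_(i < r) c i *: rho i &
      forall j, ~ exists c : 'I_r -> S,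
        rho j = \sum_(i < r | i != j) c i *: rho i].

(* d is the degree of f. *)
Definition nearly_free_exponents (d : nat) f (d1 d2 d3 : nat) : Prop :=
  [/\ (1 <= d1 <= d2)%N, d2 = d3, d3 = (d - d1)%N &
      exists rho : 'I_3 -> 'rV[S]_3,
        minimal_generators (AR f) rho /\
        forall i j, rho i 0 j \is (tnth [tuple d1; d2; d3] i).-homog].

(* Points of P^2 are the lines of K^3. *)
Definition P2 : Type := {L : {vspace 'rV[K]_3} | \dim L == 1%N}.

Definition singular_point f (p : P2) : Prop :=
  f.@[vpick (val p) 0] = 0 /\ forall i, f^`M(i).@[vpick (val p) 0] = 0.

Definition chart (p : P2) : 'I_3 :=
  odflt ord0 [pick i | vpick (val p) 0 i != 0].

Definition affine_rep (p : P2) : 'rV[K]_3 :=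
  (vpick (val p) 0 (chart p))^-1 *: vpick (val p).

(* The equation of f = 0 in the affine chart x_(chart p) = 1, in the affine
   coordinates translated so that p becomes the origin. *)
Definition local_equation f (p : P2) : {mpoly K[2]} :=
  f \mPo [tuple (affine_rep p 0 j)%:MP + oapp (fun l => 'X_l) 0
                  (unlift (chart p) j) | j < 3].

(* The germ of g = 0 at the origin is of type A_n: there are a biholomorphic
   map phi : U -> V fixing the origin, with inverse psi, and a nowhere zero
   holomorphic function e on U with g \o phi = e * (u^2 - v^(n+1)). *)
Definition type_A (n : nat) (g : {mpoly K[2]}) : Prop :=
  exists (U V : set 'rV[K]_2) (phi psi : 'rV[K]_2 -> 'rV[K]_2)
         (e : 'rV[K]_2 -> K),
    [/\ [/\ open U, open V, U 0, V 0 & phi 0 = 0],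
        (forall w, U w -> V (phi w) /\ psi (phi w) = w),
        (forall w, V w -> U (psi w) /\ phi (psi w) = w),
        (forall w, U w -> differentiable phi w) /\
        (forall w, V w -> differentiable psi w) &
        forall w, U w ->
          [/\ differentiable e w, e w != 0 &
              g.@[phi w 0] = e w * (w 0 0 ^+ 2 - w 0 1 ^+ n.+1)]].

(* A power series in K{u,v} is given by its coefficients: a i j is that of
   u^i v^j; a geometric bound on them amounts to convergence near 0. *)

Definition convergent (a : nat -> nat -> K) : Prop :=
  exists M r : K, forall i j, `|a i j| <= M * r ^+ (i + j).

Definition series_mul (a b : nat -> nat -> K) : nat -> nat -> K :=
  fun i j => \sum_(s < i.+1) \sum_(t < j.+1) a s t * b (i - s)%N (j - t)%N.

Definition series_of (g : {mpoly K[2]}) : nat -> nat -> K :=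
  fun i j => g@_[multinom [tuple i; j]].

Definition tjurina_ideal (g : {mpoly K[2]}) (h : nat -> nat -> K) : Prop :=
  exists a b c : nat -> nat -> K,
    [/\ convergent a, convergent b, convergent c &
        h = series_mul a (series_of g) + series_mul b (series_of g^`M(0))
            + series_mul c (series_of g^`M(1))].

Definition tjurina_number (g : {mpoly K[2]}) (t : nat) : Prop :=
  quotient_dim convergent (tjurina_ideal g) t.

Definition total_tjurina_number f (t : nat) : Prop :=
  exists (s : seq P2) (tau : P2 -> nat),
    [/\ uniq s, (forall p, singular_point f p <-> p \in s),
        (forall p, p \in s -> tjurina_number (local_equation f p) (tau p)) &
        t = (\sum_(p <- s) tau p)%N].

End PlaneCurves.

(* The geometric genus of an irreducible curve is the genus of its nonsingular
   projective model (its normalization); the genus of a nonsingular projective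
   curve X is computed as its arithmetic genus 1 - P(0), where P is the Hilbert
   polynomial of X in any projective embedding. *)

Section Genus.
Variable K : numClosedFieldType.

Definition homogeneous_prime_ideal (n : nat) (I : {mpoly K[n]} -> Prop) : Prop :=
  [/\ [/\ I 0, (forall a b, I a -> I b -> I (a + b)) &
          (forall a b, I b -> I (a * b))],
      (forall a d, I a -> I (pihomog mdeg d a)), ~ I 1 &
      forall a b, I (a * b) -> I a \/ I b].

(* Jacobian criterion for a curve in P^n with homogeneous ideal I. *)
Definition nonsingular_curve_ideal (n : nat) (I : {mpoly K[n.+1]} -> Prop) : Prop :=
  forall v : 'rV[K]_n.+1, v != 0 -> (forall F, I F -> F.@[v 0] = 0) ->
    exists F : 'I_n.-1 -> {mpoly K[n.+1]},
      (forall i, I (F i)) /\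
      \rank (\matrix_(i < n.-1, j < n.+1) (F i)^`M(j).@[v 0]) = n.-1.

(* size P = 2 says that the variety has dimension 1. *)
Definition curve_of_arithmetic_genus (n : nat) (I : {mpoly K[n.+1]} -> Prop)
    (g : nat) : Prop :=
  exists P : {poly rat},
    [/\ size P = 2, 1 - P.[0] = g%:R &
        exists m0 : nat, forall m : nat, (m0 <= m)%N ->
          exists t : nat, P.[m%:R] = t%:R /\
            quotient_dim (fun h : {mpoly K[n.+1]} => h \is m.-homog) I t].

(* phi represents a rational map from the variety of I to that of J. *)
Definition rational_map (n m : nat) (I : {mpoly K[n.+1]} -> Prop)
    (J : {mpoly K[m.+1]} -> Prop) (phi : m.+1.-tuple {mpoly K[n.+1]}) : Prop :=
  [/\ exists d : nat, forall i, tnth phi i \is d.-homog,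
      exists i, ~ I (tnth phi i) &
      forall F, J F -> I (F \mPo phi)].

(* psi \o phi is defined and is the identity on a dense open subset of the
   variety of I. *)
Definition rational_left_inverse (n m : nat) (I : {mpoly K[n.+1]} -> Prop)
    (phi : m.+1.-tuple {mpoly K[n.+1]})
    (psi : n.+1.-tuple {mpoly K[m.+1]}) : Prop :=
  (exists i, ~ I (tnth psi i \mPo phi)) /\
  forall i j, I ((tnth psi i \mPo phi) * 'X_j - (tnth psi j \mPo phi) * 'X_i).

Definition birational (n m : nat) (I : {mpoly K[n.+1]} -> Prop)
    (J : {mpoly K[m.+1]} -> Prop) : Prop :=
  exists phi psi, [/\ rational_map I J phi, rational_map J I psi,
    rational_left_inverse I phi psi & rational_left_inverse J psi phi].

Definition geometric_genus (f : {mpoly K[3]}) (g : nat) : Prop :=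
  exists (n : nat) (I : {mpoly K[n.+1]} -> Prop),
    [/\ homogeneous_prime_ideal I, nonsingular_curve_ideal I,
        curve_of_arithmetic_genus I g &
        birational (principal_ideal f) I].

End Genus.

(* Main.v *)
(* Put a = x^k, b = y^k, c = z^k.  Then f = a^2 + b^2 + c^2 - 2(ab + ac + bc) and
   f_x = 2k x^(k-1) (a - b - c), and similarly for y and z.

   Fermat forms c0 x^l + c1 y^l + z^l are prime, by an Eisenstein argument after
   the substitution y = w x + s with c0 + c1 w^l = 0.

   The syzygies r1 = (b - c, x^(k-1) y, - x^(k-1) z), r2 and r3 (cyclically, up to
   sign) satisfy x r1 + y r2 + z r3 = 0.  If v is a syzygy, its cross product with
   r_i is g_i grad f, where x g1 + y g2 + z g3 = 0; exactness of the Koszul complex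
   of x, y, z then writes v as a combination of the r_i.  The same tools show that
   the saturation of the Jacobian ideal J is J + K (xyz)^(k-1), while no element
   of J contains the monomial (xyz)^(k-1).

   The form f(x^2, y^2, z^2) is the product of the four Fermat forms
   +-x^k +- y^k + z^k.  For even k the same factorization with k/2 gives the
   components of f.  For odd k the factors are permuted transitively by sign
   changes of the variables, so that f is irreducible, and (x^2 : y^2 : z^2) is a
   birational map from the Fermat curve onto f = 0.

   At a singular point the local equation is U^2 - 4 s^k = 0 with
   U = (w + t)^k - 1 - s^k and w^k = 1.  As t -> (w + t)^k has a local inverse, U and
   s are local coordinates; the Tjurina ideal is generated by t and s^(k-1). *)

Require Import Defs.
From HB Require Import structures.
From mathcomp Require Import all_boot all_order all_algebra.
From mathcomp Require Import complex mpoly.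
From mathcomp Require Import classical_sets functions reals topology normedtype.
From mathcomp Require Import derive.
From mathcomp Require Import boolp separable cyclotomic ring zify.

Set Implicit Arguments.
Unset Strict Implicit.
Unset Printing Implicit Defensive.

Import Order.TTheory GRing.Theory Num.Theory.

Local Open Scope ring_scope.

(* Keeps unification from unfolding the exponent vectors of the variables. *)
#[global] Opaque mnm1.

(** Divisibility is handled by prime elements rather than by unique factorization. Primality of the
    variables and of the Fermat forms yields the coprimality of the partial derivatives, the list of
    components and the homogeneous prime ideal of the smooth model. It is proved by weights: with s
    of weight l and z of weight 1, the weight components of a remainder of z-degree below l are
    monomials, while the lowest component of the Fermat form is z^l plus a nonzero multiple of s.

    The powers x^(k-1), y^(k-1), z^(k-1) are replaced by independent letters wherever possible, so
    that the identities have bounded degree.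

    The analytic part works over any algebraically closed numeric field, which may fail to be
    complete, so limits cannot supply inverse functions or inverse series. Instead, a root of X^k -
    z near w exists because the distances from w to all the roots multiply to |1 - z|, and the units
    that have to be inverted are polynomials in one variable, hence products of linear factors
    inverted by geometric series. *)

Section EisensteinPrime.

(** * Primality by a weighted Eisenstein criterion *)

Variable D : idomainType.

Lemma poly_low (E : idomainType) (P : {poly E}) : P != 0 ->
  exists v (Q : {poly E}), [/\ P = 'X^v * Q, Q`_0 = P`_v & P`_v != 0].
Proof.
move=> nzP.
have ex : exists n, P`_n != 0.
  by exists (size P).-1; rewrite -lead_coefE lead_coef_eq0.
case: (ex_minnP ex) => v Pv minv.
exists v, (drop_poly v P); split=> //; last by rewrite coef_drop_poly add0n.
rewrite -[LHS](poly_take_drop v) mulrC.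
suff -> : take_poly v P = 0 by rewrite add0r mulrC.
apply/polyP=> i; rewrite coef_take_poly coef0; case: ltnP => // lt_iv.
by apply/eqP; apply: contraTT lt_iv => /minv; rewrite -leqNgt.
Qed.

Lemma XnM_inj (E : idomainType) (P Q : {poly E}) u v :
  P`_0 != 0 -> Q`_0 != 0 -> 'X^u * P = 'X^v * Q -> u = v /\ P = Q.
Proof.
move=> P0 Q0 e.
have uv : u = v.
  have := congr1 (fun R : {poly E} => (R`_u, R`_v)) e.
  rewrite !coefXnM !subnn !ltnn.
  case: (ltngtP u v) => [_|_|//] [E1 E2]; [by rewrite E1 eqxx in P0|].
  by rewrite -E2 eqxx in Q0.
split=> //; move: e; rewrite uv => /mulfI; apply.
by rewrite monic_neq0 ?monicXn.
Qed.

(** Once the largest power of the variable is removed from [C], both sides have nonzero constant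
    term, so the remaining factors agree; but the left one has positive degree and the right one is
    the constant [c]. *)
Lemma linear_nodvd_monomial (e c : D) (C : {poly D}) j : e != 0 -> c != 0 ->
  (1 + e *: 'X) * C != c *: 'X^j.
Proof.
move=> e0 c0; apply/eqP => E.
have C0 : C != 0.
  apply: contra_neq c0 => C0; move: E; rewrite C0 mulr0 => /esym/eqP.
  by rewrite -mul_polyC mulf_eq0 polyC_eq0 orbC -size_poly_eq0 size_polyXn /= => /eqP.
have [w [Q [eC Q0 Cw]]] := poly_low C0.
have L0 : ((1 + e *: 'X) * Q)`_0 != 0.
  by rewrite coef0M coefD coefZ coefX coef1 mulr0 addr0 mul1r Q0.
have := @XnM_inj _ ((1 + e *: 'X) * Q) c%:P w j L0.
rewrite coefC eqxx => /(_ c0); rewrite mulrCA -eC E mulrC mul_polyC.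
case=> // _ /(congr1 (fun p : {poly D} => size p)).
have szL : size (1 + e *: 'X) = 2.
  rewrite addrC -mul_polyC size_MXaddC polyC_eq0 (negPf e0) /=.
  by rewrite size_polyC e0.
have nzQ : Q != 0 by apply: contraNneq Cw => Q00; rewrite -Q0 Q00 coef0.
rewrite size_mul ?nzQ // -?size_poly_eq0 ?szL // size_polyC c0 /=.
by rewrite -[in RHS](@prednK 1) // => -[/eqP]; rewrite size_poly_eq0 (negPf nzQ).
Qed.

Variables (l : nat).

(* Puts s in weight l and z in weight 1; the powers of the outer variable record
   the weight. *)
Definition weight_inner : {rmorphism {poly D} -> {poly {poly D}}} :=
  horner_eval ('X%:P * 'X^l) \o map_poly (polyC \o polyC).

Definition weight_map : {rmorphism {poly {poly D}} -> {poly {poly D}}} :=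
  horner_eval 'X \o map_poly weight_inner.

Lemma weight_mapE A : weight_map A = (map_poly weight_inner A).['X].
Proof. by []. Qed.

Lemma weight_innerE p :
  weight_inner p = \sum_(j < size p) (p`_j *: 'X^j)%:P * 'X^(l * j).
Proof.
rewrite /weight_inner /= /horner_eval (@horner_coef_wide _ (size p)); last first.
  exact: size_poly.
apply: eq_bigr => j _; rewrite coef_map /= exprMn -exprM mulrA.
by rewrite -mul_polyC polyCM rmorphXn.
Qed.

Hypothesis l_gt0 : (0 < l)%N.

Lemma coef_weight_inner p n :
  (weight_inner p)`_n = if (l %| n)%N then p`_(n %/ l) *: 'X^(n %/ l) else 0.
Proof.
rewrite weight_innerE coef_sum.
under eq_bigr => j _ do rewrite coefCM coefXn.
case: ifP => [/dvdnP[m ->]|ndiv].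
  rewrite mulnK //; case: (ltnP m (size p)) => [ltm|lem].
    rewrite (bigD1 (Ordinal ltm)) //= mulnC eqxx mulr1 big1 ?addr0 // => i ne.
    rewrite eqn_pmul2l // -val_eqE /= in ne *.
    by rewrite eq_sym (negPf ne) mulr0.
  rewrite nth_default // scale0r big1 // => i _.
  rewrite mulnC eqn_pmul2l // [(_ == _)]gtn_eqF ?mulr0 //.
  exact: leq_trans lem.
rewrite big1 // => i _; case: eqP => [e|]; last by rewrite mulr0.
by rewrite e dvdn_mulr in ndiv.
Qed.

(** Euclidean division by l: the monomial s^j z^i with i < l has weight l j + i, and this weight
    determines i and j. Hence every weight component of [A] is a single monomial. *)
Lemma coef_weight_map (A : {poly {poly D}}) n : (size A <= l)%N ->
  (weight_map A)`_n = A`_(n %% l)`_(n %/ l) *: 'X^(n %/ l).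
Proof.
move=> szA; rewrite weight_mapE (@horner_coef_wide _ l) ?(leq_trans (size_poly _ _)) // coef_sum.
under eq_bigr => i _ do rewrite coefMXn coef_map coef_weight_inner.
have ltm : (n %% l < l)%N by rewrite ltn_mod.
rewrite (bigD1 (Ordinal ltm)) //= ltnNge leq_mod /=.
have -> : (n - n %% l = n %/ l * l)%N.
  by rewrite {1}(divn_eq n l) addnK.
rewrite dvdn_mull // mulnK // big1 ?addr0 // => i ne.
case: ltnP => // le_in; case: ifP => // /dvdnP[m e].
case/eqP: ne; apply: val_inj => /=.
by rewrite -(subnK le_in) e modnMDl modn_small.
Qed.

Lemma weight_map_neq0 (A : {poly {poly D}}) : (size A <= l)%N -> A != 0 ->
  weight_map A != 0.
Proof.
move=> szA nzA.
have i_lt : ((size A).-1 < l)%N.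
  by rewrite prednK // lt0n size_poly_eq0.
pose i := (size A).-1; pose j := (size A`_i).-1.
have nzAij : A`_i`_j != 0.
  by rewrite /j -lead_coefE lead_coef_eq0 /i -lead_coefE lead_coef_eq0.
apply/eqP => /(congr1 (fun p : {poly {poly D}} => p`_(j * l + i))).
rewrite coef_weight_map // modnMDl modn_small // divnMDl // divn_small // addn0.
move/(congr1 (fun p : {poly D} => p`_j)).
by rewrite coefZ coefXn eqxx mulr1 !coef0 => /eqP; rewrite (negPf nzAij).
Qed.

(** If [A] and [B] were nonzero, their lowest weight components would be monomials by
    [coef_weight_map], and so would their product. The lowest component of z^l + s h is, up to a
    power of the weight variable, 1 + h(0) s, which divides no monomial. *)
Lemma eisenstein_nozero (h : {poly D}) (A B C : {poly {poly D}}) : h`_0 != 0 ->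
  (size A <= l)%N -> (size B <= l)%N ->
  A * B = C * ('X^l + ('X * h)%:P) -> A = 0 \/ B = 0.
Proof.
move=> h0 szA szB E.
have [->|nzA] := eqVneq A 0; first by left.
have [->|nzB] := eqVneq B 0; first by right.
have wq : weight_map ('X^l + ('X * h)%:P) = 'X^l * (1 + 'X%:P * weight_inner h).
  have wX : weight_inner 'X = 'X%:P * 'X^l.
    rewrite -[LHS]/((map_poly (polyC \o polyC) 'X).['X%:P * 'X^l]).
    by rewrite map_polyX hornerX.
  have e1 (P Q : {poly {poly D}}) : map_poly weight_inner (P + Q) =
    map_poly weight_inner P + map_poly weight_inner Q := raddfD _ _ _.
  have e2 (P Q : {poly D}) : weight_inner (P * Q) = weight_inner P * weight_inner Q
    := rmorphM _ _ _.
  have e3 (P : {poly D}) : map_poly weight_inner P%:P = (weight_inner P)%:P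
    := map_polyC _ _.
  rewrite weight_mapE e1 map_polyXn e3 e2 wX hornerD hornerXn hornerC.
  ring.
have wM P Q : weight_map (P * Q) = weight_map P * weight_map Q := rmorphM _ _ _.
have := congr1 weight_map E; rewrite !wM wq.
have := weight_map_neq0 szA nzA; have := weight_map_neq0 szB nzB.
set wA := weight_map A; set wB := weight_map B => nzwB nzwA EE.
have [u [A1 [eA A10 A1n0]]] := poly_low nzwA.
have [v [B1 [eB B10 B1n0]]] := poly_low nzwB.
have nzC : weight_map C != 0.
  by apply: contraTneq (mulf_neq0 nzwA nzwB) => C0; rewrite EE C0 mul0r eqxx.
have [w [C1 [eC C10 C1n0]]] := poly_low nzC.
have hw0 : (weight_inner h)`_0 = (h`_0)%:P.
  by rewrite coef_weight_inner dvdn0 div0n expr0 alg_polyC.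
have q0 : (1 + 'X%:P * weight_inner h)`_0 = 1 + h`_0 *: 'X.
  by rewrite coefD coefC eqxx coefCM hw0 mulrC mul_polyC.
have q00 : 1 + h`_0 *: 'X != 0 :> {poly D}.
  apply/eqP => /(congr1 (fun p : {poly D} => p`_0)).
  rewrite coefD coefC eqxx coefZ coefX mulr0 addr0 coef0 => /eqP.
  by rewrite oner_eq0.
have := @XnM_inj _ (A1 * B1) (C1 * (1 + 'X%:P * weight_inner h)) (u + v) (w + l).
rewrite !coef0M q0 A10 B10 C10 !mulf_neq0 // => /(_ isT isT).
have -> : 'X^(u + v) * (A1 * B1) =
          'X^(w + l) * (C1 * (1 + 'X%:P * weight_inner h)).
  rewrite !exprD mulrACA -eA -eB EE eC; set X1 := 'X^w; set X2 := 'X^l.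
  by rewrite mulrACA.
case=> // _ /(congr1 (fun p : {poly {poly D}} => p`_0)).
rewrite !coef0M q0 A10 B10 C10 /wA /wB (coef_weight_map _ szA) (coef_weight_map _ szB) => F.
move: A1n0 B1n0; rewrite /wA /wB (coef_weight_map _ szA) (coef_weight_map _ szB) => nA nB.
rewrite -!mul_polyC !mulf_eq0 !negb_or !polyC_eq0 in nA nB.
case/andP: nA => nA _; case/andP: nB => nB _.
have := linear_nodvd_monomial (weight_map C)`_w (u %/ l + v %/ l) h0
  (mulf_neq0 nA nB).
by rewrite mulrC -F exprD -scalerAl -scalerAr scalerA eqxx.
Qed.

(** The divisor is monic in the outer variable, so [A] and [B] may be replaced by their remainders,
    to which [eisenstein_nozero] applies. *)
Lemma eisenstein_prime (h : {poly D}) (A B C : {poly {poly D}}) : h`_0 != 0 ->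
  A * B = C * ('X^l + ('X * h)%:P) ->
  (exists A', A = A' * ('X^l + ('X * h)%:P)) \/
  (exists B', B = B' * ('X^l + ('X * h)%:P)).
Proof.
set q := 'X^l + _ => h0 E.
have szq : size q = l.+1.
  rewrite size_polyDl size_polyXn //.
  by apply: leq_ltn_trans (size_polyC_leq1 _) _.
have mq : q \is monic.
  rewrite monicE lead_coefDl ?lead_coefXn // size_polyXn.
  by apply: leq_ltn_trans (size_polyC_leq1 _) _.
have dE P : P = Pdiv.Ring.rdivp P q * q + Pdiv.Ring.rmodp P q.
  exact: Pdiv.RingMonic.rdivp_eq.
have szm P : (size (Pdiv.Ring.rmodp P q) <= l)%N.
  by rewrite -ltnS -szq Pdiv.Ring.ltn_rmodpN0 ?monic_neq0.
have [] := @eisenstein_nozero h (Pdiv.Ring.rmodp A q) (Pdiv.Ring.rmodp B q)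
  (C - Pdiv.Ring.rdivp A q * B - Pdiv.Ring.rmodp A q * Pdiv.Ring.rdivp B q) h0
  (szm A) (szm B).
- rewrite -/q !mulrBl -E {1}[A in A * B]dE.
  by rewrite mulrDl [B in _ + _ * B]dE; ring.
- by move=> e; left; exists (Pdiv.Ring.rdivp A q); rewrite {1}[A]dE e addr0.
- by move=> e; right; exists (Pdiv.Ring.rdivp B q); rewrite {1}[B]dE e addr0.
Qed.

End EisensteinPrime.

(** * Divisibility and prime elements in polynomial rings *)

Section MPolyTools.
Variables (K : numClosedFieldType) (n : nat).
Notation S := {mpoly K[n]}.
Implicit Types p q a b c : S.

Notation dvd := (@principal_ideal K _).

Definition prime_mpoly q := forall a b, dvd q (a * b) -> dvd q a \/ dvd q b.

Lemma mpoly_morph_ext (T : comNzRingType) (f g : {rmorphism S -> T}) :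
  (forall c : K, f c%:MP = g c%:MP) -> (forall i, f 'X_i = g 'X_i) -> f =1 g.
Proof.
move=> eC eX p; rewrite (mpolyE p) !rmorph_sum; apply: eq_bigr => m _ /=.
rewrite -mul_mpolyC !rmorphM /= eC; congr (_ * _).
rewrite mpolyXE_id !rmorph_prod; apply: eq_bigr => i _ /=.
by rewrite !rmorphXn eX.
Qed.

Lemma dvdm_refl q : dvd q q. Proof. by exists 1; rewrite mul1r. Qed.

Lemma dvdm0 q : dvd q 0. Proof. by exists 0; rewrite mul0r. Qed.

Lemma dvdmD q a b : dvd q a -> dvd q b -> dvd q (a + b).
Proof. by move=> [c ->] [d ->]; exists (c + d); rewrite mulrDl. Qed.

Lemma dvdmN q a : dvd q a -> dvd q (- a).
Proof. by move=> [c ->]; exists (- c); rewrite mulNr. Qed.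

Lemma dvdmB q a b : dvd q a -> dvd q b -> dvd q (a - b).
Proof. by move=> da db; apply: dvdmD => //; apply: dvdmN. Qed.

Lemma dvdm_mull q a b : dvd q b -> dvd q (a * b).
Proof. by move=> [c ->]; exists (a * c); rewrite mulrA. Qed.

Lemma dvdm_mulr q a b : dvd q a -> dvd q (a * b).
Proof. by rewrite mulrC; apply: dvdm_mull. Qed.

Lemma dvdm_trans q a b : dvd q a -> dvd a b -> dvd q b.
Proof. by move=> dqa [c ->]; apply: dvdm_mull. Qed.

Lemma dvdm_sum q (I : Type) (r : seq I) (P : pred I) (F : I -> S) :
  (forall i, P i -> dvd q (F i)) -> dvd q (\sum_(i <- r | P i) F i).
Proof.
move=> dF; elim/big_rec: _ => [|i x Pi dx]; first exact: dvdm0.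
by apply: dvdmD => //; apply: dF.
Qed.

Lemma dvdm_eval q a v : dvd q a -> q.@[v] = 0 -> a.@[v] = 0.
Proof. by move=> [c ->] q0; rewrite mevalM q0 mulr0. Qed.

Lemma prime_mpolyN q : prime_mpoly q -> prime_mpoly (- q).
Proof.
have dN a : dvd (- q) a <-> dvd q a.
  by split=> -[c ->]; exists (- c); rewrite ?mulrNN // mulNr mulrN.
by move=> pq a b /dN/pq[] /dN; [left|right].
Qed.

(** A retraction onto the polynomials free of the i-th variable. Its kernel is the ideal of that
    variable, so divisibility by a variable becomes vanishing under a morphism into a domain, and
    primality of the variable follows. *)
Definition subst0 (i : 'I_n) : {rmorphism S -> S} :=
  comp_mpoly [tuple (if j == i then 0 else 'X_j) | j < n].

Lemma subst0X i j : subst0 i 'X_j = if j == i then 0 else 'X_j.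
Proof.
rewrite /subst0 /= comp_mpolyXU -tnth_nth tnth_mktuple.
by [].
Qed.

Lemma subst0C i (c : K) : subst0 i c%:MP = c%:MP.
Proof. by rewrite /subst0 /= comp_mpolyC. Qed.

Lemma subst0P i p : dvd 'X_i (p - subst0 i p).
Proof.
have cl a b : dvd 'X_i (a - subst0 i a) -> dvd 'X_i (b - subst0 i b) ->
    dvd 'X_i (a * b - subst0 i (a * b)).
  move=> da db; rewrite rmorphM.
  have -> : a * b - subst0 i a * subst0 i b =
    (a - subst0 i a) * b + subst0 i a * (b - subst0 i b) by ring.
  by apply: dvdmD; [apply: dvdm_mulr|apply: dvdm_mull].
have d1 : dvd 'X_i (1 - subst0 i 1) by rewrite rmorph1 subrr; apply: dvdm0.
rewrite (mpolyE p) rmorph_sum -sumrB; apply: dvdm_sum => m _.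
rewrite -mul_mpolyC; apply: (cl); first by rewrite subst0C subrr; apply: dvdm0.
rewrite (mpolyXE_id K m).
elim/big_rec: _ => [|j x _ dx]; first exact: d1.
apply: (cl ('X_j ^+ m j) x _ dx); elim: (m j) => [|k IH]; first exact: d1.
rewrite exprS; apply: (cl 'X_j ('X_j ^+ k) _ IH); rewrite subst0X.
by case: eqP => [->|_]; rewrite ?subr0 ?subrr; [apply: dvdm_refl|apply: dvdm0].
Qed.

Lemma dvdmX_subst0 i p : dvd 'X_i p <-> subst0 i p = 0.
Proof.
split=> [[c ->]|p0]; last by rewrite -[p]subr0 -p0; apply: subst0P.
by rewrite rmorphM /= subst0X eqxx mulr0.
Qed.

Lemma prime_mpolyXi i : prime_mpoly ('X_i : S).
Proof.
move=> a b /dvdmX_subst0; rewrite rmorphM => /eqP.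
by rewrite mulf_eq0 => /orP[]/eqP/dvdmX_subst0; [left|right].
Qed.

Lemma mpolyX_neq0 m : 'X_[m] != 0 :> S.
Proof. by rewrite -msize_poly_eq0 msizeX. Qed.

Lemma mpoly_unitE p : p \is a GRing.unit -> p != 0 /\ p = (p@_0%MM)%:MP.
Proof.
move=> pU; split; first by apply: contraTneq pU => ->; rewrite unitr0.
by move: pU => /andP[/eqP].
Qed.

Lemma mpoly_unitC (c : K) : c != 0 -> (c%:MP : S) \is a GRing.unit.
Proof. by move=> c0; apply/andP; rewrite mcoeffC eqxx mulr1 unitfE. Qed.

Lemma unit_dvdm1 p : dvd p 1 <-> p \is a GRing.unit.
Proof.
split=> [[c e]|pU]; last by exists p^-1; rewrite mulVr.
by apply/unitrP; exists c; rewrite [p * c]mulrC -e.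
Qed.

Lemma prime_irreducible q : q != 0 -> q \isn't a GRing.unit -> prime_mpoly q ->
  irreducible_mpoly q.
Proof.
move=> q0 qU pq; split=> // a b e.
have sym a' b' : q = a' * b' -> dvd q a' -> b' \is a GRing.unit.
  move=> e' [c ec]; apply/unit_dvdm1; exists c; apply: (mulfI q0).
  by rewrite mulr1 {1}e' ec; ring.
have /pq[d|d] : dvd q (a * b) by rewrite -e; apply: dvdm_refl.
  by right; apply: sym e d.
by left; apply: sym d; rewrite mulrC.
Qed.

Lemma meval0_nonunit q v : q.@[v] = 0 -> q \isn't a GRing.unit.
Proof.
move=> qv; apply/negP => /mpoly_unitE[+ eq].
by rewrite eq mevalC in qv; rewrite eq qv mpolyC0 eqxx.
Qed.

End MPolyTools.

(** * Primality of the Fermat forms *)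

Section HomExt.
Variables (R R' : comNzRingType) (g : {rmorphism R -> R'}) (u : R').

Definition hom_ext : {rmorphism {poly R} -> R'} := horner_eval u \o map_poly g.

Lemma hom_extE p : hom_ext p = (map_poly g p).[u]. Proof. by []. Qed.

Lemma hom_extC c : hom_ext c%:P = g c.
Proof. by rewrite hom_extE map_polyC hornerC. Qed.

Lemma hom_extX : hom_ext 'X = u.
Proof. by rewrite hom_extE map_polyX hornerX. Qed.

End HomExt.
Arguments hom_ext : simpl never.

Section Fermat.
Variables (K : numClosedFieldType).
Notation S := {mpoly K[3]}.

Definition fermat (c0 c1 : K) (l : nat) : S :=
  c0%:MP * 'X_0 ^+ l + c1%:MP * 'X_1 ^+ l + 'X_2 ^+ l.

Lemma ord3_cases (P : 'I_3 -> Prop) : P 0 -> P 1 -> P 2 -> forall i, P i.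
Proof.
move=> P0 P1 P2 [[|[|[|//]]] lt]; [move: P0|move: P1|move: P2];
  by congr (P _); apply: val_inj.
Qed.

Section Coordinates.
Variable w : K.

(* Polynomials in K[x][s][z], where y = w x + s. *)
Notation T := {poly {poly {poly K}}}.

Definition shear_var (i : 'I_3) : T :=
  if i == 0 then 'X%:P%:P
  else if i == 1 then (w%:P * 'X)%:P%:P + 'X%:P else 'X.

Definition to_tower : {rmorphism S -> T} :=
  mmap (polyC \o polyC \o polyC : {rmorphism K -> T}) shear_var.

Definition of_tower : {rmorphism T -> S} :=
  hom_ext (hom_ext (hom_ext (@mpolyC 3 K) 'X_0) ('X_1 - w%:MP * 'X_0)) 'X_2.

Lemma to_towerC c : to_tower c%:MP = c%:P%:P%:P.
Proof. by rewrite /to_tower /= mmapC. Qed.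

Lemma to_towerX i : to_tower 'X_i = shear_var i.
Proof. by rewrite /to_tower /= mmapX mmap1U. Qed.

Lemma of_towerCCC c : of_tower c%:P%:P%:P = c%:MP.
Proof. by rewrite /of_tower !hom_extC. Qed.

Lemma of_towerCCX : of_tower 'X%:P%:P = 'X_0.
Proof. by rewrite /of_tower !hom_extC hom_extX. Qed.

Lemma of_towerCX : of_tower 'X%:P = 'X_1 - w%:MP * 'X_0.
Proof. by rewrite /of_tower hom_extC hom_extX. Qed.

Lemma of_towerX : of_tower 'X = 'X_2.
Proof. exact: hom_extX. Qed.

Lemma to_towerK : cancel to_tower of_tower.
Proof.
move=> p; apply: (@mpoly_morph_ext K 3 S (of_tower \o to_tower) idfun) => [c|i].
  by rewrite -[LHS]/(of_tower (to_tower _)) to_towerC of_towerCCC.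
rewrite -[LHS]/(of_tower (to_tower _)) to_towerX /shear_var.
move: i; apply: ord3_cases.
- exact: of_towerCCX.
- have tD a b : of_tower (a + b) = of_tower a + of_tower b := rmorphD _ _ _.
  have tM a b : of_tower (a * b) = of_tower a * of_tower b := rmorphM _ _ _.
  rewrite -[LHS]/(of_tower ((w%:P * 'X)%:P%:P + 'X%:P)).
  by rewrite tD !polyCM tM of_towerCCC of_towerCCX of_towerCX addrC subrK.
- exact: of_towerX.
Qed.

End Coordinates.

Lemma prime_fermat c0 c1 l : c0 != 0 -> c1 != 0 -> (0 < l)%N ->
  prime_mpoly (fermat c0 c1 l).
Proof.
move=> c0n c1n l_gt0 A B [C E].
pose w : K := l.-root (- c0 / c1).
have wl : w ^+ l = - c0 / c1 by rewrite rootCK.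
have w0 : w != 0.
  apply/eqP => w00; move/eqP: wl.
  rewrite w00 expr0n gtn_eqF // eq_sym mulf_eq0 oppr_eq0 invr_eq0.
  by rewrite (negPf c0n) (negPf c1n).
have tM a b : to_tower w (a * b) = to_tower w a * to_tower w b := rmorphM _ _ _.
have oM a b : of_tower w (a * b) = of_tower w a * of_tower w b := rmorphM _ _ _.
have tD a b : to_tower w (a + b) = to_tower w a + to_tower w b := rmorphD _ _ _.
have tX a n : to_tower w (a ^+ n) = to_tower w a ^+ n := rmorphXn _ _ _.
pose g : {poly {poly K}} := (c0%:P * 'X ^+ l)%:P + c1%:P%:P * ((w%:P * 'X)%:P + 'X) ^+ l.
have tq : to_tower w (fermat c0 c1 l) = 'X^l + g%:P.
  rewrite /fermat /g !(tD, tM, tX) !to_towerC !to_towerX.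
  rewrite /shear_var /= addrC !polyCD !polyCM !rmorphXn /= !polyCD !polyCM.
  by [].
have g0 : g`_0 = 0.
  rewrite coefD coefC eqxx coefCM -horner_coef0.
  rewrite horner_exp hornerD hornerC hornerX addr0 exprMn -rmorphXn /= wl.
  by rewrite mulrA -polyCM mulrCA divff // mulr1 polyCN mulNr subrr.
(* The coefficient of s is nonzero in characteristic zero, so s divides g exactly once. This is the
   Eisenstein condition at s. *)
have g1 : g`_1 = (c1 *+ l)%:P * (w%:P * 'X) ^+ l.-1.
  rewrite coefD coefC add0r coefCM.
  have -> : ((((w%:P * 'X)%:P + 'X) ^+ l)`_1 =
             ((((w%:P * 'X)%:P + 'X) ^+ l)^`())`_0) by rewrite coef_deriv mulr1n.
  rewrite deriv_exp derivD derivC derivX add0r mul1r coefMn -horner_coef0.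
  by rewrite horner_exp hornerD hornerC hornerX addr0 mulrnAr polyCMn mulrnAl.
have gE : g = 'X * drop_poly 1 g.
  apply/polyP=> -[|i]; first by rewrite coefXM g0.
  by rewrite coefXM /= coef_drop_poly addn1.
have h0 : (drop_poly 1 g)`_0 != 0.
  rewrite coef_drop_poly add0n g1 mulf_neq0 ?expf_neq0 //.
    by rewrite polyC_eq0 -mulr_natr mulf_neq0 // pnatr_eq0 -lt0n.
  by rewrite mulf_neq0 ?polyC_eq0 ?polyX_eq0.
have := congr1 (to_tower w) E; rewrite !tM tq gE => EE.
have [[A' eA]|[B' eB]] := eisenstein_prime l_gt0 h0 EE; [left|right].
- exists (of_tower w A'); rewrite -[A](to_towerK w) eA -gE -tq oM.
  by rewrite to_towerK.
- exists (of_tower w B'); rewrite -[B](to_towerK w) eB -gE -tq oM.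
  by rewrite to_towerK.
Qed.
End Fermat.

Lemma sum_ord3 (A : nmodType) (F : 'I_3 -> A) : \sum_i F i = F 0 + F 1 + F 2.
Proof.
rewrite !big_ord_recl big_ord0 addr0 addrA.
by congr (F _ + F _ + F _); apply: val_inj.
Qed.

(** * The gradient of the curve and the Koszul complex of the variables *)

Section RingIdentities.
Variable A : comNzRingType.
Implicit Types (x y z p q r u v w s t : A).

(** The conic tangent to the three coordinate lines; the curve is its preimage under (x : y : z) ->
    (x^k : y^k : z^k). *)
Definition curve_form a b c : A := a ^+ 2 + b ^+ 2 + c ^+ 2 - 2 * (a * b + a * c + b * c).

Lemma derivation_curve_form (d : A -> A) a b c :
  {morph d : u v / u - v} -> {morph d : u v / u + v} ->
  (forall u v, d (u * v) = d u * v + u * d v) ->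
  d (curve_form a b c) =
  2 * ((a - b - c) * d a + (b - a - c) * d b + (c - a - b) * d c).
Proof.
move=> dB dD dM; rewrite /curve_form !expr2 -[2]/(1 + 1 : A).
rewrite mulrDl mul1r dB !dD !dM; ring.
Qed.

(** In these three lemmas the Booleans are the Kronecker symbols produced by differentiating powers
    of the variables. *)
Lemma pick_term0 (k : nat) (l0 l1 l2 p q r : A) :
  l0 * ((true * k)%:R * p) + l1 * ((false * k)%:R * q) + l2 * ((false * k)%:R * r)
  = k%:R * (p * l0).
Proof. by rewrite !mul0n mul1n; ring. Qed.

Lemma pick_term1 (k : nat) (l0 l1 l2 p q r : A) :
  l0 * ((false * k)%:R * p) + l1 * ((true * k)%:R * q) + l2 * ((false * k)%:R * r)
  = k%:R * (q * l1).
Proof. by rewrite !mul0n mul1n; ring. Qed.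

Lemma pick_term2 (k : nat) (l0 l1 l2 p q r : A) :
  l0 * ((false * k)%:R * p) + l1 * ((false * k)%:R * q) + l2 * ((true * k)%:R * r)
  = k%:R * (r * l2).
Proof. by rewrite !mul0n mul1n; ring. Qed.

End RingIdentities.

Lemma ord3_neqE :
  ((((0 : 'I_3) == 1) = false) * (((1 : 'I_3) == 0) = false) *
   (((0 : 'I_3) == 2) = false) * (((2 : 'I_3) == 0) = false) *
   (((1 : 'I_3) == 2) = false) * (((2 : 'I_3) == 1) = false))%type.
Proof. by []. Qed.

(** Exactness by reduction modulo x: [g2'] and [g3'] are the values at x = 0, where the relation
    forces them to be m z and - m y, and [u2], [u3] record what was lost in the reduction. *)
Lemma koszul_step (A : idomainType) (x y z g1 g2 g3 g2' g3' m u2 u3 : A) :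
  x != 0 -> z != 0 -> x * g1 + y * g2 + z * g3 = 0 -> y * g2' + z * g3' = 0 ->
  g2' = m * z -> g2 - g2' = u2 * x -> g3 - g3' = u3 * x ->
  [/\ g1 = y * - u2 - z * u3, g2 = z * m - x * - u2 & g3 = x * u3 - y * m].
Proof.
move=> nx nz e e0 em /eqP; rewrite subr_eq => /eqP E2 /eqP; rewrite subr_eq => /eqP E3.
have e3' : g3' = - (y * m).
  by apply: (mulfI nz); rewrite -[LHS](addKr (y * g2')) e0 em; ring.
split; [apply: (mulfI nx)|by rewrite E2 em; ring|by rewrite E3 e3'; ring].
have -> : x * g1 = - (y * g2 + z * g3) by apply/eqP; rewrite -addr_eq0 addrA e.
by rewrite E2 E3 em e3'; ring.
Qed.

Section Gradient.
Variables (K : numClosedFieldType) (k' : nat).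
Notation S := {mpoly K[3]}.
Notation x := ('X_0 : S).
Notation y := ('X_1 : S).
Notation z := ('X_2 : S).
Notation P := (x ^+ k').
Notation Q := (y ^+ k').
Notation R := (z ^+ k').
Notation dvd := (@principal_ideal K _).

Let f : S := plane_curve_poly K k'.+1.

Lemma curveE : f = curve_form (x * P) (y * Q) (z * R).
Proof. by rewrite /f /plane_curve_poly /curve_form !(mulnC 2%N) !exprM -!exprS. Qed.

Lemma mderivXn n (i j : 'I_n) m :
  ('X_i ^+ m.+1 : {mpoly K[n]})^`M(j) = ((i == j) * m.+1)%:R * 'X_i ^+ m.
Proof.
rewrite mpolyXn mderivX mulmnE mnm1E scaler_nat mulr_natl.
case: eqP => [->|_]; last by rewrite !mul0n !mulr0n.
by rewrite mulmS addmC addmK mpolyXn.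
Qed.

Definition lin (i : 'I_3) : S :=
  let a := x * P in let b := y * Q in let c := z * R in
  if i == 0 then a - b - c else if i == 1 then b - a - c else c - a - b.

(** The i-th partial derivative of the curve divided by the unit 2k, as [mderiv_curve] shows. *)
Definition grad (i : 'I_3) : S := 'X_i ^+ k' * lin i.

Lemma mderiv_curve i : f^`M(i) = (2 * k'.+1)%:R * grad i.
Proof.
have dX j : ('X_j * 'X_j ^+ k' : S)^`M(i) = ((j == i) * k'.+1)%:R * 'X_j ^+ k'.
  by rewrite -exprS mderivXn.
rewrite curveE (derivation_curve_form _ _ _ (mderivB i) (mderivD i) (mderivM i)).
rewrite !dX /grad [(2 * _)%:R]natrM -[RHS]mulrA; congr (_ * _).
move: i {dX}; apply: ord3_cases.
- exact: pick_term0.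
- exact: pick_term1.
- exact: pick_term2.
Qed.

Lemma natr_mpoly_unit n (m : nat) : (m.+1%:R : {mpoly K[n]}) \is a GRing.unit.
Proof. by rewrite -mpolyC_nat mpoly_unitC // pnatr_eq0. Qed.

Lemma jacobianP h : jacobian_ideal f h <->
  exists a b c, h = a * grad 0 + b * grad 1 + c * grad 2.
Proof.
have uU : ((2 * k'.+1)%:R : S) \is a GRing.unit by rewrite mul2n doubleS natr_mpoly_unit.
move: mderiv_curve uU; move: (_%:R : S) => t gE tU.
split=> [[a ->]|[a [b [c ->]]]].
  by exists (a 0 * t), (a 1 * t), (a 2 * t); rewrite sum_ord3 !gE !mulrA.
exists (fun i : 'I_3 => tnth [tuple a / t; b / t; c / t] i).
by rewrite sum_ord3 !gE !mulrA /tnth /= !divrK.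
Qed.

Lemma AR_curveP (rho : 'rV[S]_3) : AR f rho <->
  rho 0 0 * grad 0 + rho 0 1 * grad 1 + rho 0 2 * grad 2 = 0.
Proof.
have uU : ((2 * k'.+1)%:R : S) \is a GRing.unit by rewrite mul2n doubleS natr_mpoly_unit.
move: mderiv_curve uU; rewrite /AR sum_ord3; move: (_%:R : S) => t gE tU.
rewrite !gE !mulrA ![_ * t]mulrC -!mulrA -!mulrDr.
split=> [e|->]; last by rewrite mulr0.
by apply: (mulrI tU); rewrite e mulr0.
Qed.

(** Multiplication by [v] is injective modulo [u]. This form of coprimality passes to products on
    either side without any factorization theory. *)
Definition coprimem (u v : S) := forall w, dvd u (v * w) -> dvd u w.

Lemma coprimem_prime q v : prime_mpoly q -> ~ dvd q v -> coprimem q v.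
Proof. by move=> pq nqv w /pq[]. Qed.

Lemma coprimem_mull u u' v : u != 0 -> coprimem u v -> coprimem u' v ->
  coprimem (u * u') v.
Proof.
move=> u0 cu cu' w [c e].
have [w' ew] : dvd u w by apply: cu; exists (c * u'); rewrite e; ring.
have [w2 ew2] : dvd u' w'.
  apply: cu'; exists c; apply: (mulfI u0).
  have -> : u * (v * w') = v * (w' * u) by ring.
  by rewrite -ew e; ring.
by exists w2; rewrite ew ew2; ring.
Qed.

Lemma coprimem_mulr u v v' : coprimem u v -> coprimem u v' -> coprimem u (v * v').
Proof. by move=> cv cv' w; rewrite -mulrA => /cv/cv'. Qed.

Lemma coprimem1r u : coprimem u 1.
Proof. by move=> w; rewrite mul1r. Qed.

Lemma coprimem1l v : coprimem 1 v.
Proof. by move=> w _; exists w; rewrite mulr1. Qed.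

Lemma coprimem_expl u v n : u != 0 -> coprimem u v -> coprimem (u ^+ n) v.
Proof.
move=> u0 cuv; elim: n => [|n IH]; first exact: coprimem1l.
by rewrite exprS; apply: coprimem_mull.
Qed.

Lemma coprimem_expr u v n : coprimem u v -> coprimem u (v ^+ n).
Proof.
move=> cuv; elim: n => [|n IH]; first exact: coprimem1r.
by rewrite exprS; apply: coprimem_mulr.
Qed.

Definition pt3 (a b c : K) (i : 'I_3) : K := [:: a; b; c]`_i.

Lemma mevalXn n (v : 'I_n -> K) i m : ('X_i ^+ m : {mpoly K[n]}).@[v] = v i ^+ m.
Proof. by rewrite rmorphXn /= mevalXU. Qed.

Lemma coprimem_eval q p v : prime_mpoly q -> q.@[v] = 0 -> p.@[v] != 0 ->
  coprimem q p.
Proof.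
move=> pq q0 p0; apply: coprimem_prime => // d.
by move: p0; rewrite (dvdm_eval d q0) eqxx.
Qed.

Lemma prime_lin0 : prime_mpoly (lin 0).
Proof.
have -> : lin 0 = - fermat (-1) 1 k'.+1.
  by rewrite /lin /fermat /= mpolyCN mpolyC1 !exprS; ring.
by apply: prime_mpolyN; apply: prime_fermat; rewrite ?oppr_eq0 ?oner_neq0.
Qed.

Lemma meval_lin0 (v : 'I_3 -> K) :
  (lin 0).@[v] = v 0 ^+ k'.+1 - v 1 ^+ k'.+1 - v 2 ^+ k'.+1.
Proof. by rewrite /lin eqxx 2!mevalB !mevalM !mevalXn !mevalXU -!exprS. Qed.

Lemma meval_lin1 (v : 'I_3 -> K) :
  (lin 1).@[v] = v 1 ^+ k'.+1 - v 0 ^+ k'.+1 - v 2 ^+ k'.+1.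
Proof.
by rewrite /lin ord3_neqE eqxx 2!mevalB !mevalM !mevalXn !mevalXU -!exprS.
Qed.

Lemma meval_lin2 (v : 'I_3 -> K) :
  (lin 2).@[v] = v 2 ^+ k'.+1 - v 0 ^+ k'.+1 - v 1 ^+ k'.+1.
Proof.
by rewrite /lin !ord3_neqE 2!mevalB !mevalM !mevalXn !mevalXU -!exprS.
Qed.

Lemma meval_grad (v : 'I_3 -> K) i : (grad i).@[v] = v i ^+ k' * (lin i).@[v].
Proof. by rewrite mevalM mevalXn. Qed.

Lemma neq0_meval (p : S) v : p.@[v] != 0 -> p != 0.
Proof. by apply: contraNneq => ->; rewrite meval0. Qed.

#[local] Opaque lin grad.

(** [grad 0] is a product of the primes x and [lin 0]. Each of them is separated from each factor of
    [grad 1] by a point at which the prime vanishes and the factor does not. *)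
Lemma coprimem_grad : coprimem (grad 0) (grad 1).
Proof.
have X0 (i : 'I_3) : 'X_i != 0 :> S := mpolyX_neq0 K U_(i).
have evX (v : 'I_3 -> K) i : ('X_i : S).@[v] = v i := mevalXU v i.
rewrite -[grad 0]/('X_0 ^+ k' * lin 0) -[grad 1]/('X_1 ^+ k' * lin 1).
apply: coprimem_mull; first by rewrite expf_neq0.
  apply: coprimem_expl => //; apply: coprimem_mulr.
    apply: coprimem_expr; apply: (@coprimem_eval _ _ (pt3 0 1 0)).
    - exact: prime_mpolyXi.
    - by rewrite evX.
    - by rewrite evX oner_neq0.
  apply: (@coprimem_eval _ _ (pt3 0 1 0)).
  - exact: prime_mpolyXi.
  - by rewrite evX.
  - rewrite meval_lin1.
    by rewrite /pt3 /= !expr0n expr1n !subr0 oner_neq0.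
apply: coprimem_mulr.
  apply: coprimem_expr; apply: (@coprimem_eval _ _ (pt3 1 1 0)).
  - exact: prime_lin0.
  - rewrite meval_lin0.
    by rewrite /pt3 /= !expr0n expr1n !subr0 subrr.
  - by rewrite evX oner_neq0.
apply: (@coprimem_eval _ _ (pt3 1 0 1)).
- exact: prime_lin0.
- rewrite meval_lin0.
  by rewrite /pt3 /= !expr0n expr1n !subr0 subrr.
- rewrite meval_lin1.
  rewrite /pt3 /= !expr0n expr1n sub0r -opprD oppr_eq0.
  by rewrite -mulr2n pnatr_eq0.
Qed.

Lemma grad_neq0 i : grad i != 0.
Proof.
apply: (@neq0_meval _ (fun j => (i == j)%:R)).
rewrite meval_grad eqxx expr1n mul1r.
move: i; apply: ord3_cases; rewrite ?(meval_lin0, meval_lin1, meval_lin2).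
- by rewrite eqxx !ord3_neqE expr1n !expr0n !subr0 oner_neq0.
- by rewrite eqxx !ord3_neqE expr1n !expr0n !subr0 oner_neq0.
- by rewrite eqxx !ord3_neqE expr1n !expr0n !subr0 oner_neq0.
Qed.

Lemma koszul (g1 g2 g3 : S) : x * g1 + y * g2 + z * g3 = 0 ->
  exists h1 h2 h3, [/\ g1 = y * h3 - z * h2, g2 = z * h1 - x * h3 &
                       g3 = x * h2 - y * h1].
Proof.
move=> e.
have [u2 e2] := subst0P (0 : 'I_3) g2; have [u3 e3] := subst0P (0 : 'I_3) g3.
set g2' := subst0 K (0 : 'I_3) g2 in e2; set g3' := subst0 K (0 : 'I_3) g3 in e3.
have e0 : y * g2' + z * g3' = 0.
  have := congr1 (subst0 K (0 : 'I_3)) e.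
  rewrite !rmorphD !rmorphM /= -![comp_mpoly _ _]/(subst0 K (0 : 'I_3) _).
  by rewrite !subst0X eqxx !ord3_neqE mul0r add0r rmorph0.
have nz : z != 0 by apply: mpolyX_neq0.
have nx : x != 0 by apply: mpolyX_neq0.
have [m em] : dvd z g2'.
  have cz : coprimem z y.
    apply: (@coprimem_eval _ _ (pt3 0 1 0)); first exact: prime_mpolyXi.
      by rewrite mevalXU.
    by rewrite mevalXU oner_neq0.
  by apply: cz; exists (- g3'); apply/eqP; rewrite mulNr -addr_eq0 [g3' * _]mulrC e0.
exists m, u3, (- u2).
exact: koszul_step nx nz e e0 em e2 e3.
Qed.

End Gradient.

#[global] Opaque lin grad.

(** * Syzygies of the gradient and the socle of the Jacobian ring *)

Section LinearCombination.
Variable A : comNzRingType.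
Implicit Types c e X : A.

Lemma lc1 c e X : e = 0 -> X = c * e -> X = 0.
Proof. by move=> -> ->; rewrite mulr0. Qed.

Lemma lc2 c1 c2 e1 e2 X : e1 = 0 -> e2 = 0 -> X = c1 * e1 + c2 * e2 -> X = 0.
Proof. by move=> -> -> ->; rewrite !mulr0 addr0. Qed.

Lemma lc3 c1 c2 c3 e1 e2 e3 X : e1 = 0 -> e2 = 0 -> e3 = 0 ->
  X = c1 * e1 + c2 * e2 + c3 * e3 -> X = 0.
Proof. by move=> -> -> -> ->; rewrite !mulr0 !addr0. Qed.

Lemma eq0E (a b : A) : a = b -> a - b = 0.
Proof. by move=> ->; rewrite subrr. Qed.

Lemma sub0E (a b : A) : a - b = 0 -> a = b.
Proof. by move/eqP; rewrite subr_eq0 => /eqP. Qed.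

End LinearCombination.

Section Syzygies.
Variables (A : idomainType) (x y z P Q R : A).
Notation gx := (P * (x * P - y * Q - z * R)).
Notation gy := (Q * (y * Q - x * P - z * R)).
Notation gz := (R * (z * R - x * P - y * Q)).

Notation r11 := (y * Q - z * R). Notation r12 := (y * P). Notation r13 := (- (z * P)).
Notation r21 := (- (x * Q)). Notation r22 := (z * R - x * P). Notation r23 := (z * Q).
Notation r31 := (x * R). Notation r32 := (- (y * R)). Notation r33 := (x * P - y * Q).

Hypotheses (gx0 : gx != 0) (gy0 : gy != 0) (x0 : x != 0).
Hypothesis gxy : forall w w', w * gy = w' * gx -> exists t, w = t * gx.
Hypothesis xy : forall w w', w * y = w' * x -> exists t, w = t * x.
Hypothesis koszulA : forall g1 g2 g3, x * g1 + y * g2 + z * g3 = 0 ->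
  exists h1 h2 h3, [/\ g1 = y * h3 - z * h2, g2 = z * h1 - x * h3 &
                       g3 = x * h2 - y * h1].

Lemma syz1 : r11 * gx + r12 * gy + r13 * gz = 0. Proof. by ring. Qed.
Lemma syz2 : r21 * gx + r22 * gy + r23 * gz = 0. Proof. by ring. Qed.
Lemma syz3 : r31 * gx + r32 * gy + r33 * gz = 0. Proof. by ring. Qed.

(* Two vectors orthogonal to the gradient have their cross product proportional
   to it; the proportionality factor is a polynomial because the partial
   derivatives are coprime. *)
Lemma cross_grad v1 v2 v3 r1 r2 r3 :
  v1 * gx + v2 * gy + v3 * gz = 0 -> r1 * gx + r2 * gy + r3 * gz = 0 ->
  exists t, [/\ v2 * r3 - v3 * r2 = t * gx, v3 * r1 - v1 * r3 = t * gy &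
                v1 * r2 - v2 * r1 = t * gz].
Proof.
move=> ev er.
have e12 : (v2 * r3 - v3 * r2) * gy = (v3 * r1 - v1 * r3) * gx.
  by apply: sub0E; apply: (lc2 (c1 := r3) (c2 := - v3) ev er); ring.
have [t et] := gxy e12; exists t; split=> //; apply: (mulIf gx0).
  by rewrite -e12 et; ring.
apply: sub0E.
by apply: (lc3 (c1 := r2) (c2 := - v2) (c3 := gz) ev er (eq0E et)); ring.
Qed.

Lemma syzygies_generate v1 v2 v3 : v1 * gx + v2 * gy + v3 * gz = 0 ->
  exists h1 h2 h3, [/\ v1 = h1 * r11 + h2 * r21 + h3 * r31,
    v2 = h1 * r12 + h2 * r22 + h3 * r32 & v3 = h1 * r13 + h2 * r23 + h3 * r33].
Proof.
move=> ev.
have [g1 [e11 e12 e13]] := cross_grad ev syz1.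
have [g2 [e21 e22 e23]] := cross_grad ev syz2.
have [g3 [e31 e32 e33]] := cross_grad ev syz3.
have eg : x * g1 + y * g2 + z * g3 = 0.
  apply: (mulIf gx0); rewrite mul0r.
  by apply: (lc3 (c1 := - x) (c2 := - y) (c3 := - z) (eq0E e11) (eq0E e21) (eq0E e31)); ring.
have [h1 [h2 [h3 [E1 E2 E3]]]] := koszulA eg.
(* The cross product of r2 and r3 is - x times the gradient. Eliminating between the cross products
   of v with r2 and with r3 therefore gives x v = g2 r3 - g3 r2. *)
have xv1 : x * v1 = g2 * r31 - g3 * r21.
  apply: (mulIf gy0); apply: sub0E.
  by apply: (lc2 (c1 := r31) (c2 := - r21) (eq0E e22) (eq0E e32)); ring.
have xv2 : x * v2 = g2 * r32 - g3 * r22.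
  apply: (mulIf gx0); apply: sub0E.
  by apply: (lc2 (c1 := r32) (c2 := - r22) (eq0E e21) (eq0E e31)); ring.
have xv3 : x * v3 = g2 * r33 - g3 * r23.
  apply: (mulIf gy0); apply: sub0E.
  by apply: (lc2 (c1 := r33) (c2 := - r23) (eq0E e22) (eq0E e32)); ring.
(* Since y r2 + z r3 = - x r1, inserting the Koszul form of g2 and g3 makes the right-hand side - x
   (h1 r1 + h2 r2 + h3 r3). *)
exists (- h1), (- h2), (- h3); split; apply: (mulfI x0).
- by rewrite xv1 E2 E3; ring.
- by rewrite xv2 E2 E3; ring.
- by rewrite xv3 E2 E3; ring.
Qed.

(** The 2x2 minors of the matrix of the r_i are coordinates times partial derivatives, up to sign.
    Eliminating one unknown and cancelling [gx] leaves t1 y = t2 x and t1 z = t3 x. *)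
Lemma second_syzygy t1 t2 t3 :
  t1 * r11 + t2 * r21 + t3 * r31 = 0 -> t1 * r12 + t2 * r22 + t3 * r32 = 0 ->
  t1 * r13 + t2 * r23 + t3 * r33 = 0 ->
  exists g, [/\ t1 = g * x, t2 = g * y & t3 = g * z].
Proof.
move=> e1 e2 e3.
have e12 : t1 * y = t2 * x.
  apply: (mulIf gx0); apply: sub0E.
  by apply: (lc2 (c1 := r33) (c2 := - r32) e2 e3); ring.
have e13 : t1 * z = t3 * x.
  apply: (mulIf gx0); apply: sub0E.
  by apply: (lc2 (c1 := - r23) (c2 := r22) e2 e3); ring.
have [g eg] := xy e12; exists g; split=> //; apply: (mulIf x0).
  by rewrite -e12 eg; ring.
by rewrite -e13 eg; ring.
Qed.

(** Stands for the scalars; [cst_max] says that a scalar in the ideal of x, y, z is zero. *)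
Variable cst : A -> Prop.
Hypothesis cst_max : forall c p q r, cst c -> c = x * p + y * q + z * r -> c = 0.

(* If x h, y h and z h lie in J + K PQR, their representations are compatible up to
   syzygies; comparing these syzygies twice through the Koszul complex puts h in
   J + (PQR). *)
Lemma socle_step al be ga h a1 a2 a3 b1 b2 b3 c1 c2 c3 :
  cst al -> cst be -> cst ga ->
  x * h = a1 * gx + a2 * gy + a3 * gz + al * (2 * (P * Q * R)) ->
  y * h = b1 * gx + b2 * gy + b3 * gz + be * (2 * (P * Q * R)) ->
  z * h = c1 * gx + c2 * gy + c3 * gz + ga * (2 * (P * Q * R)) ->
  exists u1 u2 u3 t, h = u1 * gx + u2 * gy + u3 * gz + t * (2 * (P * Q * R)).
Proof.
move=> cal cbe cga ex ey ez.
(* From z (y h) = y (z h). The terms in [be] and [ga] come from writing 2 z PQR and 2 y PQR as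
   explicit elements of J. The next two syzygies arise cyclically. *)
have [A1 [A2 [A3 [E11 E12 E13]]]] : exists A1 A2 A3,
    [/\ z * b1 - y * c1 - be * Q + ga * R = A1 * r11 + A2 * r21 + A3 * r31,
        z * b2 - y * c2 - be * P = A1 * r12 + A2 * r22 + A3 * r32 &
        z * b3 - y * c3 + ga * P = A1 * r13 + A2 * r23 + A3 * r33].
  apply: syzygies_generate.
  by apply: (lc2 (c1 := - z) (c2 := y) (eq0E ey) (eq0E ez)); ring.
have [B1 [B2 [B3 [E21 E22 E23]]]] : exists B1 B2 B3,
    [/\ x * c1 - z * a1 + al * Q = B1 * r11 + B2 * r21 + B3 * r31,
        x * c2 - z * a2 - ga * R + al * P = B1 * r12 + B2 * r22 + B3 * r32 &
        x * c3 - z * a3 - ga * Q = B1 * r13 + B2 * r23 + B3 * r33].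
  apply: syzygies_generate.
  by apply: (lc2 (c1 := - x) (c2 := z) (eq0E ez) (eq0E ex)); ring.
have [C1 [C2 [C3 [E31 E32 E33]]]] : exists C1 C2 C3,
    [/\ y * a1 - x * b1 - al * R = C1 * r11 + C2 * r21 + C3 * r31,
        y * a2 - x * b2 + be * R = C1 * r12 + C2 * r22 + C3 * r32 &
        y * a3 - x * b3 - al * P + be * Q = C1 * r13 + C2 * r23 + C3 * r33].
  apply: syzygies_generate.
  by apply: (lc2 (c1 := - y) (c2 := x) (eq0E ex) (eq0E ey)); ring.
(* Adding the three syzygies with factors x, y, z cancels all the a, b, c and leaves al r1 + be r2 +
   ga r3, so the difference is a relation between the r_i. *)
have [t [et1 et2 et3]] : exists t,
    [/\ x * A1 + y * B1 + z * C1 - al = t * x,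
        x * A2 + y * B2 + z * C2 - be = t * y &
        x * A3 + y * B3 + z * C3 - ga = t * z].
  apply: second_syzygy.
  - apply: (lc3 (c1 := - x) (c2 := - y) (c3 := - z) (eq0E E11) (eq0E E21) (eq0E E31)).
    by ring.
  - apply: (lc3 (c1 := - x) (c2 := - y) (c3 := - z) (eq0E E12) (eq0E E22) (eq0E E32)).
    by ring.
  - apply: (lc3 (c1 := - x) (c2 := - y) (c3 := - z) (eq0E E13) (eq0E E23) (eq0E E33)).
    by ring.
(* The relation puts each of the scalars in the ideal of x, y, z, so the socle terms disappear from
   the three representations. *)
have al0 : al = 0.
  apply: (cst_max (p := A1 - t) (q := B1) (r := C1) cal); apply: sub0E.
  by apply: (lc1 (c := - 1) (eq0E et1)); ring.
have be0 : be = 0.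
  apply: (cst_max (p := A2) (q := B2 - t) (r := C2) cbe); apply: sub0E.
  by apply: (lc1 (c := - 1) (eq0E et2)); ring.
have ga0 : ga = 0.
  apply: (cst_max (p := A3) (q := B3) (r := C3 - t) cga); apply: sub0E.
  by apply: (lc1 (c := - 1) (eq0E et3)); ring.
move: ex ey ez E11 E12 E13 E21 E22 E23 E31 E32 E33 et1 et2 et3.
rewrite al0 be0 ga0 !mul0r !subr0 !addr0.
move=> ex ey ez E11 E12 E13 E21 E22 E23 E31 E32 E33 et1 et2 et3.
(* Each component of x A + y B + z C = t (x, y, z) is a Koszul relation once t is subtracted on the
   diagonal. *)
have [p1 [q1 [s1 [F11 F12 F13]]]] : exists p q s,
    [/\ A1 - t = y * s - z * q, B1 = z * p - x * s & C1 = x * q - y * p].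
  by apply: koszulA; apply: (lc1 (c := 1) (eq0E et1)); ring.
have [p2 [q2 [s2 [F21 F22 F23]]]] : exists p q s,
    [/\ A2 = y * s - z * q, B2 - t = z * p - x * s & C2 = x * q - y * p].
  by apply: koszulA; apply: (lc1 (c := 1) (eq0E et2)); ring.
have [p3 [q3 [s3 [F31 F32 F33]]]] : exists p q s,
    [/\ A3 = y * s - z * q, B3 = z * p - x * s & C3 - t = x * q - y * p].
  by apply: koszulA; apply: (lc1 (c := 1) (eq0E et3)); ring.
(* With C in Koszul form, y a - x b = C1 r1 + C2 r2 + C3 r3 separates into a multiple of y and a
   multiple of x. The corrected coefficients a are thus divisible by x, and the quotients represent
   h. *)
have [u1 eu1] : exists u, a1 + (p1 * r11 + p2 * r21 + p3 * r31) = u * x.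
  apply: (xy (w' := b1 + t * R + (q1 * r11 + q2 * r21 + q3 * r31))); apply: sub0E.
  apply: (lc1 (c := 1) (eq0E E31)).
  by move/eqP: F33; rewrite subr_eq F13 F23 => /eqP ->; ring.
have [u2 eu2] : exists u, a2 + t * R + (p1 * r12 + p2 * r22 + p3 * r32) = u * x.
  apply: (xy (w' := b2 + (q1 * r12 + q2 * r22 + q3 * r32))); apply: sub0E.
  apply: (lc1 (c := 1) (eq0E E32)).
  by move/eqP: F33; rewrite subr_eq F13 F23 => /eqP ->; ring.
have [u3 eu3] : exists u, a3 + t * Q + (p1 * r13 + p2 * r23 + p3 * r33) = u * x.
  apply: (xy (w' := b3 + t * P + (q1 * r13 + q2 * r23 + q3 * r33))); apply: sub0E.
  apply: (lc1 (c := 1) (eq0E E33)).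
  by move/eqP: F33; rewrite subr_eq F13 F23 => /eqP ->; ring.
exists u1, u2, u3, t; apply: (mulfI x0); rewrite ex; apply: sub0E.
by apply: (lc3 (c1 := gx) (c2 := gy) (c3 := gz) (eq0E eu1) (eq0E eu2) (eq0E eu3)); ring.
Qed.

End Syzygies.

(** * Near freeness and exponents *)

Section NearlyFree.
Variables (K : numClosedFieldType) (k' : nat).
Notation S := {mpoly K[3]}.
Notation x := ('X_0 : S).
Notation y := ('X_1 : S).
Notation z := ('X_2 : S).
Notation P := (x ^+ k').
Notation Q := (y ^+ k').
Notation R := (z ^+ k').
Notation g0 := (P * (x * P - y * Q - z * R)).
Notation g1 := (Q * (y * Q - x * P - z * R)).
Notation g2 := (R * (z * R - x * P - y * Q)).

Let f : S := plane_curve_poly K k'.+1.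
Let J := jacobian_ideal f.

Lemma grad0E : grad K k' 0 = g0. Proof. by []. Qed.
Lemma grad1E : grad K k' 1 = g1. Proof. by []. Qed.
Lemma grad2E : grad K k' 2 = g2. Proof. by []. Qed.

Lemma jacobianE h : J h <-> exists a b c, h = a * g0 + b * g1 + c * g2.
Proof. exact: jacobianP. Qed.

Lemma g0_neq0 : g0 != 0. Proof. exact: (grad_neq0 K k' 0). Qed.
Lemma g1_neq0 : g1 != 0. Proof. exact: (grad_neq0 K k' 1). Qed.
Lemma X_neq0 (i : 'I_3) : 'X_i != 0 :> S. Proof. exact: mpolyX_neq0. Qed.

Lemma g0_coprime w w' : w * g1 = w' * g0 -> exists t, w = t * g0.
Proof.
move=> e; apply: (@coprimem_grad K k'); exists w'.
exact: etrans (mulrC _ _) e.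
Qed.

Lemma X01_coprime (w w' : S) : w * y = w' * x -> exists t, w = t * x.
Proof.
move=> e; have : coprimem x y.
  apply: (@coprimem_eval _ _ _ (pt3 0 1 0)); first exact: prime_mpolyXi.
    by rewrite mevalXU.
  by rewrite mevalXU oner_neq0.
by apply; exists w'; exact: etrans (mulrC _ _) e.
Qed.

Definition syz (i : 'I_3) : 'rV[S]_3 := \row_j
  tnth (tnth [tuple [tuple y * Q - z * R; y * P; - (z * P)];
        [tuple - (x * Q); z * R - x * P; z * Q];
        [tuple x * R; - (y * R); x * P - y * Q]] i) j.

Lemma homog_X (i : 'I_3) : ('X_i : S) \is 1.-homog.
Proof. by rewrite dhomogX /= mdeg1. Qed.

Lemma homog_Xn (i : 'I_3) n : ('X_i ^+ n : S) \is n.-homog.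
Proof. by have := dhomogMn n (homog_X i); rewrite mul1n. Qed.

Lemma homog_XXn (i j : 'I_3) : ('X_i * 'X_j ^+ k' : S) \is (k'.+1).-homog.
Proof. by rewrite -[k'.+1]add1n; apply: dhomogM; [apply: homog_X|apply: homog_Xn]. Qed.

Lemma syz_homog i j : syz i 0 j \is (k'.+1).-homog.
Proof.
rewrite mxE; move: i j; apply: ord3_cases; apply: ord3_cases;
  rewrite !(tnth_nth 0) /=; rewrite ?rpredB ?rpredN ?homog_XXn //.
Qed.

Lemma syz_AR i : AR f (syz i).
Proof.
apply/AR_curveP; rewrite grad0E grad1E grad2E !mxE !(tnth_nth 0).
move: i; apply: ord3_cases => /=.
- exact: syz1.
- exact: syz2.
- exact: syz3.
Qed.

End NearlyFree.

Section Combinations.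
Variable A : comNzRingType.
Implicit Types a b c : A.

Lemma comb0 a b c : 0 = 0 * a + 0 * b + 0 * c :> A.
Proof. by ring. Qed.

Lemma combD a1 a2 a3 b1 b2 b3 a b c : a1 * a + a2 * b + a3 * c +
  (b1 * a + b2 * b + b3 * c) = (a1 + b1) * a + (a2 + b2) * b + (a3 + b3) * c.
Proof. by ring. Qed.

Lemma comb_ext a b c d t : a + c * t + (b + d * t) = a + b + (c + d) * t.
Proof. by ring. Qed.

Lemma half_comb h a b : h * 2 = 1 -> a * b = h * (a * (2 * b)).
Proof. by move=> e; rewrite [RHS](_ : _ = h * 2 * (a * b)); [rewrite e mul1r|ring]. Qed.

Lemma combM a1 a2 a3 a b c d : d * (a1 * a + a2 * b + a3 * c) =
  (d * a1) * a + (d * a2) * b + (d * a3) * c.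
Proof. by ring. Qed.

(** Regrouping shows that J lies in the ideal of the powers x^(k+1), y^(k+1), z^(k+1), none of whose
    elements contains the monomial (xyz)^k. *)
Lemma gradient_powers k (a b c x y z : A) :
  let p := x ^+ k in let q := y ^+ k in let r := z ^+ k in
  a * (p * (x * p - y * q - z * r)) + b * (q * (y * q - x * p - z * r)) +
  c * (r * (z * r - x * p - y * q)) =
  (a * p - b * q - c * r) * x ^+ k.+1 + (b * q - a * p - c * r) * y ^+ k.+1 +
  (c * r - a * p - b * q) * z ^+ k.+1.
Proof. by move=> p q r; rewrite !exprS -/p -/q -/r; ring. Qed.

Section Socle.
Variables x y z p q r : A.
Notation g0 := (p * (x * p - y * q - z * r)).
Notation g1 := (q * (y * q - x * p - z * r)).
Notation g2 := (r * (z * r - x * p - y * q)).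

Lemma socle_comb0 : x * (2 * (p * q * r)) = 0 * g0 + - r * g1 + - q * g2.
Proof. by ring. Qed.

Lemma socle_comb1 : y * (2 * (p * q * r)) = - r * g0 + 0 * g1 + - p * g2.
Proof. by ring. Qed.

Lemma socle_comb2 : z * (2 * (p * q * r)) = - q * g0 + - p * g1 + 0 * g2.
Proof. by ring. Qed.

End Socle.
End Combinations.

Section NearlyFreeCurve.
Variables (K : numClosedFieldType) (k' : nat).
Notation S := {mpoly K[3]}.
Notation x := ('X_0 : S).
Notation y := ('X_1 : S).
Notation z := ('X_2 : S).
Notation P := (x ^+ k').
Notation Q := (y ^+ k').
Notation R := (z ^+ k').
Notation g0 := (P * (x * P - y * Q - z * R)).
Notation g1 := (Q * (y * Q - x * P - z * R)).
Notation g2 := (R * (z * R - x * P - y * Q)).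

Let f : S := plane_curve_poly K k'.+1.
Let J := jacobian_ideal f.
Notation syz := (@syz K k').

Lemma syz_generate v : AR f v -> exists c : 'I_3 -> S, v = \sum_i c i *: syz i.
Proof.
move=> /AR_curveP; rewrite grad0E grad1E grad2E => e.
have [h1 [h2 [h3 [E1 E2 E3]]]] := syzygies_generate (g0_neq0 K k') (g1_neq0 K k')
  (X_neq0 K 0) (@g0_coprime K k') (@koszul K) e.
exists (fun i => tnth [tuple h1; h2; h3] i).
apply/rowP=> j; rewrite sum_ord3 !mxE !(tnth_nth 0).
move: j; apply: ord3_cases => /=.
- exact: E1.
- exact: E2.
- exact: E3.
Qed.

(** At the coordinate point following the j-th one cyclically, only the diagonal entry survives in
    column j. A generator that is a combination of the other two would thus give 1 = 0. *)
Lemma syz_eval (i j : 'I_3) :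
  (syz i 0 j).@[fun l => (l == match val j with 0 => 1 | 1 => 2 | _ => 0 end)%:R]
  = (i == j)%:R.
Proof.
rewrite mxE !(tnth_nth 0); move: j i; apply: ord3_cases; apply: ord3_cases => /=;
by rewrite ?mevalB ?mevalN !mevalM !mevalXU ?mevalXn ?ord3_neqE ?eqxx ?mul1r
  ?expr1n ?mul0r ?subr0 ?sub0r ?opprK ?oppr0.
Qed.

Lemma syz_minimal : minimal_generators (AR f) syz.
Proof.
split; [exact: syz_AR | exact: syz_generate|] => j [c /rowP/(_ j)] e.
pose v := fun l : 'I_3 => (l == match val j with 0 => 1 | 1 => 2 | _ => 0 end)%:R : K.
move/(congr1 (meval v)): e; rewrite syz_eval eqxx summxE raddf_sum big1 => [/eqP|i ne].
  by rewrite oner_eq0.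
by rewrite /= mxE mevalM syz_eval (negPf ne) mulr0.
Qed.

Lemma curve_exponents : nearly_free_exponents (2 * k'.+1) f k'.+1 k'.+1 k'.+1.
Proof.
split=> //; first by rewrite leqnn.
  by rewrite mul2n -addnn addnK.
exists syz; split; first exact: syz_minimal.
move=> i j; have -> : tnth [tuple k'.+1; k'.+1; k'.+1] i = k'.+1.
  by move: i; apply: ord3_cases.
exact: syz_homog.
Qed.

Definition socle_mnm : 'X_{1..3} := (U_(0%R) *+ k' + U_(1%R) *+ k' + U_(2%R) *+ k')%MM.
Notation M0 := socle_mnm.

Lemma socle_mnmE i : M0 i = k'.
Proof.
rewrite !mnmDE !mulmnE !mnm1E.
by move: i; apply: ord3_cases; rewrite !ord3_neqE !eqxx !mul0n mul1n ?addn0.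
Qed.

Lemma mdeg_socle : mdeg M0 = (3 * k')%N.
Proof. by rewrite !mdegD !mdegMn !mdeg1 !mul1n; lia. Qed.

Lemma mpolyX_socle : 'X_[M0] = P * Q * R.
Proof. by rewrite !mpolyXD -!mpolyXn. Qed.

Lemma mcoeff_mulXn n (p : {mpoly K[n]}) (i : 'I_n) l (m : 'X_{1..n}) : (m i < l)%N ->
  (p * 'X_i ^+ l)@_m = 0.
Proof.
move=> ltm; rewrite mpolyXn; apply: memN_msupp_eq0.
rewrite (perm_mem (msuppMX _ _)); apply/mapP => -[m' _ em].
by move: ltm; rewrite em mnmDE mulmnE mnm1E eqxx mul1n ltnNge leq_addr.
Qed.

Lemma powers_socle_coeff (a b c : S) :
  (a * x ^+ k'.+1 + b * y ^+ k'.+1 + c * z ^+ k'.+1)@_M0 = 0.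
Proof.
have lt i : (M0 i < k'.+1)%N by rewrite socle_mnmE.
have ea := mcoeff_mulXn a (lt 0); have eb := mcoeff_mulXn b (lt 1).
have ec := mcoeff_mulXn c (lt 2).
have D (p q r : S) m : p@_m = 0 -> q@_m = 0 -> r@_m = 0 -> (p + q + r)@_m = 0.
  by move=> ep eq er; rewrite !mcoeffD ep eq er !addr0.
exact: D ea eb ec.
Qed.

Lemma jacobian_socle_coeff j : J j -> j@_M0 = 0.
Proof.
move=> /jacobianE[a [b [c ->]]]; rewrite gradient_powers.
exact: powers_socle_coeff.
Qed.

Lemma jacobian0 : J 0.
Proof. by apply/jacobianE; exists 0, 0, 0; apply: comb0. Qed.

Lemma jacobianD a b : J a -> J b -> J (a + b).
Proof.
move=> /jacobianE[a1 [a2 [a3 ->]]] /jacobianE[b1 [b2 [b3 ->]]].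
apply/jacobianE; exists (a1 + b1), (a2 + b2), (a3 + b3); exact: combD.
Qed.

Lemma jacobianM a b : J b -> J (a * b).
Proof.
move=> /jacobianE[b1 [b2 [b3 ->]]]; apply/jacobianE.
exists (a * b1), (a * b2), (a * b3); exact: combM.
Qed.

Lemma socle_jacobian (i : 'I_3) : J ('X_i * (2 * (P * Q * R))).
Proof.
apply/jacobianE; move: i; apply: ord3_cases.
- by exists 0, (- R), (- Q); apply: socle_comb0.
- by exists (- R), 0, (- P); apply: socle_comb1.
- by exists (- Q), (- P), 0; apply: socle_comb2.
Qed.

(** J + K PQR; the factor 2 matches the division-free identities [socle_comb0], [socle_comb1] and
    [socle_comb2]. *)
Definition socle_ext h := exists2 j, J j &
  exists c : K, h = j + c%:MP * (2 * (P * Q * R)).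

Lemma socle_extJ j : J j -> socle_ext j.
Proof. by move=> Jj; exists j => //; exists 0; rewrite mpolyC0 mul0r addr0. Qed.

Lemma socle_extD a b : socle_ext a -> socle_ext b -> socle_ext (a + b).
Proof.
move=> [i Ji [c ->]] [j Jj [d ->]]; exists (i + j); first exact: jacobianD.
by exists (c + d); rewrite mpolyCD; apply: comb_ext.
Qed.

(** Any nonconstant monomial multiplies 2PQR into J, so only the constant term of [t] leaves a socle
    part. *)
Lemma socle_ext_mul t : socle_ext (t * (2 * (P * Q * R))).
Proof.
have := socle_jacobian.
have : forall c : K, socle_ext (c%:MP * (2 * (P * Q * R))).
  by move=> c; exists 0; [exact: jacobian0|exists c; rewrite add0r].
move: (2 * _) => T CT JT.
elim/mpolyind: t => [|c m p _ _ IH].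
  by rewrite mul0r; apply/socle_extJ/jacobian0.
rewrite mulrDl; apply: socle_extD IH; rewrite -mul_mpolyC.
have [->|] := eqVneq m 0%MM.
  by rewrite mpolyX0 mulr1.
rewrite -mdeg_eq0 mdegE -lt0n => mpos.
have /existsP[i mi] : [exists i, m i != 0%N].
  apply: contraTT mpos => /existsPn m0; rewrite -leqNgt leqn0 sum_nat_eq0.
  by apply/forallP=> i; have := m0 i; rewrite negbK.
apply: socle_extJ; rewrite -[m](@submK _ U_(i)%MM) ?lep1mP // mpolyXD.
by rewrite -!mulrA; apply: jacobianM; apply: jacobianM.
Qed.

Lemma const_in_max (c p q r : S) : (exists d : K, c = d%:MP) ->
  c = x * p + y * q + z * r -> c = 0.
Proof.
move=> [d ->] /(congr1 (meval (fun _ => 0))).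
rewrite mevalC !mevalD !mevalM !mevalXU !mul0r !addr0 => ->.
by rewrite mpolyC0.
Qed.

(** [socle_step] yields J plus a polynomial multiple of 2PQR, which [socle_ext_mul] cuts down to a
    scalar multiple. Repeating this lowers the exponent of the saturation to zero. *)
Lemma socle_ext_descend h : (forall i : 'I_3, socle_ext ('X_i * h)) -> socle_ext h.
Proof.
move=> H; have [j0 J0 [al e0]] := H 0; have [j1 J1 [be e1]] := H 1.
have [j2 J2 [ga e2]] := H 2.
move: J0 J1 J2 => /jacobianE[a1 [a2 [a3 E0]]] /jacobianE[b1 [b2 [b3 E1]]].
move=> /jacobianE[c1 [c2 [c3 E2]]].
rewrite E0 in e0; rewrite E1 in e1; rewrite E2 in e2.
have C (d : K) : exists d' : K, (d%:MP : S) = d'%:MP by exists d.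
have [u1 [u2 [u3 [t ->]]]] := socle_step (g0_neq0 K k') (g1_neq0 K k')
  (X_neq0 K 0) (@g0_coprime K k') (@X01_coprime K) (@koszul K) const_in_max
  (C al) (C be) (C ga) e0 e1 e2.
apply: socle_extD; last exact: socle_ext_mul.
by apply/socle_extJ/jacobianE; exists u1, u2, u3.
Qed.

Lemma saturation_socle_ext h : saturation J h -> socle_ext h.
Proof.
move=> [N sat].
have {}sat : forall m : 'X_{1..3}, mdeg m = N -> socle_ext ('X_[m] * h).
  by move=> m /sat; apply: socle_extJ.
elim: N sat => [|N IH] sat.
  by have := sat 0%MM mdeg0; rewrite mpolyX0 mul1r.
apply: IH => m em; apply: socle_ext_descend => i.
by rewrite mulrA -mpolyXD; apply: sat; rewrite mdegD mdeg1 em.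
Qed.

Lemma two_unit : (2 : S) = (2%:R : K)%:MP.
Proof. by rewrite mpolyC_nat. Qed.

(** Elements of J have no coefficient at this monomial, so the socle part of [h] is read off from
    [h] itself. The same fact gives uniqueness of coordinates in N(f). *)
Lemma saturation_coeff h : saturation J h -> J (h - h@_M0 *: 'X_[M0]).
Proof.
move=> /saturation_socle_ext[j Jj [c ->]].
rewrite -mpolyX_socle two_unit mulrA -mpolyCM mul_mpolyC.
rewrite mcoeffD mcoeffZ mcoeffX eqxx mulr1 (jacobian_socle_coeff Jj) add0r.
by rewrite addrK.
Qed.

Lemma socle_saturation : saturation J 'X_[M0].
Proof.
exists 1%N => m /eqP/mdeg1P[i /eqP ->]; rewrite mpolyX_socle.
have -> : 'X_i * (P * Q * R) = (2^-1)%:MP * ('X_i * (2 * (P * Q * R))) :> S.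
  apply: half_comb; rewrite two_unit -mpolyCM mulVf ?mpolyC1 //.
  by rewrite pnatr_eq0.
by apply: jacobianM; apply: socle_jacobian.
Qed.

Lemma curve_nearly_free : nearly_free f.
Proof.
split.
  exists 'X_[M0]; split; first exact: socle_saturation.
  by move=> /jacobian_socle_coeff/eqP; rewrite mcoeffX eqxx oner_eq0.
(* N(f) is a line spanned by the class of (xyz)^k' in degree 3k', and zero in every other degree. *)
move=> m; have [->|ne] := eqVneq m (3 * k')%N.
  exists 1%N; split=> //; exists (fun _ => 'X_[M0]); split=> [_|u [satu _]].
    by split; [exact: socle_saturation|rewrite dhomogX /= mdeg_socle].
  exists (const_mx u@_M0); split=> [|c].
    by rewrite big_ord1 mxE; apply: saturation_coeff.
  rewrite big_ord1 => /jacobian_socle_coeff/eqP.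
  rewrite mcoeffB mcoeffZ mcoeffX eqxx mulr1 subr_eq0 => /eqP ->.
  by apply/rowP=> i; rewrite mxE (ord1 i).
exists 0%N; split=> //; exists (fun _ => 0); split=> [[]//|u [satu hu]].
exists 0; split=> [|c _]; last by rewrite !thinmx0.
rewrite big_ord0 subr0; have := saturation_coeff satu.
rewrite (dhomog_nemf_coeff hu) ?scale0r ?subr0 //.
by rewrite /= mdeg_socle eq_sym.
Qed.

End NearlyFreeCurve.

Lemma rmorph_curve_form (A B : comNzRingType) (g : {rmorphism A -> B}) a b c :
  g (curve_form a b c) = curve_form (g a) (g b) (g c).
Proof. by rewrite /curve_form rmorphB !rmorphD !rmorphXn rmorphM rmorph_nat !rmorphD !rmorphM. Qed.

(** * Reducedness, and the four components for even k *)

Section Components.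
Variables (K : numClosedFieldType).
Notation S := {mpoly K[3]}.
Notation dvd := (@principal_ideal K _).

(** The variables of the monomial are stripped off one at a time: each is prime, so it divides [q]
    or can be cancelled from the cofactor. *)
Lemma dvdm_mpolyX n (q : {mpoly K[n]}) (m : 'X_{1..n}) : dvd q 'X_[m] ->
  q \is a GRing.unit \/ exists i, dvd 'X_i q.
Proof.
have [N leN] := ubnP (mdeg m); elim: N => // N IH in m leN *.
move=> [r e]; have [m0|] := eqVneq m 0%MM.
  by left; apply/unit_dvdm1; exists r; rewrite -e m0 mpolyX0.
rewrite -mdeg_eq0 mdegE sum_nat_eq0 negb_forall => /existsP[i mi].
have lei : (U_(i) <= m)%MM by rewrite lep1mP.
have em : 'X_[m] = 'X_[m - U_(i)] * 'X_i :> {mpoly K[n]} by rewrite -mpolyXD submK.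
have : dvd 'X_i (r * q) by rewrite -e em; apply/dvdm_mull/dvdm_refl.
move=> /prime_mpolyXi[[r' er]|]; last by right; exists i.
apply: (IH (m - U_(i))%MM).
  have e1 : mdeg m = (mdeg (m - U_(i))%MM).+1.
    by rewrite -[RHS]addn1 -(mdeg1 i) -mdegD submK.
  by rewrite e1 ltnS in leN.
exists r'; apply: (mulIf (mpolyX_neq0 K U_(i))).
by rewrite -em e er mulrAC.
Qed.

Lemma plane_curveE k : plane_curve_poly K k =
  curve_form ('X_0 ^+ k) ('X_1 ^+ k) ('X_2 ^+ k).
Proof. by rewrite /plane_curve_poly /curve_form !(mulnC 2%N) !exprM. Qed.

Lemma curve_homog k : plane_curve_poly K k \is (2 * k).-homog.
Proof.
have h (i j : 'I_3) : ('X_i ^+ k * 'X_j ^+ k : S) \is (2 * k).-homog.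
  by rewrite mul2n -addnn; apply: dhomogM; apply: homog_Xn.
rewrite /plane_curve_poly mulr_natl; apply: rpredB.
  by rewrite !rpredD ?homog_Xn.
by rewrite rpredMn ?rpredD ?h.
Qed.

Lemma meval_curve k (v : 'I_3 -> K) : (plane_curve_poly K k).@[v] =
  curve_form (v 0 ^+ k) (v 1 ^+ k) (v 2 ^+ k).
Proof.
by rewrite plane_curveE (rmorph_curve_form (meval v)) /= !mevalXn.
Qed.

Lemma curve_neq0 k : (0 < k)%N -> plane_curve_poly K k != 0.
Proof.
case: k => // k _.
apply: (@neq0_meval _ _ (pt3 1 0 0)); rewrite meval_curve /curve_form /pt3 /=.
by rewrite expr1n !expr0n expr1n /= !mul0r !mulr0 !addr0 mulr0 subr0 oner_neq0.
Qed.

(** A square factor q divides every partial derivative, hence all of J, which contains the monomial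
    x (xyz)^k. If q were not a unit, a variable would divide q and so the curve, which a coordinate
    point refutes. *)
Lemma curve_square_free k : (0 < k)%N -> square_free (plane_curve_poly K k).
Proof.
case: k => // k _; split=> [|a q e]; first exact: curve_neq0.
have dq i : dvd q (plane_curve_poly K k.+1)^`M(i).
  rewrite e expr2 !mderivM; apply: dvdmD.
    by apply/dvdm_mull/dvdm_mull/dvdm_refl.
  apply/dvdm_mull/dvdmD; first exact/dvdm_mull/dvdm_refl.
  exact/dvdm_mulr/dvdm_refl.
have dJ h : jacobian_ideal (plane_curve_poly K k.+1) h -> dvd q h.
  by move=> [b ->]; apply: dvdm_sum => i _; apply: dvdm_mull.
have [|//|[i di]] := @dvdm_mpolyX _ q (U_(0%R) + socle_mnm k)%MM.
  rewrite mpolyXD mpolyX_socle; have := dJ _ (socle_jacobian K k 0).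
  set T := 'X_0 ^+ k * _ * _ => -[b eb].
  have hE : (2^-1)%:MP * 2 = 1 :> S.
    by rewrite two_unit -mpolyCM mulVf ?mpolyC1 // pnatr_eq0.
  by exists ((2^-1)%:MP * b); rewrite (half_comb 'X_0 T hE) eb mulrA.
pose v := fun j : 'I_3 => (j == (if i == 0 then 1 else 0))%:R : K.
have vi : v i = 0 by rewrite /v; move: i {di v}; apply: ord3_cases.
have : dvd 'X_i (plane_curve_poly K k.+1).
  by rewrite e; apply/dvdm_mull/(dvdm_trans di)/dvdm_mulr/dvdm_refl.
move=> /dvdm_eval/(_ (_ : ('X_i : S).@[v] = 0)); rewrite mevalXU => /(_ vi).
rewrite meval_curve /v /curve_form.
by case: ifP => _; rewrite !ord3_neqE eqxx ?expr0n expr1n /= ?expr0n expr1n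
   !(mul0r, mulr0, addr0, add0r, subr0) => /eqP; rewrite oner_eq0.
Qed.

(** Heron's formula, up to sign. *)
Lemma curve_form_squares (A : comNzRingType) (a b c : A) :
  curve_form (a ^+ 2) (b ^+ 2) (c ^+ 2) =
  ((a + b + c) * (a - b + c)) * ((- a + b + c) * (- a - b + c)).
Proof. by rewrite /curve_form; ring. Qed.

(* i = 0, ..., 3 encodes the pair of signs of x^l and y^l. *)
Definition component (l : nat) (i : 'I_4) : S :=
  fermat ((-1) ^+ (1 < i)%N) ((-1) ^+ odd i) l.

Lemma big_ord4 (A : comNzRingType) (F : 'I_4 -> A) :
  \prod_i F i = (F 0 * F 1) * (F 2 * F 3).
Proof.
rewrite !big_ord_recl big_ord0 mulr1 !mulrA.
by congr (F _ * F _ * F _ * F _); apply: val_inj.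
Qed.

Lemma curve_components l : plane_curve_poly K (2 * l) = \prod_i component l i.
Proof.
rewrite plane_curveE !(mulnC 2%N) !exprM curve_form_squares big_ord4.
rewrite /component /fermat /= !expr0 !expr1 mpolyCN !mpolyC1 !mul1r !mulN1r.
by [].
Qed.

Lemma meval_fermat c0 c1 l (v : 'I_3 -> K) :
  (fermat c0 c1 l).@[v] = c0 * v 0 ^+ l + c1 * v 1 ^+ l + v 2 ^+ l.
Proof. by rewrite /fermat !mevalD !mevalM !mevalC !rmorphXn /= !mevalXU. Qed.

Lemma fermat_irreducible (c0 c1 : K) l : c0 != 0 -> c1 != 0 -> (0 < l)%N ->
  irreducible_mpoly (fermat c0 c1 l).
Proof.
move=> c00 c10 l0; apply: prime_irreducible (prime_fermat c00 c10 l0).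
  apply: (@neq0_meval _ _ (pt3 0 0 1)); rewrite meval_fermat /pt3 /=.
  by rewrite !expr0n gtn_eqF // !mulr0 !add0r expr1n oner_neq0.
apply: (@meval0_nonunit _ _ _ (fun _ => 0)).
by rewrite meval_fermat expr0n gtn_eqF // !mulr0 !addr0.
Qed.

Lemma component_prime l i : (0 < l)%N -> prime_mpoly (component l i).
Proof. by move=> l0; apply: prime_fermat; rewrite ?signr_eq0. Qed.

Lemma component_irreducible l i : (0 < l)%N -> irreducible_mpoly (component l i).
Proof. by move=> l0; apply: fermat_irreducible; rewrite ?signr_eq0. Qed.

Lemma component_inj l i j (c : K) : (0 < l)%N ->
  component l i = c *: component l j -> i = j.
Proof.
move=> l0 e.
have ev v := congr1 (meval v) e.
have := ev (pt3 0 0 1); rewrite mevalZ !meval_fermat /pt3 /=.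
rewrite !expr0n gtn_eqF // expr1n !mulr0 !add0r mulr1 => c1.
have := ev (pt3 1 0 0); rewrite mevalZ !meval_fermat /pt3 /=.
rewrite !expr0n gtn_eqF // expr1n !mulr0 !addr0 !mulr1 -c1 mul1r => /signr_inj e1.
have := ev (pt3 0 1 0); rewrite mevalZ !meval_fermat /pt3 /=.
rewrite !expr0n gtn_eqF // expr1n !mulr0 !addr0 !add0r !mulr1 -c1 mul1r.
move=> /signr_inj e2; apply: val_inj.
by move: e1 e2; case: i {e ev} => [[|[|[|[|//]]]] ?]; case: j => [[|[|[|[|//]]]] ?].
Qed.

Lemma unit_mpolyC n (p : {mpoly K[n]}) : p \is a GRing.unit ->
  exists2 c : K, c != 0 & p = c%:MP.
Proof.
move=> /mpoly_unitE[p0 e]; exists p@_0%MM => //.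
by apply: contraNneq p0 => c0; rewrite e c0 mpolyC0.
Qed.

Lemma component_ndvd l i j : (0 < l)%N -> dvd (component l i) (component l j) -> i = j.
Proof.
move=> l0 [b e]; have [_ niU _] := component_irreducible i l0.
have [_ _ /(_ b _ e)[/unit_mpolyC[c c0 eb]|iU]] := component_irreducible j l0.
  apply/esym/(@component_inj l _ _ c) => //.
  by rewrite e eb mul_mpolyC.
by rewrite iU in niU.
Qed.

Lemma components_irreducible l : (0 < l)%N ->
  irreducible_components (plane_curve_poly K (2 * l)) (component l).
Proof.
move=> l0; split=> [i|i j c|p irrp [a ea]].
- split; first exact: component_irreducible.
  by rewrite curve_components (bigD1 i) //=; apply/dvdm_mulr/dvdm_refl.
- exact: component_inj.
have [i di] : exists i, dvd (component l i) p.
  have [p0 npU _] := irrp.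
  (* Each component is prime and divides b p. As long as none divides p, they can all be cancelled
     against b, which would leave p a unit. *)
  suff H (r : seq 'I_4) b : \prod_(i <- r) component l i = b * p ->
      exists i, dvd (component l i) p.
    by apply: (H (index_enum 'I_4) a); rewrite -curve_components.
  elim: r b => [|i r IH] b.
    by rewrite big_nil => e; case/negP: npU; apply/unit_dvdm1; exists b.
  rewrite big_cons => e.
  have : dvd (component l i) (b * p) by rewrite -e; apply/dvdm_mulr/dvdm_refl.
  move=> /(component_prime l0)[[b' eb]|]; last by exists i.
  have [qi0 _ _] := component_irreducible i l0.
  by apply: (IH b'); apply: (mulfI qi0); rewrite e eb [RHS]mulrCA mulrA.
exists i; case: di => b eb; have [_ niU _] := component_irreducible i l0.
have [_ _ /(_ _ _ eb)[/unit_mpolyC[c _ ec]|iU]] := irrp.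
  by exists c; rewrite eb ec mul_mpolyC.
by rewrite iU in niU.
Qed.

Lemma fermat_homog (c0 c1 : K) l : fermat c0 c1 l \is l.-homog.
Proof.
by rewrite /fermat !mul_mpolyC; rewrite !rpredD ?dhomogZ ?homog_Xn.
Qed.

Lemma mderiv_fermat (c0 c1 : K) l i : (fermat c0 c1 l.+1)^`M(i) =
  ((tnth [tuple c0; c1; 1] i) *+ l.+1)%:MP * 'X_i ^+ l.
Proof.
rewrite /fermat !mderivD !mderiv_mulC !mderivXn.
move: i; apply: ord3_cases; rewrite !ord3_neqE eqxx !mul0n mul1n !mul0r !mulr0;
by rewrite ?addr0 ?add0r /tnth /= -mpolyC_nat ?mulrA -?mpolyCM ?mulr_natr.
Qed.

Lemma fermat_smooth (c0 c1 : K) l (v : 'I_3 -> K) : c0 != 0 -> c1 != 0 -> (0 < l)%N ->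
  (forall i, (fermat c0 c1 l)^`M(i).@[v] = 0) -> forall i, v i = 0.
Proof.
case: l => // l c00 c10 _ H i; have := H i; rewrite mderiv_fermat mevalM mevalC.
rewrite rmorphXn /= mevalXU => /eqP; rewrite mulf_eq0 -mulr_natr mulf_eq0 pnatr_eq0.
rewrite orbF => /orP[|]; last by rewrite expf_eq0 => /andP[_ /eqP].
move: i; apply: ord3_cases; rewrite /tnth /=; by rewrite ?(negPf c00) ?(negPf c10) ?oner_eq0.
Qed.

Lemma vpick_P2 (p : P2 K) : vpick (val p) != 0.
Proof.
by rewrite vpick0 -dimv_eq0; case: p => L /= /eqP ->.
Qed.

Lemma component_smooth l i p : (0 < l)%N -> ~ singular_point (component l i) p.
Proof.
move=> l0 [_ /fermat_smooth H]; have := vpick_P2 p.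
case/eqP; apply/rowP => j; rewrite mxE; apply: H => //; by rewrite signr_eq0.
Qed.

End Components.

(** * Irreducibility for odd k *)

Section OddIrreducible.
Variables (K : numClosedFieldType).
Notation S := {mpoly K[3]}.
Notation dvd := (@principal_ideal K _).

Definition squares : 3.-tuple S := [tuple 'X_i ^+ 2 | i < 3].

Lemma tnth_squares i : tnth squares i = 'X_i ^+ 2.
Proof. by rewrite tnth_mktuple. Qed.

Lemma comp_mpolyXi n k (t : n.-tuple {mpoly K[k]}) (i : 'I_n) :
  'X_i \mPo t = tnth t i.
Proof. by rewrite comp_mpolyXU (tnth_nth 0). Qed.

Lemma comp_mpolyXin n k (t : n.-tuple {mpoly K[k]}) (i : 'I_n) m :
  ('X_i ^+ m) \mPo t = tnth t i ^+ m.
Proof. by rewrite rmorphXn /= comp_mpolyXi. Qed.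

Lemma curve_mPo k (t : 3.-tuple S) : plane_curve_poly K k \mPo t =
  curve_form (tnth t 0 ^+ k) (tnth t 1 ^+ k) (tnth t 2 ^+ k).
Proof.
by rewrite plane_curveE (rmorph_curve_form (comp_mpoly t)) /= !comp_mpolyXin.
Qed.

Lemma fermat_mPo (c0 c1 : K) k (t : 3.-tuple S) : fermat c0 c1 k \mPo t =
  c0%:MP * tnth t 0 ^+ k + c1%:MP * tnth t 1 ^+ k + tnth t 2 ^+ k.
Proof.
by rewrite /fermat !comp_mpolyD !rmorphM /= !comp_mpolyC !comp_mpolyXin.
Qed.

Lemma curve_squares k : plane_curve_poly K k \mPo squares = \prod_i component K k i.
Proof.
by rewrite -curve_components curve_mPo plane_curveE !tnth_squares !exprM.
Qed.

Lemma mcoeff_squares p m : (p \mPo squares)@_(m + m) = p@_m.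
Proof.
have e m' : 'X_[m'] \mPo squares = 'X_[m' + m'].
  rewrite comp_mpolyX mpolyXD (mpolyXE_id K m') -big_split /=.
  by apply: eq_bigr => i _; rewrite tnth_squares -exprM mulnC exprM expr2.
have dblI (a b : 'X_{1..3}) : ((a + a)%MM == (b + b)%MM) = (a == b).
  apply/eqP/eqP => [|-> //] /mnmP ab; apply/mnmP => i.
  by have := ab i; rewrite !mnmDE; lia.
rewrite comp_mpolyEX raddf_sum /=.
under eq_bigr => m' _ do rewrite mcoeffZ e mcoeffX dblI.
have [mp|mp] := boolP (m \in msupp p).
  rewrite (bigD1_seq m) ?msupp_uniq //= eqxx mulr1 big1 ?addr0 // => i ne.
  by rewrite (negPf ne) mulr0.
rewrite (memN_msupp_eq0 mp) big_seq big1 // => i ip.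
by case: eqP mp => [<-|]; rewrite ?ip ?mulr0.
Qed.

(** The substitution doubles exponent vectors, so every coefficient survives it. *)
Lemma squares_inj p q : p \mPo squares = q \mPo squares -> p = q.
Proof. by move=> e; apply/mpolyP => m; rewrite -[LHS]mcoeff_squares e mcoeff_squares. Qed.

Definition signs (i : 'I_4) : 3.-tuple S :=
  [tuple (-1) ^+ (1 < i)%N * 'X_0; (-1) ^+ odd i * 'X_1; 'X_2].

Lemma squares_signs p i : (p \mPo squares) \mPo signs i = p \mPo squares.
Proof.
apply: (@mpoly_morph_ext K 3 S (comp_mpoly (signs i) \o comp_mpoly squares)
         (comp_mpoly squares)) => [c|j].
  by rewrite /= !comp_mpolyC.
rewrite -[LHS]/(('X_j \mPo squares) \mPo signs i) comp_mpolyXi tnth_squares comp_mpolyXin.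
move: j; apply: ord3_cases; rewrite /signs /tnth /= ?exprMn ?sqrr_sign ?mul1r;
  by rewrite comp_mpolyXi tnth_squares.
Qed.

Lemma component_signs k i : odd k -> component K k 0 \mPo signs i = component K k i.
Proof.
move=> ok; have e (b : bool) (p : S) :
    ((-1) ^+ b * p) ^+ k = ((-1) ^+ b)%:MP * p ^+ k.
  rewrite exprMn -exprM mulnC exprM -[(-1) ^+ k]signr_odd ok expr1; congr (_ * _).
  by case: b; rewrite ?expr1 ?expr0 ?mpolyCN ?mpolyC1.
rewrite /component fermat_mPo /signs /tnth /= !e /fermat.
by rewrite !expr0 !mpolyC1 !mul1r.
Qed.

(** The components are pairwise non-associate primes, so their divisibilities multiply. *)
Lemma dvdm_components l (r : seq 'I_4) p : (0 < l)%N -> uniq r ->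
  (forall i, i \in r -> dvd (component K l i) p) ->
  dvd (\prod_(i <- r) component K l i) p.
Proof.
move=> l0; elim: r => [|i r IH] /=; first by exists p; rewrite big_nil mulr1.
move=> /andP[ir ur] H; have [|c ec] := IH ur.
  by move=> j jr; apply: H; rewrite inE jr orbT.
have := H i (mem_head _ _); rewrite ec => /(component_prime l0)[[c' ec']|].
  by exists c'; rewrite big_cons ec' mulrA.
have ndvd (s : seq 'I_4) : i \notin s ->
    ~ dvd (component K l i) (\prod_(j <- s) component K l j).
  elim: s => [_|j s IHs].
    rewrite big_nil => /unit_dvdm1; apply/negP.
    by have [] := component_irreducible K i l0.
  rewrite inE negb_or big_cons => /andP[ij /IHs nd].
  move=> /(component_prime l0)[/(component_ndvd l0)/eqP|//].
  by rewrite (negPf ij).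
by move/ndvd: ir.
Qed.

Lemma curve_irreducible k : odd k -> irreducible_mpoly (plane_curve_poly K k).
Proof.
move=> ok; have k0 : (0 < k)%N by case: k ok.
split; first exact: curve_neq0.
  apply: (@meval0_nonunit _ _ _ (fun _ => 0)).
  rewrite meval_curve expr0n gtn_eqF // /curve_form expr0n /=.
  by rewrite !mul0r !addr0 mulr0 subr0.
(* A polynomial in the squares is invariant under sign changes, which carry component 0 to all the
   others. So all four divide a(x^2, y^2, z^2); their product is f(x^2, y^2, z^2), and nothing but a
   unit remains for b. *)
have half a b : plane_curve_poly K k = a * b ->
    dvd (component K k 0) (a \mPo squares) -> b \is a GRing.unit.
  move=> e d0.
  have dall i : dvd (component K k i) (a \mPo squares).
    case: d0 => c ec; exists (c \mPo signs i).
    by rewrite -(component_signs i ok) -rmorphM /= -ec squares_signs.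
  have [c ec] : dvd (\prod_i component K k i) (a \mPo squares).
    by apply: dvdm_components; rewrite ?index_enum_uniq.
  rewrite -curve_squares e rmorphM /= in ec.
  have a0 : a \mPo squares != 0.
    apply: contraTneq (curve_neq0 K k0) => a0; rewrite e (_ : a = 0) ?mul0r ?eqxx //.
    by apply: squares_inj; rewrite a0 comp_mpoly0.
  have : b \mPo squares \is a GRing.unit.
    apply/unit_dvdm1; exists c; apply: (mulfI a0); rewrite mulr1 {1}ec; ring.
  move=> /unit_mpolyC[d d0' ed].
  have -> : b = d%:MP by apply: squares_inj; rewrite ed comp_mpolyC.
  exact: mpoly_unitC.
move=> a b e.
have : dvd (component K k 0) ((a \mPo squares) * (b \mPo squares)).
  rewrite -rmorphM /= -e curve_squares (bigD1 0) //=.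
  exact/dvdm_mulr/dvdm_refl.
move=> /(component_prime k0)[]; first by right; apply: half e _.
by left; apply: (half b a); rewrite // mulrC.
Qed.

End OddIrreducible.

(** * Geometric genus for odd k *)

Section RingMorphisms.
Variables (A B : comNzRingType) (g : {rmorphism A -> B}).

Lemma rmorph_diff_mul a b c d e :
  g ((a - b - c) * (d * e)) = (g a - g b - g c) * (g d * g e).
Proof. by rewrite !rmorphM !rmorphB. Qed.

Lemma rmorph_double_mul a d e : g (2 * a * (d * e)) = 2 * g a * (g d * g e).
Proof. by rewrite !rmorphM rmorph_nat. Qed.

End RingMorphisms.

Section Genus.
Variables (K : numClosedFieldType).
Notation S := {mpoly K[3]}.
Notation dvd := (@principal_ideal K _).

Lemma dvdm_pihomog n (q : {mpoly K[n]}) e d a : q \is e.-homog -> dvd q a ->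
  dvd q (pihomog mdeg d a).
Proof.
move=> hq [c ->]; rewrite (mpolyE c) mulr_suml linear_sum; apply: dvdm_sum => m _.
rewrite -scalerAl linearZ /= -mul_mpolyC; apply: dvdm_mull.
have h : 'X_[m] * q \is (mdeg m + e).-homog.
  by apply: dhomogM => //; rewrite dhomogX.
have [<-|ne] := eqVneq (mdeg m + e)%N d.
  by rewrite pihomog_dE //; apply/dvdm_mull/dvdm_refl.
by rewrite (pihomog_ne0 ne h); apply: dvdm0.
Qed.

Lemma prime_homogeneous n (q : {mpoly K[n]}) e : prime_mpoly q ->
  q \isn't a GRing.unit -> q \is e.-homog -> homogeneous_prime_ideal (dvd q).
Proof.
move=> pq nU hq; split=> //.
- split; [exact: dvdm0|exact: dvdmD|by move=> a b; apply: dvdm_mull].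
- by move=> a d; apply: dvdm_pihomog hq.
- by move=> /unit_dvdm1; apply/negP.
Qed.

Lemma fermat_nonsingular (c0 c1 : K) k : c0 != 0 -> c1 != 0 -> (0 < k)%N ->
  nonsingular_curve_ideal (n := 2) (dvd (fermat c0 c1 k)).
Proof.
move=> c00 c10 k0 v v0 _; exists (fun _ => fermat c0 c1 k).
split=> [_|]; first exact: dvdm_refl.
rewrite rank_rV; case: eqP => // /rowP E; case/eqP: v0; apply/rowP => j.
rewrite mxE; apply: (fermat_smooth c00 c10 k0) => i.
by have := E i; rewrite !mxE.
Qed.

(** * Hilbert function of the Fermat curve *)

Section Hilbert.
Variables (k m : nat).
Hypothesis k0 : (0 < k)%N.
Let F : S := fermat 1 1 k.

(** The exponent of z is [i], that of x is [j], and y fills up the degree m. *)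
Definition std_mnm (i j : nat) : 'X_{1..3} :=
  [multinom tnth [tuple j; m - i - j; i]%N l | l < 3].

(* Monomials of degree m that are not divisible by the leading monomial z^k. *)
Definition std_mnms : seq 'X_{1..3} :=
  [seq std_mnm i j | i <- iota 0 k, j <- iota 0 (m - i).+1].

Lemma mnm3P (u v : 'X_{1..3}) : u 0 = v 0 -> u 1 = v 1 -> u 2 = v 2 -> u = v.
Proof. by move=> e0 e1 e2; apply/mnmP; apply: ord3_cases. Qed.

Lemma mdeg3 (u : 'X_{1..3}) : mdeg u = (u 0%R + u 1%R + u 2%R)%N.
Proof. by rewrite mdegE (sum_ord3 (A := nat) u). Qed.

Lemma std_mnmE i j : ((std_mnm i j 0%R = j) * (std_mnm i j 1%R = m - i - j)%N *
  (std_mnm i j 2%R = i))%type.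
Proof. by rewrite !mnmE. Qed.

Lemma std_mnms_mem u : (k <= m.+1)%N ->
  (u \in std_mnms) = (mdeg u == m) && (u 2%R < k)%N.
Proof.
move=> km; apply/allpairsPdep/andP => [[i [j [ii ij ->]]]|[/eqP du u2]].
  move: ii ij; rewrite !mem_iota mdeg3 !std_mnmE => ii ij; split; lia.
exists (u 2), (u 0); rewrite !mem_iota; rewrite mdeg3 in du; split; try lia.
by apply: mnm3P; rewrite !std_mnmE; lia.
Qed.

Lemma std_mnms_uniq : uniq std_mnms.
Proof.
apply: allpairs_uniq_dep => [|i _|]; rewrite ?iota_uniq //.
move=> [i j] [i' j'] _ _ /= /mnmP e; have := e 0; have := e 2.
by rewrite !std_mnmE => -> ->.
Qed.

(** For each z-exponent i < k there are m - i + 1 monomials. The binomial coefficient stands on the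
    left to avoid truncated subtraction. *)
Lemma size_std_mnms : (k <= m.+1)%N ->
  (size std_mnms + 'C(k, 2) = k * m.+1)%N.
Proof.
move=> km; rewrite size_allpairs_dep.
have -> : sumn [seq size (iota 0 (m - i).+1) | i <- iota 0 k] =
  (\sum_(0 <= i < k) (m - i).+1)%N.
  rewrite sumnE big_map /index_iota subn0; apply: eq_bigr => i _.
  by rewrite size_iota.
rewrite -bin2_sum -big_split /= big_nat.
rewrite (eq_bigr (fun=> m.+1)) => [|i /andP[_ ik]]; last by lia.
by rewrite -big_nat sum_nat_const_nat subn0.
Qed.

Definition std_basis (i : 'I_(size std_mnms)) : S := 'X_[nth 0%MM std_mnms i].

(** Replacing z^k by - x^k - y^k lowers the exponent of z, on which the induction for monomials
    runs. *)
Lemma std_basis_span h : (k <= m.+1)%N -> h \is m.-homog ->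
  exists c : 'rV[K]_(size std_mnms), dvd F (h - \sum_i c 0 i *: std_basis i).
Proof.
move=> km hh.
pose G h := exists c : 'rV[K]_(size std_mnms), dvd F (h - \sum_i c 0 i *: std_basis i).
have GD a b : G a -> G b -> G (a + b).
  move=> [c ca] [d db]; exists (c + d).
  rewrite (eq_bigr (fun i => c 0 i *: std_basis i + d 0 i *: std_basis i)); last first.
    by move=> i _; rewrite mxE scalerDl.
  by rewrite big_split /= opprD addrACA; apply: dvdmD.
have GZ c a : G a -> G (c *: a).
  move=> [d da]; exists (c *: d).
  rewrite (eq_bigr (fun i => c *: (d 0 i *: std_basis i))); last first.
    by move=> i _; rewrite mxE scalerA.
  by rewrite -scaler_sumr -scalerBr -mul_mpolyC; apply: dvdm_mull.
have G0 : G 0.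
  exists 0; rewrite big1 ?subrr; first exact: dvdm0.
  by move=> i _; rewrite mxE scale0r.
have Gdvd a b : dvd F (a - b) -> G b -> G a.
  move=> d [c ec]; exists c; rewrite -[a](subrK b) -addrA; exact: dvdmD.
have GX u : mdeg u = m -> G 'X_[u].
  have [N ltN] := ubnP (u 2%R); elim: N => // N IH in u ltN * => du.
  have [u2|u2] := ltnP (u 2%R) k.
    have uin : u \in std_mnms by rewrite std_mnms_mem // du eqxx.
    have lti : (index u std_mnms < size std_mnms)%N by rewrite index_mem.
    exists (delta_mx 0 (Ordinal lti)); rewrite (bigD1 (Ordinal lti)) //= big1.
      by rewrite mxE !eqxx scale1r addr0 /std_basis /= nth_index // subrr; apply: dvdm0.
    by move=> i ne; rewrite mxE (negPf ne) andbF scale0r.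
  have le2 : (U_(2%R) *+ k <= u)%MM.
    apply/mnm_lepP => i; rewrite mulmnE mnm1E.
    by case: eqP => [<-|]; rewrite ?mul1n ?mul0n.
  pose w := (u - U_(2%R) *+ k)%MM.
  have ew : 'X_[u] = 'X_[w] * 'X_2 ^+ k :> S by rewrite mpolyXn -mpolyXD submK.
  have dw : (mdeg w + k = m)%N.
    by rewrite -du -[u in RHS](submK le2) mdegD mdegMn mdeg1 mul1n.
  have w2 : (w 2%R = u 2%R - k)%N by rewrite mnmBE mulmnE mnm1E eqxx mul1n.
  apply: (Gdvd _ (- 'X_[w + U_(0%R) *+ k] - 'X_[w + U_(1%R) *+ k])).
    exists 'X_[w]; rewrite ew /F /fermat !mpolyC1 !mpolyXD -!mpolyXn; ring.
  rewrite -!scaleN1r; apply: GD; apply: GZ; apply: IH.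
  - by rewrite mnmDE mulmnE mnm1E ord3_neqE w2; lia.
  - by rewrite mdegD mdegMn mdeg1; lia.
  - by rewrite mnmDE mulmnE mnm1E ord3_neqE w2; lia.
  - by rewrite mdegD mdegMn mdeg1; lia.
rewrite (mpolyE h) -/(G _) big_seq; elim/big_rec: _ => // u a uh Ga.
by apply: GD => //; apply: GZ; apply: GX; apply: (dhomogP _ _ _ hh).
Qed.

(** At w = 0 the shear is trivial, and the tower is K[x][y][z], where the size measures the degree
    in z. *)
Lemma to_tower_mnm u :
  exists c, to_tower (0 : K) 'X_[u] = c%:P * 'X^(u 2%R).
Proof.
have tM a b : to_tower (0 : K) (a * b) = to_tower 0 a * to_tower 0 b := rmorphM _ _ _.
have tX a n : to_tower (0 : K) (a ^+ n) = to_tower 0 a ^+ n := rmorphXn _ _ _.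
have e : 'X_[u] = 'X_0 ^+ (u 0%R) * 'X_1 ^+ (u 1%R) * 'X_2 ^+ (u 2%R) :> S.
  rewrite !mpolyXn -!mpolyXD; congr 'X_[_]; apply/mnmP; apply: ord3_cases;
  by rewrite !mnmDE !mulmnE !mnm1E !ord3_neqE !eqxx !mul0n mul1n ?addn0.
rewrite e !tM !tX !to_towerX /shear_var /= polyC0 mul0r polyC0 add0r.
by exists ('X%:P ^+ u 0 * 'X ^+ u 1); rewrite polyCM !rmorphXn.
Qed.

Lemma size_to_tower (r : S) : (forall u, u \in msupp r -> (u 2%R < k)%N) ->
  (size (to_tower (0 : K) r) <= k)%N.
Proof.
move=> H.
have -> : to_tower (0 : K) r = \sum_(u <- msupp r) to_tower 0 (r@_u *: 'X_[u]).
  by rewrite {1}(mpolyE r) rmorph_sum.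
rewrite big_seq.
elim/big_rec: _ => [|u p /H u2 IH]; first by rewrite size_poly0.
apply: leq_trans (size_polyD _ _) _; rewrite geq_max IH andbT.
have tM a b : to_tower (0 : K) (a * b) = to_tower 0 a * to_tower 0 b := rmorphM _ _ _.
rewrite -mul_mpolyC tM to_towerC.
have [c ->] := to_tower_mnm u; rewrite mulrA -polyCM mul_polyC.
by apply: leq_trans (size_scale_leq _ _) _; rewrite size_polyXn.
Qed.

(** [F] is monic of degree k in z, so a nonzero multiple of it has z-degree at least k. This gives
    the independence of the standard monomials. *)
Lemma fermat_reduced (r : S) : dvd F r ->
  (forall u, u \in msupp r -> (u 2%R < k)%N) -> r = 0.
Proof.
move=> [a ea] /size_to_tower szr.
have tM a b : to_tower (0 : K) (a * b) = to_tower 0 a * to_tower 0 b := rmorphM _ _ _.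
have tD a b : to_tower (0 : K) (a + b) = to_tower 0 a + to_tower 0 b := rmorphD _ _ _.
have tX a n : to_tower (0 : K) (a ^+ n) = to_tower 0 a ^+ n := rmorphXn _ _ _.
have [g eF] : exists g, to_tower 0 F = 'X^k + g%:P.
  exists ('X%:P ^+ k + 'X ^+ k).
  rewrite /F /fermat !tD !tM !tX !to_towerC !to_towerX /shear_var /=.
  by rewrite !polyC1 !mul1r polyC0 mul0r polyC0 add0r addrC polyCD !rmorphXn.
have szg : (size g%:P < size ('X^k : {poly {poly {poly K}}}))%N.
  by rewrite size_polyXn; apply: leq_ltn_trans (size_polyC_leq1 _) _.
have mF : to_tower 0 F \is monic.
  by rewrite eF monicE lead_coefDl // lead_coefXn.
have szF : size (to_tower 0 F) = k.+1 by rewrite eF size_polyDl // size_polyXn.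
apply: (can_inj (@to_towerK K 0)); rewrite ea tM.
rewrite ea tM in szr; have t0 : to_tower (0 : K) 0 = 0 := rmorph0 _.
have [->|na] := eqVneq (to_tower 0 a) 0; first by rewrite mul0r t0.
move: szr; rewrite size_Mmonic // szF addnS /= leqNgt.
by rewrite -[X in (X < _)%N]add0n ltn_add2r lt0n size_poly_eq0 na.
Qed.

Lemma fermat_hilbert : (k <= m.+1)%N ->
  quotient_dim (fun h : S => h \is m.-homog) (dvd F) (size std_mnms).
Proof.
move=> km; exists std_basis; split=> [i|u hu].
  have : nth 0%MM std_mnms i \in std_mnms by rewrite mem_nth.
  by rewrite std_mnms_mem // dhomogX => /andP[].
have [c ec] := std_basis_span km hu; exists c; split=> // d ed.
have : dvd F (\sum_i (c 0 i - d 0 i) *: std_basis i).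
  have := dvdmB ed ec.
  have -> : \sum_i (c 0 i - d 0 i) *: std_basis i =
      \sum_i c 0 i *: std_basis i - \sum_i d 0 i *: std_basis i.
    by rewrite -sumrB; apply: eq_bigr => i _; rewrite scalerBl.
  by move: (\sum_i _) (\sum_i _) => p q; rewrite (_ : _ - _ - _ = p - q) //; ring.
move/fermat_reduced => H; have /H {}H : forall u0,
    u0 \in msupp (\sum_i (c 0 i - d 0 i) *: std_basis i) -> (u0 2%R < k)%N.
  move=> u0; rewrite mcoeff_msupp => /eqP nz; apply/idP.
  apply: contra_notT nz => nlt; rewrite raddf_sum /= big1 // => i _.
  rewrite mcoeffZ mcoeffX; case: eqP => [e|]; last by rewrite mulr0.
  have : nth 0%MM std_mnms i \in std_mnms by rewrite mem_nth.
  by rewrite std_mnms_mem // e => /andP[_]; rewrite (negPf nlt).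
apply/rowP => j; have := congr1 (mcoeff (nth 0%MM std_mnms j)) H.
rewrite raddf_sum /= (bigD1 j) //= mcoeffZ mcoeffX eqxx mulr1 mcoeff0 big1.
  by rewrite addr0 => /eqP; rewrite subr_eq0 => /eqP.
move=> i ne; rewrite mcoeffZ mcoeffX nth_uniq ?std_mnms_uniq //.
by rewrite [_ == _](_ : _ = (i == j)) // (negPf ne) mulr0.
Qed.

End Hilbert.

Lemma fermat_arithmetic_genus k :
  curve_of_arithmetic_genus (n := 2) (dvd (fermat 1 1 k.+1 : S)) 'C(k, 2).
Proof.
(* With K = k + 1, [size_std_mnms] gives the Hilbert polynomial K (m + 1) - C(K, 2), and 1 - K +
   C(K, 2) = C(k, 2). *)
exists (k.+1%:R *: 'X + (k.+1%:R - 'C(k.+1, 2)%:R)%:P); split.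
- rewrite -mul_polyC size_MXaddC polyC_eq0 pnatr_eq0 /= size_polyC.
  by rewrite pnatr_eq0.
- rewrite hornerD hornerZ hornerX hornerC binS bin1 natrD -[k.+1]addn1 natrD; ring.
exists k.+1 => m km; exists (size (std_mnms k.+1 m)); split; last first.
  by apply: fermat_hilbert => //; apply: leq_trans km _.
rewrite hornerD hornerZ hornerX hornerC.
have /(congr1 (fun n : nat => n%:R : rat)) := size_std_mnms (ltn0Sn k) (leq_trans km (leqnSn m)).
rewrite natrD natrM -[m.+1]addn1 natrD => /(canRL (addrK _)) ->; ring.
Qed.

(** * The birational map between the curve and the Fermat curve *)

Section Birational.
Variable m : nat.
Let k := m.*2.+1.
Notation x := ('X_0 : S).
Notation y := ('X_1 : S).
Notation z := ('X_2 : S).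
Let f : S := plane_curve_poly K k.
Let F : S := fermat 1 1 k.

(* On the Fermat curve u^k + v^k + w^k = 0 with x = u^2, y = v^2, z = w^2 the
   products u x^m, v y^m, w z^m sum to 0, which gives u : v : w rationally in
   terms of x, y, z. *)
Definition curve_to_fermat : 3.-tuple S :=
  [tuple (y ^+ k - x ^+ k - z ^+ k) * (y ^+ m * z ^+ m);
         (x ^+ k - y ^+ k - z ^+ k) * (x ^+ m * z ^+ m);
         2 * z ^+ k * (x ^+ m * y ^+ m)].

Section Identities.
Variables (A : comNzRingType) (a b c p q r : A).
(** In the application a, b, c are the coordinates and p, q, r their m-th powers, so that X, Y, Z
    are the powers of odd exponent 2m + 1. *)
Let X := a * p ^+ 2.
Let Y := b * q ^+ 2.
Let Z := c * r ^+ 2.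
Let G := curve_form X Y Z.

Lemma phi_psi01 : (((Y - X - Z) * (q * r)) ^+ 2) * b - (((X - Y - Z) * (p * r)) ^+ 2) * a =
  (b * (q * r) ^+ 2 - a * (p * r) ^+ 2) * G.
Proof. by rewrite /G /curve_form /X /Y /Z; ring. Qed.

Lemma phi_psi02 : (((Y - X - Z) * (q * r)) ^+ 2) * c - ((2 * Z * (p * q)) ^+ 2) * a =
  (c * (q * r) ^+ 2) * G.
Proof. by rewrite /G /curve_form /X /Y /Z; ring. Qed.

Lemma phi_psi12 : (((X - Y - Z) * (p * r)) ^+ 2) * c - ((2 * Z * (p * q)) ^+ 2) * b =
  (c * (p * r) ^+ 2) * G.
Proof. by rewrite /G /curve_form /X /Y /Z; ring. Qed.

Lemma expr_mod (u v : A) n : exists w, (u + v * G) ^+ n = u ^+ n + w * G.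
Proof.
elim: n => [|n [w e]]; first by exists 0; rewrite mul0r addr0.
exists (u * w + v * u ^+ n + v * w * G); rewrite !exprS e; ring.
Qed.

(** Modulo G the squares of the three entries are T a, T b, T c with a common factor T. Hence the
    sum of the odd powers is T^n p q r times (Y - X - Z) + (X - Y - Z) + 2 Z = 0. *)
Lemma fermat_mod_curve n : p = a ^+ n -> q = b ^+ n -> r = c ^+ n ->
  exists w, ((Y - X - Z) * (q * r)) ^+ n.*2.+1 + ((X - Y - Z) * (p * r)) ^+ n.*2.+1 +
    (2 * Z * (p * q)) ^+ n.*2.+1 = w * G.
Proof.
move=> ep eq er.
have pw (t : A) : t ^+ n.*2.+1 = t * (t ^+ 2) ^+ n by rewrite exprS -mul2n exprM.
pose T := 4 * Z * (p * q * r) ^+ 2.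
have e0 : ((Y - X - Z) * (q * r)) ^+ 2 = T * a + (q * r) ^+ 2 * G.
  by rewrite /T /G /curve_form /X /Y /Z; ring.
have e1 : ((X - Y - Z) * (p * r)) ^+ 2 = T * b + (p * r) ^+ 2 * G.
  by rewrite /T /G /curve_form /X /Y /Z; ring.
have e2 : (2 * Z * (p * q)) ^+ 2 = T * c by rewrite /T /Z; ring.
rewrite !pw e0 e1 e2.
have [w0 ->] := expr_mod (T * a) ((q * r) ^+ 2) n.
have [w1 ->] := expr_mod (T * b) ((p * r) ^+ 2) n.
rewrite !exprMn -ep -eq -er.
exists ((Y - X - Z) * (q * r) * w0 + (X - Y - Z) * (p * r) * w1).
move: (T ^+ n) => U; move: G => G'; ring.
Qed.

Lemma psi_phi01 : ((Y ^+ 2 - X ^+ 2 - Z ^+ 2) * (q ^+ 2 * r ^+ 2)) * b -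
  ((X ^+ 2 - Y ^+ 2 - Z ^+ 2) * (p ^+ 2 * r ^+ 2)) * a =
  ((Y - X - Z) * (q ^+ 2 * r ^+ 2) * b - (X - Y - Z) * (p ^+ 2 * r ^+ 2) * a) * (X + Y + Z).
Proof. by rewrite /X /Y /Z; ring. Qed.

Lemma psi_phi02 : ((Y ^+ 2 - X ^+ 2 - Z ^+ 2) * (q ^+ 2 * r ^+ 2)) * c -
  (2 * Z ^+ 2 * (p ^+ 2 * q ^+ 2)) * a =
  ((Y - X - Z) * (q ^+ 2 * r ^+ 2) * c) * (X + Y + Z).
Proof. by rewrite /X /Y /Z; ring. Qed.

Lemma psi_phi12 : ((X ^+ 2 - Y ^+ 2 - Z ^+ 2) * (p ^+ 2 * r ^+ 2)) * c -
  (2 * Z ^+ 2 * (p ^+ 2 * q ^+ 2)) * b =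
  ((X - Y - Z) * (p ^+ 2 * r ^+ 2) * c) * (X + Y + Z).
Proof. by rewrite /X /Y /Z; ring. Qed.

End Identities.

Notation phi := curve_to_fermat.
Notation psi := (squares K).

Lemma expr_odd (A : comNzRingType) (t : A) : t ^+ k = t * (t ^+ m) ^+ 2.
Proof. by rewrite /k exprS -muln2 exprM. Qed.

Lemma curve_odd : f = curve_form (x * (x ^+ m) ^+ 2) (y * (y ^+ m) ^+ 2) (z * (z ^+ m) ^+ 2).
Proof. by rewrite /f plane_curveE !expr_odd. Qed.

Lemma fermat_odd : F = x * (x ^+ m) ^+ 2 + y * (y ^+ m) ^+ 2 + z * (z ^+ m) ^+ 2.
Proof. by rewrite /F /fermat !mpolyC1 !mul1r !expr_odd. Qed.

Lemma phi_entries : [/\ tnth phi 0 = (y ^+ k - x ^+ k - z ^+ k) * (y ^+ m * z ^+ m),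
  tnth phi 1 = (x ^+ k - y ^+ k - z ^+ k) * (x ^+ m * z ^+ m) &
  tnth phi 2 = 2 * z ^+ k * (x ^+ m * y ^+ m)].
Proof. by []. Qed.

Opaque curve_to_fermat squares.

Lemma phi0 : tnth phi 0 = (y * (y ^+ m) ^+ 2 - x * (x ^+ m) ^+ 2 - z * (z ^+ m) ^+ 2)
  * (y ^+ m * z ^+ m).
Proof. by have [-> _ _] := phi_entries; rewrite -!expr_odd. Qed.

Lemma phi1 : tnth phi 1 = (x * (x ^+ m) ^+ 2 - y * (y ^+ m) ^+ 2 - z * (z ^+ m) ^+ 2)
  * (x ^+ m * z ^+ m).
Proof. by have [_ -> _] := phi_entries; rewrite -!expr_odd. Qed.

Lemma phi2 : tnth phi 2 = 2 * (z * (z ^+ m) ^+ 2) * (x ^+ m * y ^+ m).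
Proof. by have [_ _ ->] := phi_entries; rewrite -!expr_odd. Qed.

Lemma fermat11_mPo (t : 3.-tuple S) :
  F \mPo t = tnth t 0 ^+ k + tnth t 1 ^+ k + tnth t 2 ^+ k.
Proof. by rewrite /F fermat_mPo !mpolyC1 !mul1r. Qed.

Lemma dvdm_minors (q : S) (t : 'I_3 -> S) :
  dvd q (t 0 * y - t 1 * x) -> dvd q (t 0 * z - t 2 * x) ->
  dvd q (t 1 * z - t 2 * y) -> forall i j, dvd q (t i * 'X_j - t j * 'X_i).
Proof.
move=> d01 d02 d12.
have sw a b : dvd q (a - b) -> dvd q (b - a).
  by rewrite -[b - a]opprB; apply: dvdmN.
have dd i : dvd q (t i * 'X_i - t i * 'X_i) by rewrite subrr; apply: dvdm0.
apply: ord3_cases; apply: ord3_cases; try exact: dd; try assumption.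
- exact: sw d01.
- exact: sw d02.
- exact: sw d12.
Qed.

Lemma fermat_phi : dvd f (F \mPo phi).
Proof.
rewrite fermat11_mPo phi0 phi1 phi2 curve_odd.
have [w e] := @fermat_mod_curve S x y z (x ^+ m) (y ^+ m) (z ^+ m) m erefl erefl erefl.
by exists w.
Qed.

Lemma phi_homog i : tnth phi i \is (k + (m + m)).-homog.
Proof.
have h (j l : 'I_3) : ('X_j ^+ m * 'X_l ^+ m : S) \is (m + m).-homog.
  by apply: dhomogM; apply: homog_Xn.
have h3 (a b c : 'I_3) : ('X_a ^+ k - 'X_b ^+ k - 'X_c ^+ k : S) \is k.-homog.
  by rewrite !rpredB ?homog_Xn.
have [e0 e1 e2] := phi_entries; move: i; apply: ord3_cases.
- by rewrite e0; apply: dhomogM (h3 _ _ _) (h _ _).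
- by rewrite e1; apply: dhomogM (h3 _ _ _) (h _ _).
- rewrite e2; apply: dhomogM (h _ _); rewrite mulr_natl; exact: rpredMn (homog_Xn _ _ _).
Qed.

Lemma psi_phi_id i j : dvd f ((tnth psi i \mPo phi) * 'X_j - (tnth psi j \mPo phi) * 'X_i).
Proof.
have e l : tnth psi l \mPo phi = tnth phi l ^+ 2.
  by rewrite tnth_squares comp_mpolyXin.
rewrite !e; apply: (dvdm_minors (t := fun l => tnth phi l ^+ 2)).
- by rewrite phi0 phi1 curve_odd; eexists; apply: phi_psi01.
- by rewrite phi0 phi2 curve_odd; eexists; apply: phi_psi02.
- by rewrite phi1 phi2 curve_odd; eexists; apply: phi_psi12.
Qed.

Lemma mpolyXn_squares (l : 'I_3) n : ('X_l ^+ n : S) \mPo psi = ('X_l ^+ n) ^+ 2.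
Proof. by rewrite comp_mpolyXin tnth_squares -!exprM mulnC. Qed.

Lemma phi0_squares : tnth phi 0 \mPo psi = ((y * (y ^+ m) ^+ 2) ^+ 2 -
    (x * (x ^+ m) ^+ 2) ^+ 2 - (z * (z ^+ m) ^+ 2) ^+ 2) *
    ((y ^+ m) ^+ 2 * (z ^+ m) ^+ 2).
Proof.
rewrite -!expr_odd; have [-> _ _] := phi_entries.
by rewrite (rmorph_diff_mul (comp_mpoly psi)) /= !mpolyXn_squares.
Qed.

Lemma phi1_squares : tnth phi 1 \mPo psi = ((x * (x ^+ m) ^+ 2) ^+ 2 -
    (y * (y ^+ m) ^+ 2) ^+ 2 - (z * (z ^+ m) ^+ 2) ^+ 2) *
    ((x ^+ m) ^+ 2 * (z ^+ m) ^+ 2).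
Proof.
rewrite -!expr_odd; have [_ -> _] := phi_entries.
by rewrite (rmorph_diff_mul (comp_mpoly psi)) /= !mpolyXn_squares.
Qed.

Lemma phi2_squares : tnth phi 2 \mPo psi =
    2 * (z * (z ^+ m) ^+ 2) ^+ 2 * ((x ^+ m) ^+ 2 * (y ^+ m) ^+ 2).
Proof.
rewrite -!expr_odd; have [_ _ ->] := phi_entries.
by rewrite (rmorph_double_mul (comp_mpoly psi)) /= !mpolyXn_squares.
Qed.

Lemma phi_psi_id i j : dvd F ((tnth phi i \mPo psi) * 'X_j - (tnth phi j \mPo psi) * 'X_i).
Proof.
apply: (dvdm_minors (t := fun l => tnth phi l \mPo psi)).
- by rewrite phi0_squares phi1_squares fermat_odd; eexists; apply: psi_phi01.
- by rewrite phi0_squares phi2_squares fermat_odd; eexists; apply: psi_phi02.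
- by rewrite phi1_squares phi2_squares fermat_odd; eexists; apply: psi_phi12.
Qed.

(** Points of the curve and of the Fermat curve off the coordinate lines; evaluation there shows
    that the rational maps and their composites are not identically zero. *)
Let w4 := pt3 1 1 (k.-root 4 : K).
Let w2 := pt3 1 1 (k.-root (- 2) : K).

Lemma w4_curve : f.@[w4] = 0.
Proof.
rewrite meval_curve /w4 /pt3 /= expr1n rootCK // /curve_form; ring.
Qed.

Lemma w2_fermat : F.@[w2] = 0.
Proof. by rewrite meval_fermat /w2 /pt3 /= expr1n rootCK //; ring. Qed.

Lemma phi2_w4 : (tnth phi 2).@[w4] = 8.
Proof.
have [_ _ ->] := phi_entries; rewrite !mevalM !mevalXn.
by rewrite rmorph_nat /w4 /pt3 /= !expr1n rootCK //; ring.
Qed.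

Lemma fermat_birational : birational (n := 2) (m := 2) (dvd f) (dvd F).
Proof.
have n8 : (8 : K) != 0 by rewrite pnatr_eq0.
exists phi, psi; split.
- split; first by exists (k + (m + m))%N; apply: phi_homog.
    exists 2 => d; have := dvdm_eval d w4_curve; rewrite phi2_w4.
    by apply/eqP.
  by move=> H [c ->]; rewrite rmorphM /=; apply/dvdm_mull/fermat_phi.
- split; first by exists 2%N => i; rewrite tnth_squares homog_Xn.
    exists 0 => d; have /eqP := dvdm_eval d w2_fermat.
    by rewrite tnth_squares mevalXn /w2 /pt3 /= expr1n oner_eq0.
  move=> H [c ->]; rewrite rmorphM /=; apply: dvdm_mull.
  rewrite curve_squares (bigD1 0) //=; apply: dvdm_mulr.
  by rewrite /component /= !expr0; apply: dvdm_refl.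
- split; last exact: psi_phi_id.
  exists 2 => d; have /eqP := dvdm_eval d w4_curve.
  by rewrite tnth_squares comp_mpolyXin rmorphXn /= phi2_w4 expf_eq0 (negPf n8).
- split; last exact: phi_psi_id.
  exists 2 => d; have /eqP := dvdm_eval d w2_fermat.
  rewrite comp_mpoly_meval (meval_eq (v2 := fun i => w2 i ^+ 2)); last first.
    by move=> i; rewrite tnth_squares mevalXn.
  have [_ _ ->] := phi_entries; rewrite !mevalM !mevalXn.
  rewrite rmorph_nat /w2 /pt3 /= !expr1n -exprM mulnC exprM rootCK //.
  by rewrite sqrrN !mulr1 -natrX -natrM pnatr_eq0.
Qed.

End Birational.

Lemma curve_geometric_genus k : odd k ->
  geometric_genus (plane_curve_poly K k) (((k - 1) * (k - 2)) %/ 2)%N.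
Proof.
move=> ok; have -> : k = k./2.*2.+1 by rewrite -[LHS]odd_double_half ok.
move: (k./2) => m; exists 2, (dvd (fermat 1 1 m.*2.+1)).
have n1 : (1 : K) != 0 := oner_neq0 _.
have [_ nU _] := fermat_irreducible n1 n1 (ltn0Sn m.*2).
split.
- by apply: (prime_homogeneous (prime_fermat n1 n1 _) nU (fermat_homog _ _ _)).
- exact: fermat_nonsingular.
- have := fermat_arithmetic_genus m.*2; congr curve_of_arithmetic_genus.
  by rewrite bin2 -divn2 subn1 /= subSS subn1.
- exact: fermat_birational.
Qed.

End Genus.

(** * Singular points and their local equations *)

Section SingularPoints.
Variables (K : numClosedFieldType) (k' : nat).
Notation k := k'.+1.
Notation S := {mpoly K[3]}.
Let f : S := plane_curve_poly K k.

Lemma singularE (v : 'I_3 -> K) :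
  (f.@[v] = 0 /\ forall i, f^`M(i).@[v] = 0) <->
  (f.@[v] = 0 /\ forall i, (grad K k' i).@[v] = 0).
Proof.
have n0 : (2 * k)%:R != 0 :> K by rewrite pnatr_eq0.
have e i : f^`M(i).@[v] = (2 * k)%:R * (grad K k' i).@[v].
  by rewrite mderiv_curve mevalM rmorph_nat.
split=> -[fv H]; split=> // i; last by rewrite e H mulr0.
by have /eqP := H i; rewrite e mulf_eq0 (negPf n0) => /eqP.
Qed.

Lemma grad_eval (v : 'I_3 -> K) :
  [/\ (grad K k' 0).@[v] = v 0 ^+ k' * (v 0 ^+ k - v 1 ^+ k - v 2 ^+ k),
      (grad K k' 1).@[v] = v 1 ^+ k' * (v 1 ^+ k - v 0 ^+ k - v 2 ^+ k) &
      (grad K k' 2).@[v] = v 2 ^+ k' * (v 2 ^+ k - v 0 ^+ k - v 1 ^+ k)].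
Proof.
split; rewrite meval_grad; congr (_ * _).
- exact: meval_lin0.
- exact: meval_lin1.
- exact: meval_lin2.
Qed.

Definition node_at (v : 'I_3 -> K) (j : 'I_3) :=
  v j = 0 /\ forall a b, a != j -> b != j -> v a != 0 /\ v a ^+ k = v b ^+ k.

(** The two remaining gradient equations on a coordinate line; the [0] is the k-th power of the
    vanishing coordinate. *)
Lemma node_grad_alg (b c : K) : c ^+ k' * (c ^+ k - 0 - b ^+ k) = 0 ->
  b ^+ k' * (b ^+ k - 0 - c ^+ k) = 0 -> (b != 0) || (c != 0) ->
  [/\ b != 0, c != 0 & b ^+ k = c ^+ k].
Proof.
rewrite !subr0; have [->|b0] := eqVneq b 0.
  rewrite [0 ^+ k]expr0n subr0 -exprD => /eqP; rewrite expf_eq0 => /andP[_ c0] _.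
  by rewrite c0.
have [->|c0] := eqVneq c 0.
  rewrite [0 ^+ k]expr0n subr0 -exprD => _ /eqP.
  by rewrite expf_eq0 (negPf b0) andbF.
move=> _ /eqP; rewrite mulf_eq0 expf_eq0 (negPf b0) andbF subr_eq0 => /eqP e.
by split.
Qed.

(** If x and y are nonzero, the linear factors of the first two derivatives vanish, and they add up
    to - 2 z^k. *)
Lemma grad_zero_coord (v : 'I_3 -> K) : (forall i, (grad K k' i).@[v] = 0) ->
  exists j, v j = 0.
Proof.
move=> H; have [g0 g1 _] := grad_eval v.
rewrite H in g0; rewrite H in g1.
have [v0|v0] := eqVneq (v 0) 0; first by exists 0.
have [v1|v1] := eqVneq (v 1) 0; first by exists 1.
exists 2; move/esym/eqP: g0; move/esym/eqP: g1.
rewrite !mulf_eq0 !expf_eq0 (negPf v0) (negPf v1) !andbF /= => /eqP e1 /eqP e0.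
have /eqP : v 2 ^+ k = 0.
  have two : (2 : K) != 0 by rewrite pnatr_eq0.
  apply: (mulfI two); rewrite mulr0.
  by apply: (lc2 (c1 := -1) (c2 := -1) e0 e1); ring.
by rewrite expf_eq0 => /andP[_ /eqP].
Qed.

Lemma grad_node (v : 'I_3 -> K) : (forall i, (grad K k' i).@[v] = 0) ->
  (exists i, v i != 0) -> exists j, node_at v j.
Proof.
move=> H [i vi]; have [j vj] := grad_zero_coord H; exists j; split=> //.
have z : 0 ^+ k = 0 :> K by rewrite expr0n.
have [g0 g1 g2] := grad_eval v; rewrite H in g0; rewrite H in g1; rewrite H in g2.
move: j vj; apply: ord3_cases => vj.
- rewrite vj z in g1 g2.
  have [] := node_grad_alg (esym g2) (esym g1).
    by move: i vi; apply: ord3_cases; rewrite ?vj ?eqxx // => ->; rewrite ?orbT.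
  move=> v1 v2 e12; apply: ord3_cases; apply: ord3_cases => //; by rewrite e12.
- rewrite vj z in g0 g2.
  have [] := @node_grad_alg (v 0) (v 2).
  + by rewrite [RHS]g2; ring.
  + by rewrite [RHS]g0; ring.
  + by move: i vi; apply: ord3_cases; rewrite ?vj ?eqxx // => ->; rewrite ?orbT.
  move=> v0 v2 e02; apply: ord3_cases; apply: ord3_cases => //; by rewrite e02.
- rewrite vj z in g0 g1.
  have [] := @node_grad_alg (v 0) (v 1).
  + by rewrite [RHS]g1; ring.
  + by rewrite [RHS]g0; ring.
  + by move: i vi; apply: ord3_cases; rewrite ?vj ?eqxx // => ->; rewrite ?orbT.
  move=> v0 v1 e01; apply: ord3_cases; apply: ord3_cases => //; by rewrite e01.
Qed.

Lemma smooth_conic (v : 'I_3 -> K) : k' = 0%N ->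
  (forall i, (grad K k' i).@[v] = 0) -> forall i, v i = 0.
Proof.
move=> k0 H; have [g0 g1 g2] := grad_eval v.
move: (etrans (esym g0) (H 0)) (etrans (esym g1) (H 1)) (etrans (esym g2) (H 2)).
rewrite {H g0 g1 g2} k0 !expr0 !expr1 !mul1r => g0 g1 g2.
have two : (2 : K) != 0 by rewrite pnatr_eq0.
apply: ord3_cases; apply: (mulfI two); rewrite mulr0.
- by apply: (lc2 (c1 := -1) (c2 := -1) g1 g2); ring.
- by apply: (lc2 (c1 := -1) (c2 := -1) g0 g2); ring.
- by apply: (lc2 (c1 := -1) (c2 := -1) g0 g1); ring.
Qed.

Lemma node_singular (v : 'I_3 -> K) j : (0 < k')%N -> node_at v j ->
  f.@[v] = 0 /\ forall i, (grad K k' i).@[v] = 0.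
Proof.
move=> k0 [vj H]; have [g0 g1 g2] := grad_eval v; rewrite meval_curve.
have z : 0 ^+ k' = 0 :> K by rewrite expr0n gtn_eqF.
have zk : 0 ^+ k = 0 :> K by rewrite expr0n.
move: j vj H g0 g1 g2; apply: ord3_cases => -> H; rewrite z zk.
- have [_ ->] := H 1 2 isT isT => g0 g1 g2; split; first by rewrite /curve_form /=; ring.
  by apply: ord3_cases; rewrite (g0, g1, g2) /=; ring.
- have [_ ->] := H 0 2 isT isT => g0 g1 g2; split; first by rewrite /curve_form /=; ring.
  by apply: ord3_cases; rewrite (g0, g1, g2) /=; ring.
- have [_ ->] := H 0 1 isT isT => g0 g1 g2; split; first by rewrite /curve_form /=; ring.
  by apply: ord3_cases; rewrite (g0, g1, g2) /=; ring.
Qed.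

Lemma conic_smooth (p : P2 K) : k' = 0%N -> ~ singular_point f p.
Proof.
move=> k0 /singularE[_ H]; have /eqP[] := vpick_P2 p.
by apply/rowP=> i; rewrite mxE (smooth_conic k0 H).
Qed.

Lemma node_scale (v : 'I_3 -> K) c j : c != 0 -> node_at v j ->
  node_at (fun i => c * v i) j.
Proof.
move=> c0 [vj H]; split=> [|a b aj bj]; first by rewrite vj mulr0.
have [va e] := H a b aj bj.
by rewrite mulf_neq0 //; split=> //; rewrite !exprMn e.
Qed.

Lemma P2_coord (p : P2 K) : exists i, vpick (val p) 0 i != 0.
Proof.
case: (pickP (fun i => vpick (val p) 0 i != 0)) => [i vi|H]; first by exists i.
case/eqP: (vpick_P2 p); apply/rowP => i; rewrite mxE; apply/eqP.
by have := H i; rewrite /= => /negbFE.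
Qed.

Lemma singular_node (p : P2 K) : singular_point f p ->
  exists j, node_at (vpick (val p) 0) j.
Proof. by move=> /singularE[_ H]; apply: grad_node H (P2_coord p). Qed.

(** The first coordinate other than the j-th is normalized to 1, which makes [w] an invariant of the
    point. *)
Definition node_vec (j : 'I_3) (w : K) : 'rV[K]_3 :=
  \row_l (if l == j then 0 else if l == (if j == 0 then 1 else 0) then 1 else w).

Lemma node_vec_neq0 j w : node_vec j w != 0.
Proof.
apply/eqP => /rowP/(_ (if j == 0 then 1 else 0)); rewrite !mxE eqxx.
by move: j; apply: ord3_cases => /= /eqP; rewrite oner_eq0.
Qed.

Lemma vec_P2_subproof (v : 'rV[K]_3) : v != 0 -> \dim <[v]>%VS == 1%N.
Proof. by rewrite dim_vline => ->. Qed.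

Definition node_point (j : 'I_3) (w : K) : P2 K :=
  exist _ <[node_vec j w]>%VS (vec_P2_subproof (node_vec_neq0 j w)).

Lemma P2_line (p : P2 K) : val p = <[vpick (val p)]>%VS.
Proof.
apply/esym/eqP; rewrite eqEdim -memvE memv_pick dim_vline vpick_P2.
by case: p => L /= /eqP ->.
Qed.

Lemma vline_scale (v : 'rV[K]_3) c : c != 0 -> <[c *: v]>%VS = <[v]>%VS.
Proof.
move=> c0; apply/eqP; rewrite eqEsubv -!memvE memvZ ?memv_line //=.
by apply/vlineP; exists c^-1; rewrite scalerA mulVf ?scale1r.
Qed.

Lemma node_point_pick j w : exists2 c, c != 0 &
  vpick (val (node_point j w)) = c *: node_vec j w.
Proof.
have : vpick (val (node_point j w)) \in val (node_point j w) := memv_pick _.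
move=> /vlineP[c e]; exists c => //.
by apply: contraTneq (vpick_P2 (node_point j w)) => c0; rewrite e c0 scale0r eqxx.
Qed.

Lemma node_vec_node j w : w ^+ k = 1 -> node_at (node_vec j w 0) j.
Proof.
move=> wk; have w0 : w != 0.
  by apply: contra_eq_neq wk => ->; rewrite expr0n eq_sym oner_eq0.
split=> [|a b aj bj]; rewrite !mxE ?eqxx // (negPf aj) (negPf bj).
by split; case: (a == _); rewrite ?oner_neq0 //; case: (b == _); rewrite ?wk ?expr1n.
Qed.

Lemma node_point_singular j w : (0 < k')%N -> w ^+ k = 1 ->
  singular_point f (node_point j w).
Proof.
move=> k0 wk; apply/singularE; have [c c0 ->] := node_point_pick j w.
have := node_scale c0 (node_vec_node j wk) => /(node_singular k0).
have e i : (c *: node_vec j w) 0 i = c * node_vec j w 0 i by rewrite mxE.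
by move=> [fv H]; split=> [|i]; rewrite (meval_eq _ e).
Qed.

Lemma singular_node_point (p : P2 K) : singular_point f p ->
  exists j w, w ^+ k = 1 /\ p = node_point j w.
Proof.
move=> /singular_node[j [vj H]].
(* The two indices other than j; [fst] is the one that [node_vec] normalizes to 1. *)
pose fst : 'I_3 := if j == 0 then 1 else 0; pose lst : 'I_3 := if j == 2 then 1 else 2.
have fj : fst != j by rewrite /fst; move: j {vj H fst lst}; apply: ord3_cases.
have lj : lst != j by rewrite /lst; move: j {vj H fst lst fj}; apply: ord3_cases.
have [vf ef] := H _ _ fj lj.
exists j, (vpick (val p) 0 lst / vpick (val p) 0 fst); split.
  by rewrite exprMn exprVn -ef divff // expf_neq0.
apply: val_inj; apply: (etrans (P2_line p)); rewrite /= -[RHS](vline_scale _ vf).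
congr (<[_]>%VS); apply/rowP=> i; rewrite !mxE -/fst.
have [->|ij] := eqVneq i j; first by rewrite vj mulr0.
have [->|iF] := eqVneq i fst; first by rewrite mulr1.
have -> : i = lst.
  move: ij iF {H vj vf ef fj lj}; rewrite /fst /lst.
  by move: i j {fst lst}; apply: ord3_cases; apply: ord3_cases.
by rewrite [RHS]mulrC divfK.
Qed.

Lemma node_point_inj j w j' w' : w != 0 -> w' != 0 ->
  node_point j w = node_point j' w' -> j = j' /\ w = w'.
Proof.
move=> w0 w0' /(congr1 val) /= e.
have : node_vec j w \in <[node_vec j' w']>%VS by rewrite -e memv_line.
move=> /vlineP[c ec].
have c0 : c != 0.
  by apply: contraTneq (node_vec_neq0 j w) => c0; rewrite ec c0 scale0r eqxx.
have jj : j = j'.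
  have /rowP/(_ j) := ec; rewrite !mxE eqxx => /esym/eqP.
  rewrite mulf_eq0 (negPf c0) /=; have [//|_] := eqVneq j j'.
  by case: ifP; rewrite ?oner_eq0 // (negPf w0').
split=> //; rewrite -jj in ec.
pose fst : 'I_3 := if j == 0 then 1 else 0; pose lst : 'I_3 := if j == 2 then 1 else 2.
have fj : (fst == j) = false by rewrite /fst; move: j {ec e jj fst lst}; apply: ord3_cases.
have lj : (lst == j) = false by rewrite /lst; move: j {ec e jj fst lst fj}; apply: ord3_cases.
have lf : (lst == fst) = false.
  by rewrite /lst /fst; move: j {ec e jj fst lst fj lj}; apply: ord3_cases.
have /rowP/(_ fst) := ec; rewrite !mxE -/fst fj eqxx mulr1 => c1.
by have /rowP/(_ lst) := ec; rewrite !mxE -/fst lj lf -c1 mul1r.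
Qed.

Lemma roots_of_unity : exists rs : seq K,
  [/\ uniq rs, size rs = k & forall w, w \in rs = (w ^+ k == 1)].
Proof.
have [rs e] := closed_field_poly_normal ('X^k - 1 : {poly K}).
rewrite (monicP _) ?monicXnsubC // scale1r in e.
exists rs; split.
- by rewrite -separable_prod_XsubC -e separable_Xn_sub_1 // pnatr_eq0.
- by apply: succn_inj; rewrite -(size_prod_XsubC rs id) -e size_XnsubC.
move=> w; rewrite -root_prod_XsubC -e rootE hornerD hornerN hornerXn hornerC.
by rewrite subr_eq0.
Qed.

Lemma singular_points : (0 < k')%N -> exists s : seq (P2 K),
  [/\ uniq s, size s = (3 * k)%N & forall p, singular_point f p <-> p \in s].
Proof.
move=> k0; have [rs [urs szrs mem_rs]] := roots_of_unity.
have rs0 w : w \in rs -> w != 0.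
  rewrite mem_rs => wk; apply: contraTneq wk => ->.
  by rewrite expr0n eq_sym oner_eq0.
exists [seq node_point j w | j <- enum 'I_3, w <- rs]; split.
- apply: allpairs_uniq; rewrite ?enum_uniq // => -[j w] [j' w'].
  move=> /allpairsP[[j1 w1] /= [_ w1r [-> ->]]] /allpairsP[[j2 w2] /= [_ w2r [-> ->]]].
  by move=> /(node_point_inj (rs0 _ w1r) (rs0 _ w2r)) /= [-> ->].
- by rewrite size_allpairs size_enum_ord szrs.
move=> p; split=> [/singular_node_point[j [w [wk ->]]]|/allpairsP[[j w] [_ wr ->]]].
  by apply/allpairsP; exists (j, w); rewrite mem_enum mem_rs wk /=.
by apply: node_point_singular; rewrite // -?mem_rs; apply/eqP; rewrite -mem_rs.
Qed.

Definition other (l : 'I_2) : 'I_2 := if l == 0 then 1 else 0.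

(** ['X_l] is the coordinate that vanishes at the point, ['X_(other l)] is the displacement of the
    coordinate with value [w], and 1 comes from the chart. *)
Definition local_form (l : 'I_2) (w : K) : {mpoly K[2]} :=
  curve_form 1 ('X_l ^+ k) ((w%:MP + 'X_(other l)) ^+ k).

Lemma curve_form_sym (A : comNzRingType) (a b c : A) :
  curve_form a b c = curve_form b a c /\ curve_form a b c = curve_form a c b.
Proof. by split; rewrite /curve_form; ring. Qed.

Lemma local_equation_mPo p : local_equation f p =
  let t j : {mpoly K[2]} := (affine_rep p 0 j)%:MP + oapp (fun l => 'X_l) 0
                  (unlift (chart p) j) in
  curve_form (t 0 ^+ k) (t 1 ^+ k) (t 2 ^+ k).
Proof.
rewrite /local_equation /f plane_curveE (rmorph_curve_form (comp_mpoly _)) /=.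
by rewrite !rmorphXn /= !comp_mpolyXU -!tnth_nth !tnth_mktuple.
Qed.

Lemma unlift3 :
  (unlift (0 : 'I_3) 1 = Some 0) * (unlift (0 : 'I_3) 2 = Some 1) *
  (unlift (1 : 'I_3) 0 = Some 0) * (unlift (1 : 'I_3) 2 = Some 1) *
  ((unlift (2 : 'I_3) 0 = Some 0) * (unlift (2 : 'I_3) 1 = Some 1)).
Proof.
have u (h i : 'I_3) (l : 'I_2) : lift h l = i -> unlift h i = Some l.
  by move=> <-; rewrite liftK.
by repeat split; apply: u; apply: val_inj.
Qed.

(** The six cases differ in which affine variable belongs to the vanishing coordinate and in the
    order of the arguments; the symmetry of the conic removes the latter difference. *)
Lemma local_form_cases (a : 'I_3 -> K) (ch j : 'I_3) : ch != j -> a ch = 1 ->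
  a j = 0 -> (forall o, o != j -> a o ^+ k = 1) ->
  exists l w, w ^+ k = 1 /\
    let t j : {mpoly K[2]} := (a j)%:MP + oapp (fun l => 'X_l) 0 (unlift ch j) in
    curve_form (t 0 ^+ k) (t 1 ^+ k) (t 2 ^+ k) = local_form l w.
Proof.
have one1 : (1%:MP + 0 : {mpoly K[2]}) ^+ k = 1 by rewrite mpolyC1 addr0 expr1n.
have zX l : (0%:MP + 'X_l : {mpoly K[2]}) ^+ k = 'X_l ^+ k by rewrite mpolyC0 add0r.
move: ch j; apply: ord3_cases; apply: ord3_cases => // _ a1 a0 H.
- exists 0, (a 2); split; [exact: H|].
  by cbv zeta beta; rewrite unlift_none !unlift3 a1 a0 [oapp _ _ _]/= !one1 zX.
- exists 1, (a 1); split; [exact: H|].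
  cbv zeta beta; rewrite unlift_none !unlift3 a1 a0 [oapp _ _ _]/= !one1 zX.
  by have [_ ->] := curve_form_sym 1 ((((a 1)%:MP + 'X_0) : {mpoly K[2]}) ^+ k) ('X_1 ^+ k).
- exists 0, (a 2); split; [exact: H|].
  cbv zeta beta; rewrite unlift_none !unlift3 a1 a0 [oapp _ _ _]/= !one1 zX.
  by have [-> _] := curve_form_sym ('X_0 ^+ k) 1 ((((a 2)%:MP + 'X_1) : {mpoly K[2]}) ^+ k).
- exists 1, (a 0); split; [exact: H|].
  cbv zeta beta; rewrite unlift_none !unlift3 a1 a0 [oapp _ _ _]/= !one1 zX.
  have [-> _] := curve_form_sym ((((a 0)%:MP + 'X_0) : {mpoly K[2]}) ^+ k) 1 ('X_1 ^+ k).
  by have [_ ->] := curve_form_sym 1 ((((a 0)%:MP + 'X_0) : {mpoly K[2]}) ^+ k) ('X_1 ^+ k).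
- exists 0, (a 1); split; [exact: H|].
  cbv zeta beta; rewrite unlift_none !unlift3 a1 a0 [oapp _ _ _]/= !one1 zX.
  have [_ ->] := curve_form_sym ('X_0 ^+ k) ((((a 1)%:MP + 'X_1) : {mpoly K[2]}) ^+ k) 1.
  by have [-> _] := curve_form_sym ('X_0 ^+ k) 1 ((((a 1)%:MP + 'X_1) : {mpoly K[2]}) ^+ k).
- exists 1, (a 0); split; [exact: H|].
  cbv zeta beta; rewrite unlift_none !unlift3 a1 a0 [oapp _ _ _]/= !one1 zX.
  have [_ ->] := curve_form_sym ((((a 0)%:MP + 'X_0) : {mpoly K[2]}) ^+ k) ('X_1 ^+ k) 1.
  have [-> _] := curve_form_sym ((((a 0)%:MP + 'X_0) : {mpoly K[2]}) ^+ k) 1 ('X_1 ^+ k).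
  by have [_ ->] := curve_form_sym 1 ((((a 0)%:MP + 'X_0) : {mpoly K[2]}) ^+ k) ('X_1 ^+ k).
Qed.

Lemma local_equation_node p : singular_point f p ->
  exists l w, w ^+ k = 1 /\ local_equation f p = local_form l w.
Proof.
move=> /singular_node[j [vj H]]; rewrite local_equation_mPo.
have ch0 : vpick (val p) 0 (chart p) != 0.
  rewrite /chart; case: pickP => [//|E]; have [i vi] := P2_coord p.
  by have := E i; rewrite /= vi.
have chj : chart p != j by apply: contraNneq ch0 => ->; rewrite vj.
apply: (local_form_cases (a := affine_rep p 0) chj); rewrite /affine_rep.
- by rewrite mxE mulVf.
- by rewrite mxE vj mulr0.
move=> o oj; rewrite mxE exprMn; have [_ ->] := H _ _ oj chj.
by rewrite -exprMn mulVf // expr1n.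
Qed.

End SingularPoints.

(** * The ring of double power series *)

Section DoubleSeries.
Import numFieldNormedType.Exports.
Variable K : numClosedFieldType.
Implicit Types a b c : nat -> nat -> K.

Lemma series_ext a b : (forall i j, a i j = b i j) -> a = b.
Proof. by move=> e; apply/funext => i; apply/funext => j. Qed.

Lemma series_mul_ext a b a' b' i j :
  (forall s t, (s <= i)%N -> (t <= j)%N -> a s t = a' s t) ->
  (forall s t, (s <= i)%N -> (t <= j)%N -> b s t = b' s t) ->
  series_mul a b i j = series_mul a' b' i j.
Proof.
move=> ea eb; apply: eq_bigr => s _; apply: eq_bigr => t _.
by rewrite ea ?eb ?leq_subr // -ltnS.
Qed.

Definition coef2 (p : {poly {poly K}}) : nat -> nat -> K := fun i j => p`_i`_j.

(** A coefficient of a Cauchy product depends on finitely many coefficients of the factors, so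
    commutativity and associativity are inherited from polynomials through truncation. *)
Definition trunc2 n a : {poly {poly K}} := \poly_(i < n) \poly_(j < n) a i j.

Lemma coef2M p q i j : coef2 (p * q) i j = series_mul (coef2 p) (coef2 q) i j.
Proof.
rewrite /coef2 coefM coef_sum; apply: eq_bigr => s _.
by rewrite coefM.
Qed.

Lemma coef2_trunc2 n a i j : (i < n)%N -> (j < n)%N -> coef2 (trunc2 n a) i j = a i j.
Proof. by move=> li lj; rewrite /coef2 coef_poly li coef_poly lj. Qed.

Lemma series_mul_trunc n a b i j : (i < n)%N -> (j < n)%N ->
  series_mul a b i j = coef2 (trunc2 n a * trunc2 n b) i j.
Proof.
move=> li lj; rewrite coef2M; apply: series_mul_ext => s t ls lt;
by rewrite coef2_trunc2 ?(leq_ltn_trans ls) ?(leq_ltn_trans lt).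
Qed.

Lemma series_mulC : commutative (@series_mul K).
Proof.
move=> a b; apply: series_ext => i j; set n := (i + j).+1.
have li : (i < n)%N by rewrite ltnS leq_addr.
have lj : (j < n)%N by rewrite ltnS leq_addl.
by rewrite !(series_mul_trunc _ _ li lj) mulrC.
Qed.

Lemma series_mulA : associative (@series_mul K).
Proof.
move=> a b c; apply: series_ext => i j; set n := (i + j).+1.
have li : (i < n)%N by rewrite ltnS leq_addr.
have lj : (j < n)%N by rewrite ltnS leq_addl.
have lt s m : (s <= m)%N -> (m < n)%N -> (s < n)%N by apply: leq_ltn_trans.
transitivity (coef2 (trunc2 n a * (trunc2 n b * trunc2 n c)) i j).
  rewrite coef2M; apply: series_mul_ext => s t ls l2.
    by rewrite coef2_trunc2 ?(lt _ _ ls) ?(lt _ _ l2).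
  by rewrite -series_mul_trunc ?(lt _ _ ls) ?(lt _ _ l2).
rewrite mulrA coef2M; apply: series_mul_ext => s t ls l2.
  by rewrite -series_mul_trunc ?(lt _ _ ls) ?(lt _ _ l2).
by rewrite coef2_trunc2 ?(lt _ _ ls) ?(lt _ _ l2).
Qed.

Definition mono (m n : nat) : nat -> nat -> K :=
  fun i j => ((i == m) && (j == n))%:R.

Lemma series_mul_mono m n a i j : series_mul (mono m n) a i j =
  if (m <= i)%N && (n <= j)%N then a (i - m)%N (j - n)%N else 0.
Proof.
rewrite /series_mul.
have z0 (s : 'I_i.+1) (t : 'I_j.+1) : (val s != m) || (val t != n) ->
    mono m n s t * a (i - s)%N (j - t)%N = 0.
  by rewrite /mono -negb_and => /negPf ->; rewrite mul0r.
case: (leqP m i) => [mi|im] /=; last first.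
  rewrite big1 // => s _; rewrite big1 // => t _; apply: z0.
  have ls : (val s <= i)%N := ltn_ord s.
  by apply/orP; left; rewrite neq_ltn (leq_ltn_trans ls im).
case: (leqP n j) => [nj|jn] /=; last first.
  rewrite big1 // => s _; rewrite big1 // => t _; apply: z0.
  have lt : (val t <= j)%N := ltn_ord t.
  by apply/orP; right; rewrite neq_ltn (leq_ltn_trans lt jn).
have mi' : (m < i.+1)%N by []; have nj' : (n < j.+1)%N by [].
rewrite (bigD1 (Ordinal mi')) //= (bigD1 (Ordinal nj')) //=.
rewrite {1}/mono !eqxx mul1r big1 ?addr0 => [|t nt]; last first.
  by rewrite -val_eqE in nt; apply: (z0 (Ordinal mi') t); apply/orP; right.
rewrite big1 ?addr0 // => s ns; rewrite big1 // => t _.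
by rewrite -val_eqE in ns; apply: (z0 s t); apply/orP; left.
Qed.

Lemma series_mul1 : left_id (mono 0 0) (@series_mul K).
Proof. by move=> a; apply: series_ext => i j; rewrite series_mul_mono !subn0. Qed.

Lemma series_mulDl : left_distributive (@series_mul K) +%R.
Proof.
move=> a b c; apply: series_ext => i j.
have e s t : (a + b) s t = a s t + b s t by [].
rewrite -[RHS]/(series_mul a c i j + series_mul b c i j) /series_mul.
rewrite (eq_bigr (fun s : 'I_i.+1 => \sum_(t < j.+1) a s t * c (i - s)%N (j - t)%N +
  \sum_(t < j.+1) b s t * c (i - s)%N (j - t)%N)) ?big_split // => s _.
by rewrite -big_split; apply: eq_bigr => t _ /=; rewrite e mulrDl.
Qed.

Lemma mono_neq0 : mono 0 0 != 0.
Proof.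
by apply/eqP => /(congr1 (fun a => a 0 0)%N) /eqP; rewrite /mono /= oner_eq0.
Qed.

(** A separate name that carries the Cauchy product, while its module structure stays the pointwise
    one used by [tjurina_number]. *)
Definition dseries : Type := nat -> nat -> K.

HB.instance Definition _ := GRing.Lmodule.copy dseries (nat -> nat -> K).
HB.instance Definition _ := GRing.Zmodule_isComNzRing.Build dseries
  series_mulA series_mulC series_mul1 series_mulDl mono_neq0.

Lemma dseries_scaleAl (c : K) (a b : dseries) : c *: (a * b) = (c *: a) * b.
Proof.
apply: series_ext => i j; rewrite -[LHS]/(c * series_mul a b i j).
rewrite -[RHS]/(series_mul (c *: a) b i j) /series_mul mulr_sumr.
apply: eq_bigr => s _; rewrite mulr_sumr; apply: eq_bigr => t _.
by rewrite mulrA.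
Qed.

HB.instance Definition _ := GRing.Lmodule_isLalgebra.Build K dseries dseries_scaleAl.

End DoubleSeries.

(** * Convergent series *)

Section Convergent.
Variable K : numClosedFieldType.
Notation D := (dseries K).
Implicit Types a b c : D.

Lemma dseriesME a b : a * b = series_mul a b :> D. Proof. by []. Qed.

Lemma dseriesDE a b i j : (a + b : D) i j = a i j + b i j. Proof. by []. Qed.

Lemma dseriesZE (c : K) a i j : (c *: a : D) i j = c * a i j. Proof. by []. Qed.

Lemma dseriesNE a i j : (- a : D) i j = - a i j. Proof. by []. Qed.

Lemma dseries1E : 1 = mono K 0 0 :> D. Proof. by []. Qed.

(** The bound at (0, 0) makes M nonnegative and the one at (1, 0) does the same for r, unless M = 0;
    then r is arbitrary and gets replaced by 0. *)
Lemma convergent_bound (a : D) : convergent a ->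
  exists M r : K, [/\ 0 <= M, 0 <= r & forall i j, `|a i j| <= M * r ^+ (i + j)].
Proof.
move=> [M [r H]].
have M0 : 0 <= M by have := H 0%N 0%N; rewrite expr0 mulr1; apply: le_trans.
have [Mz|Mn] := eqVneq M 0.
  exists 0, 0; split=> // i j; rewrite mul0r.
  by have := H i j; rewrite Mz mul0r.
exists M, r; split=> //; have Mp : 0 < M by rewrite lt_def Mn.
have := H 1%N 0%N; rewrite addn0 expr1 => /(le_trans (normr_ge0 _)).
by rewrite pmulr_rge0.
Qed.

Lemma convergentD a b : convergent a -> convergent b -> convergent (a + b : D).
Proof.
move=> /convergent_bound[M [r [M0 r0 Ha]]] /convergent_bound[N [q [N0 q0 Hb]]].
exists (M + N), (r + q) => i j; rewrite dseriesDE mulrDl.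
apply: le_trans (ler_normD _ _) _; apply: lerD.
  apply: le_trans (Ha i j) _; rewrite ler_wpM2l // lerXn2r ?nnegrE ?addr_ge0 //.
  by rewrite lerDl.
apply: le_trans (Hb i j) _; rewrite ler_wpM2l // lerXn2r ?nnegrE ?addr_ge0 //.
by rewrite lerDr.
Qed.

Lemma succ_le_exp2 n : n.+1%:R <= 2 ^+ n :> K.
Proof. by rewrite -natrX ler_nat ltn_expl. Qed.

Lemma convergentM a b : convergent a -> convergent b -> convergent (a * b : D).
Proof.
move=> /convergent_bound[M [r [M0 r0 Ha]]] /convergent_bound[N [q [N0 q0 Hb]]].
(* The factor 2 absorbs the number (i + 1)(j + 1) of summands, which is at most 2^(i + j). *)
exists (M * N), (2 * (r + q)) => i j; rewrite dseriesME /series_mul.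
have rq0 : 0 <= r + q by rewrite addr_ge0.
have B (s : 'I_i.+1) (t : 'I_j.+1) : `|a s t * b (i - s)%N (j - t)%N|
    <= M * N * (r + q) ^+ (i + j).
  have -> : (i + j = (s + t) + ((i - s) + (j - t)))%N.
    by have := ltn_ord s; have := ltn_ord t; lia.
  rewrite normrM exprD mulrACA; apply: ler_pM => //.
    apply: le_trans (Ha _ _) _; rewrite ler_wpM2l // lerXn2r ?nnegrE //.
    by rewrite lerDl.
  apply: le_trans (Hb _ _) _; rewrite ler_wpM2l // lerXn2r ?nnegrE //.
  by rewrite lerDr.
apply: le_trans (ler_norm_sum _ _ _) _.
apply: (@le_trans _ _ (\sum_(s < i.+1) \sum_(t < j.+1) M * N * (r + q) ^+ (i + j))).
  apply: ler_sum => s _; apply: le_trans (ler_norm_sum _ _ _) _.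
  by apply: ler_sum => t _; apply: B.
rewrite !sumr_const !card_ord -mulrnA -[leLHS]mulr_natr exprMn.
rewrite [2 ^+ _ * _]mulrC mulrA; apply: ler_wpM2l.
  by rewrite !mulr_ge0 ?exprn_ge0.
rewrite natrM mulrC exprD.
by apply: ler_pM; rewrite ?ler0n ?succ_le_exp2.
Qed.

Lemma convergentZ (c : K) a : convergent a -> convergent (c *: a : D).
Proof.
move=> /convergent_bound[M [r [M0 r0 Ha]]]; exists (`|c| * M), r => i j.
by rewrite dseriesZE normrM -mulrA ler_wpM2l.
Qed.

Lemma convergentN a : convergent a -> convergent (- a : D).
Proof. by move=> [M [r H]]; exists M, r => i j; rewrite dseriesNE normrN. Qed.

Lemma convergent0 : convergent (0 : D).
Proof. by exists 0, 0 => i j; rewrite mul0r [X in `|X|](_ : _ = 0) ?normr0. Qed.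

Lemma convergent_mono m n : convergent (mono K m n).
Proof.
exists 1, 1 => i j; rewrite expr1n mulr1 /mono.
by case: ((i == m) && (j == n)); rewrite ?normr1 ?normr0 ?ler01.
Qed.

Lemma convergent1 : convergent (1 : D). Proof. exact: convergent_mono. Qed.

Lemma convergentX a n : convergent a -> convergent (a ^+ n : D).
Proof.
move=> ca; elim: n => [|n IH]; first exact: convergent1.
by rewrite exprS; apply: convergentM.
Qed.

Lemma monoM m n m' n' : (mono K m n : D) * (mono K m' n' : D) = mono K (m + m') (n + n').
Proof.
apply: series_ext => i j; rewrite dseriesME series_mul_mono /mono.
case: leqP => [mi|im] /=; last by rewrite ltn_eqF //; lia.
case: leqP => [nj|jn] /=; last by rewrite [j == _]ltn_eqF ?andbF //; lia.
by congr (_ && _)%:R; lia.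
Qed.

Definition svar (l : 'I_2) : D := mono K (l == 0) (l == 1).

Lemma svarX l n : svar l ^+ n = mono K ((l == 0) * n) ((l == 1) * n).
Proof.
elim: n => [|n IH]; first by rewrite expr0 !muln0.
by rewrite exprS IH /svar monoM !mulnS.
Qed.

(** The first index is the exponent of [svar l], whichever of the two variables that is. *)
Definition scoef (l : 'I_2) (a : D) (i j : nat) : K := if l == 0 then a i j else a j i.

(** Exchanges the two variables, which carries results from [l = 0] to [l = 1]. *)
Definition stranspose (a : D) : D := fun i j => a j i.

Lemma stransposeM a b : stranspose (a * b) = stranspose a * stranspose b.
Proof.
apply: series_ext => i j; rewrite /stranspose !dseriesME /series_mul.
by rewrite exchange_big.
Qed.

Lemma convergent_transpose a : convergent a -> convergent (stranspose a).
Proof. by move=> [M [r H]]; exists M, r => i j; rewrite addnC; apply: H. Qed.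

Lemma stransposeK a : stranspose (stranspose a) = a.
Proof. by []. Qed.

Lemma ord2_cases (P : 'I_2 -> Prop) : P 0 -> P 1 -> forall i, P i.
Proof.
by move=> P0 P1 [[|[|//]] lt]; [move: P0|move: P1]; congr (P _); apply: val_inj.
Qed.

Lemma other0 : other 0 = 1. Proof. by []. Qed.
Lemma other1 : other 1 = 0. Proof. by []. Qed.

(** [h1] collects the pure powers of u from u^n on, and [h2] all the monomials that contain v. *)
Lemma series_split0 n (h : D) : convergent h -> exists h1 h2 : D,
  [/\ convergent h1, convergent h2 &
   h = \sum_(i < n) h i 0%N *: svar 0 ^+ i + svar 0 ^+ n * h1 + svar 1 * h2].
Proof.
move=> /convergent_bound[M [r [M0 r0 H]]].
exists (fun i j => if j == 0%N then h (i + n)%N 0%N else 0), (fun i j => h i j.+1).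
split.
- exists (M * r ^+ n), r => i j; case: eqP => [->|_].
    by have := H (i + n)%N 0%N; rewrite -mulrA -exprD !addn0 [(n + i)%N]addnC.
  by rewrite normr0 !mulr_ge0 ?exprn_ge0.
- exists (M * r), r => i j; rewrite -mulrA -exprS -addnS; exact: H.
apply: series_ext => i j; rewrite !dseriesDE !dseriesME svarX /svar !series_mul_mono.
rewrite !eqxx !mul1n !mul0n !subn0 leq0n andbT.
have -> : (\sum_(i0 < n) h i0 0%N *: svar 0 ^+ i0 : D) i j =
    if (i < n)%N && (j == 0%N) then h i 0%N else 0.
  transitivity (\sum_(s < n) h s 0%N * ((i == s) && (j == 0%N))%:R).
    rewrite fct_sumE fct_sumE; apply: eq_bigr => s _.
    by rewrite dseriesZE svarX eqxx mul1n mul0n.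
  case: (ltnP i n) => [lin|nli] /=.
    rewrite (bigD1 (Ordinal lin)) //= eqxx big1 ?addr0 => [|s ne].
      by case: eqP => _; rewrite ?mulr1 ?mulr0.
    by rewrite -val_eqE eq_sym /= in ne; rewrite (negPf ne) mulr0.
  rewrite big1 // => s _; rewrite gtn_eqF ?mulr0 //.
  exact: leq_trans nli.
case: j => [|j]; rewrite ?eqxx ?andbT ?andbF /=; last by rewrite if_same !add0r subn1.
by case: ltnP => ni; rewrite ?addr0 ?add0r // subnK.
Qed.

Lemma stransposeD a b : stranspose (a + b) = stranspose a + stranspose b.
Proof. by []. Qed.

Lemma stransposeZ (c : K) a : stranspose (c *: a) = c *: stranspose a.
Proof. by []. Qed.

Lemma stranspose_mono m n : stranspose (mono K m n) = mono K n m.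
Proof. by apply: series_ext => i j; rewrite /stranspose /mono andbC. Qed.

Lemma stranspose1 : stranspose 1 = 1.
Proof. exact: stranspose_mono. Qed.

Lemma stranspose_svarX l n : stranspose (svar l ^+ n) = svar (other l) ^+ n.
Proof.
by rewrite !svarX stranspose_mono; move: l; apply: ord2_cases.
Qed.

Lemma series_split l n (h : D) : convergent h -> exists h1 h2 : D,
  [/\ convergent h1, convergent h2 & h = \sum_(i < n) scoef l h i 0%N *: svar l ^+ i +
    svar l ^+ n * h1 + svar (other l) * h2].
Proof.
move: l; apply: ord2_cases => ch; first exact: series_split0.
have [h1 [h2 [c1 c2 e]]] := series_split0 n (convergent_transpose ch).
exists (stranspose h1), (stranspose h2); split; try exact: convergent_transpose.
rewrite -[LHS]stransposeK e !stransposeD !stransposeM stranspose_svarX.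
congr (_ + _ + _); last first.
  by rewrite -[svar 1]expr1 stranspose_svarX expr1.
rewrite (big_morph stranspose stransposeD (erefl _)).
by apply: eq_bigr => i _; rewrite stransposeZ stranspose_svarX.
Qed.

(** The ideal generated by s^n and t in the formal power series, read on coefficients, where s is
    [svar l] and t the other variable. *)
Definition axis_null l n (a : D) := forall i, (i < n)%N -> scoef l a i 0%N = 0.

Lemma axis_nullD l n a b : axis_null l n a -> axis_null l n b -> axis_null l n (a + b).
Proof.
move=> Ha Hb i li; move: (Ha i li) (Hb i li); rewrite /scoef.
by case: ifP => _; rewrite dseriesDE => -> ->; rewrite addr0.
Qed.

Lemma axis_nullN l n a : axis_null l n a -> axis_null l n (- a).
Proof.
move=> Ha i li; move: (Ha i li); rewrite /scoef.
by case: ifP => _; rewrite dseriesNE => ->; rewrite oppr0.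
Qed.

Lemma axis_nullM l n a b : axis_null l n b -> axis_null l n (a * b).
Proof.
move=> Hb i li; have M0 (c d : D) : (forall i, (i < n)%N -> d i 0%N = 0) -> (c * d) i 0%N = 0.
  move=> Hd; rewrite dseriesME /series_mul big1 // => s _.
  by rewrite big_ord1 subn0 Hd ?mulr0 // (leq_ltn_trans (leq_subr _ _)).
move: Hb; rewrite /axis_null /scoef; case: ifP => _ Hb; first exact: M0.
rewrite -[LHS]/(stranspose (a * b) i 0%N) stransposeM; exact: M0.
Qed.

Lemma axis_null_svarX l n : axis_null l n (svar l ^+ n).
Proof.
move=> i li; rewrite svarX /scoef /mono.
by move: l; apply: ord2_cases; rewrite ?eqxx /= ?mul1n (ltn_eqF li) ?andbF.
Qed.

Lemma axis_null_other l n : axis_null l n (svar (other l)).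
Proof. by move=> i li; move: l; apply: ord2_cases; rewrite /scoef /svar /mono /= ?andbF. Qed.

Lemma scoef_sum l n (c : 'rV[K]_n) (i : 'I_n) :
  scoef l (\sum_(j < n) c 0 j *: svar l ^+ j : D) i 0%N = c 0 i.
Proof.
have e a b : scoef l (a + b) i 0%N = scoef l a i 0%N + scoef l b i 0%N.
  by rewrite /scoef; case: ifP.
rewrite (big_morph (fun a => scoef l a i 0%N) e (id1 := 0)); last first.
  by rewrite /scoef; case: ifP.
have ez (j : 'I_n) : scoef l (c 0 j *: svar l ^+ j) i 0%N = c 0 j * (i == j)%:R.
  rewrite svarX /scoef; move: l {e}; apply: ord2_cases => /=;
  by rewrite dseriesZE /mono !mul1n !mul0n eqxx ?andbT -?val_eqE.
rewrite (bigD1 i) //= ez eqxx mulr1 big1 ?addr0 // => j ne.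
by rewrite ez eq_sym (negPf ne) mulr0.
Qed.

Lemma convergent_svar l : convergent (svar l). Proof. exact: convergent_mono. Qed.

Lemma geometric_inverse l (z : K) : z != 0 -> exists2 v : D, convergent v &
  v * (svar l - z *: 1) = 1.
Proof.
move=> z0.
(* The expansion 1 / (u - z) = - (1/z + u/z^2 + u^2/z^3 + ...). *)
pose v : D := fun i j => if j == 0%N then - z^-1 ^+ i.+1 else 0.
have cv : convergent v.
  exists `|z^-1|, `|z^-1| => i j; rewrite /v; case: eqP => [->|_].
    by rewrite normrN normrX addn0 exprS.
  by rewrite normr0 mulr_ge0 ?exprn_ge0.
have ev : v * (svar 0 - z *: 1) = 1.
  rewrite mulrC mulrBl -scalerAl mul1r.
  apply: series_ext => i j; rewrite dseriesDE dseriesNE dseriesZE dseriesME /svar.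
  rewrite series_mul_mono dseries1E /mono /v !subn0 eqxx.
  case: j => [|j] /=; last by rewrite andbF if_same mulr0 subr0.
  case: i => [|i] /=; first by rewrite expr1 mulrN mulfV // opprK add0r.
  rewrite subn1 /= [z^-1 ^+ i.+2]exprS mulrN mulrA mulfV // mul1r opprK.
  by rewrite addNr.
move: l; apply: ord2_cases; first by exists v.
exists (stranspose v); first exact: convergent_transpose.
have := congr1 stranspose ev; rewrite stransposeM.
rewrite stranspose1 => e1; rewrite -[RHS]e1; congr (_ * _).
rewrite stransposeD -[svar 0]expr1 stranspose_svarX expr1; congr (_ + _).
by rewrite -!scaleNr stransposeZ stranspose1.
Qed.

Definition const_series : {rmorphism K -> D} := GRing.in_alg D.

Definition eval_series l : {rmorphism {poly K} -> D} := hom_ext const_series (svar l).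

Lemma const_seriesE (c : K) : const_series c = c *: 1.
Proof. by []. Qed.

Lemma eval_seriesC l (c : K) : eval_series l c%:P = c *: 1.
Proof. by rewrite /eval_series hom_extC const_seriesE. Qed.

Lemma eval_seriesX l : eval_series l 'X = svar l.
Proof. by rewrite /eval_series hom_extX. Qed.

(** The polynomial splits into linear factors whose roots are nonzero, and each factor is inverted
    by a geometric series. *)
Lemma poly_inverse l (p : {poly K}) : p.[0] != 0 -> exists2 v : D, convergent v &
  v * eval_series l p = 1.
Proof.
have [rs e] := closed_field_poly_normal p.
have [->|p0] := eqVneq p 0; first by rewrite horner0 eqxx.
have lc0 : lead_coef p != 0 by rewrite lead_coef_eq0.
have eM (a b : {poly K}) : eval_series l (a * b) = eval_series l a * eval_series l b := rmorphM _ _ _.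
have eB (a b : {poly K}) : eval_series l (a - b) = eval_series l a - eval_series l b := rmorphB _ _ _.
have e1 : eval_series l 1 = 1 := rmorph1 _.
rewrite e hornerZ mulf_eq0 negb_or => /andP[_ nz].
have [v cv ev] : exists2 v : D, convergent v &
    v * eval_series l (\prod_(z <- rs) ('X - z%:P)) = 1.
  move: nz; elim: {e} rs => [_|z rs IH].
    by exists 1; [exact: convergent1|rewrite big_nil e1 mulr1].
  rewrite !big_cons hornerM mulf_eq0 negb_or hornerXsubC sub0r oppr_eq0.
  move=> /andP[z0 /IH[v cv ev]]; have [u cu eu] := geometric_inverse l z0.
  exists (u * v); first exact: convergentM.
  by rewrite eM eB eval_seriesX eval_seriesC mulrACA eu ev mulr1.
exists ((lead_coef p)^-1 *: v); first exact: convergentZ.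
rewrite -mul_polyC eM eval_seriesC -!scalerAl mul1r [v * _]mulrC -scalerAl.
by rewrite scalerA mulVf // scale1r mulrC.
Qed.

(** [series_of] in the form of a ring morphism, see [series_ofE]. *)
Definition sof : {rmorphism {mpoly K[2]} -> D} := mmap const_series svar.

Lemma sofE p : sof p = mmap const_series svar p. Proof. by []. Qed.

Lemma sofX i : sof 'X_i = svar i.
Proof. by rewrite sofE mmapX mmap1U. Qed.

Lemma sofC (c : K) : sof c%:MP = c *: 1.
Proof. by rewrite sofE mmapC. Qed.

Lemma sofD p q : sof (p + q) = sof p + sof q. Proof. exact: rmorphD. Qed.
Lemma sofB p q : sof (p - q) = sof p - sof q. Proof. exact: rmorphB. Qed.
Lemma sofM p q : sof (p * q) = sof p * sof q. Proof. exact: rmorphM. Qed.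
Lemma sofXn p n : sof (p ^+ n) = sof p ^+ n. Proof. exact: rmorphXn. Qed.
Lemma sof1 : sof 1 = 1. Proof. exact: rmorph1. Qed.
Lemma sof0 : sof 0 = 0. Proof. exact: rmorph0. Qed.
Lemma sof_nat n : sof n%:R = n%:R. Proof. exact: rmorph_nat. Qed.
Definition sof_morph := (sofD, sofB, sofM, sofXn, sof1, sof0, sof_nat, sofX, sofC).

Lemma mmap1_svar m : mmap1 svar m = mono K (m 0%R) (m 1%R).
Proof.
rewrite /mmap1 !big_ord_recl big_ord0 mulr1 !svarX monoM.
by rewrite !mul1n !mul0n addn0 add0n; congr (mono K (m _) (m _)); apply: val_inj.
Qed.

Lemma series_ofE p : series_of p = sof p.
Proof.
have -> : sof p = \sum_(m <- msupp p) p@_m *: (mono K (m 0%R) (m 1%R) : D).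
  rewrite sofE /mmap; apply: eq_bigr => m _.
  by rewrite mmap1_svar -scalerAl mul1r.
apply: series_ext => i j; rewrite /series_of {1}(mpolyE p) raddf_sum /=.
rewrite fct_sumE fct_sumE; apply: eq_bigr => m _.
rewrite mcoeffZ mcoeffX dseriesZE /mono; congr (_ * (nat_of_bool _)%:R).
apply/eqP/andP => [-> //|[/eqP-> /eqP ->]]; apply/mnmP.
by apply: ord2_cases; rewrite mnm_tnth.
Qed.

End Convergent.

(** * The Tjurina number of the local equation *)

Section DerivationPower.
Variables (A : comNzRingType) (d : A -> A).
Hypothesis (dM : forall u v, d (u * v) = d u * v + u * d v).

Lemma derivation_exp p n : d (p ^+ n.+1) = n.+1%:R * p ^+ n * d p.
Proof.
elim: n => [|n IH]; first by rewrite !expr1 expr0 !mul1r.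
rewrite exprS dM IH [n.+2%:R]mulrS !exprS; ring.
Qed.

End DerivationPower.

Section LocalTjurina.
Variables (K : numClosedFieldType) (k' : nat) (l : 'I_2) (w : K).
Hypothesis wk : w ^+ k'.+1 = 1.
Notation k := k'.+1.
Notation D := (dseries K).
Notation s := (svar K l).
Notation t := (svar K (other l)).
Let g : {mpoly K[2]} := local_form k' l w.
Let y : D := w *: 1 + t.
Let T : D := y ^+ k.
Let U : D := T - 1 - s ^+ k.

Let w0 : w != 0.
Proof. by apply: contra_eq_neq wk => ->; rewrite expr0n eq_sym oner_eq0. Qed.

Lemma other_neq : (other l == l = false) * (l == other l = false).
Proof. by rewrite /other; move: (l); apply: ord2_cases. Qed.

Lemma series_local : series_of g = curve_form 1 (s ^+ k) T.
Proof.
rewrite series_ofE /g /local_form.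
have e a b c : sof K (curve_form a b c) = curve_form (sof K a) (sof K b) (sof K c).
  exact: rmorph_curve_form.
by rewrite e !sof_morph.
Qed.

Lemma mderiv_local i : g^`M(i) = 2 * ((1 - 'X_l ^+ k - (w%:MP + 'X_(other l)) ^+ k) * 0 +
  ('X_l ^+ k - 1 - (w%:MP + 'X_(other l)) ^+ k) * (k%:R * 'X_l ^+ k' * (l == i)%:R) +
  ((w%:MP + 'X_(other l)) ^+ k - 1 - 'X_l ^+ k) *
    (k%:R * (w%:MP + 'X_(other l)) ^+ k' * (other l == i)%:R)).
Proof.
have dM (u v : {mpoly K[2]}) : (u * v)^`M(i) = u^`M(i) * v + u * v^`M(i) := mderivM i u v.
have dX j : ('X_j : {mpoly K[2]})^`M(i) = (j == i)%:R.
  by have := mderivXn K j i 0; rewrite !expr1 expr0 muln1 mulr1 => <-.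
rewrite /g /local_form (derivation_curve_form _ _ _ (mderivB i) (mderivD i) dM).
have d1 : (1 : {mpoly K[2]})^`M(i) = 0 by rewrite -mpolyC1 mderivC.
by rewrite d1 !(derivation_exp dM) mderivD mderivC !dX add0r.
Qed.

Lemma rmorph_derivation (A B : comNzRingType) (h : {rmorphism A -> B}) b c n p m q e1 e2 :
  h (2 * ((1 - b - c) * 0 + (b - 1 - c) * (n%:R * p * e1) +
          (c - 1 - b) * (m%:R * q * e2))) =
  2 * ((h b - 1 - h c) * (n%:R * h p * h e1) + (h c - 1 - h b) * (m%:R * h q * h e2)).
Proof.
rewrite rmorphM rmorph_nat mulr0 add0r rmorphD !rmorphM !rmorph_nat !rmorphB.
by rewrite rmorph1.
Qed.

Lemma series_local_deriv i : series_of g^`M(i) =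
  2 * ((s ^+ k - 1 - T) * (k%:R * s ^+ k' * (l == i)%:R) +
       U * (k%:R * y ^+ k' * (other l == i)%:R)).
Proof.
have e a b n p m q e1 e2 : sof K (2 * ((1 - a - b) * 0 + (a - 1 - b) * (n%:R * p * e1) +
          (b - 1 - a) * (m%:R * q * e2))) =
  2 * ((sof K a - 1 - sof K b) * (n%:R * sof K p * sof K e1) +
       (sof K b - 1 - sof K a) * (m%:R * sof K q * sof K e2)).
  exact: rmorph_derivation.
by rewrite mderiv_local series_ofE e !sofXn sofD sofC !sofX !sof_nat.
Qed.

Lemma series_local_s : series_of g^`M(l) = - (2 * (k%:R * s ^+ k') * (U + 2)).
Proof.
have e (a b n : D) : 2 * ((a - 1 - b) * n) = - (2 * n * (b - 1 - a + 2)) by ring.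
by rewrite series_local_deriv eqxx other_neq !mulr0 mulr1 addr0 e.
Qed.

Lemma series_local_t : series_of g^`M(other l) = 2 * (U * (k%:R * y ^+ k')).
Proof. by rewrite series_local_deriv eqxx other_neq !mulr0 mulr1 add0r. Qed.

(** The Tjurina ideal with its derivatives ordered as s, t instead of by index, so that both values
    of [l] are treated alike. *)
Definition local_ideal (h : D) := exists a b c : D,
  [/\ convergent a, convergent b, convergent c &
      h = a * series_of g + b * series_of g^`M(l) + c * series_of g^`M(other l)].

Lemma local_ideal_tjurina h : tjurina_ideal g h <-> local_ideal h.
Proof.
have perm (a b c : D) : a + b + c = a + c + b by rewrite addrAC.
rewrite /local_ideal; move: (l); apply: ord2_cases.
  by split=> -[a [b [c H]]]; exists a, b, c.
split=> -[a [b [c [ca cb cc ->]]]]; exists a, c, b; split=> //; exact: perm.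
Qed.

Lemma local_idealD (h h' : D) : local_ideal h -> local_ideal h' -> local_ideal (h + h').
Proof.
move=> [a [b [c [ca cb cc ->]]]] [a' [b' [c' [ca' cb' cc' ->]]]].
exists (a + a'), (b + b'), (c + c'); split; try exact: convergentD.
exact: combD.
Qed.

Lemma local_idealM (u h : D) : convergent u -> local_ideal h -> local_ideal (u * h).
Proof.
move=> cu [a [b [c [ca cb cc ->]]]].
exists (u * a), (u * b), (u * c); split; try exact: convergentM.
exact: combM.
Qed.

Lemma local_ideal_deriv i : local_ideal (series_of g^`M(i)).
Proof.
have c0 := convergent0 K; have c1 := convergent1 K.
have [->|->] : i = l \/ i = other l.
  by rewrite /other; move: (l) i; apply: ord2_cases; apply: ord2_cases; [left|right|right|left].
- by exists 0, 1, 0; split=> //; rewrite !mul0r mul1r addr0 add0r.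
- by exists 0, 0, 1; split=> //; rewrite !mul0r mul1r !add0r.
Qed.

Lemma natr_inverse n : exists2 q : D, convergent q & q * n.+1%:R = 1.
Proof.
exists (n.+1%:R^-1 *: 1); first exact/convergentZ/convergent1.
by rewrite -scalerAl mul1r -scaler_nat scalerA mulVf ?scale1r // pnatr_eq0.
Qed.

Lemma shift_inverse n : exists2 v : D, convergent v & v * y ^+ n = 1.
Proof.
have [|v cv ev] := @poly_inverse K (other l) ((w%:P + 'X) ^+ n).
  by rewrite horner_exp hornerD hornerC hornerX addr0 expf_neq0.
exists v => //; rewrite -ev; congr (_ * _).
have eX (p : {poly K}) m : eval_series K (other l) (p ^+ m) = eval_series K (other l) p ^+ m
  := rmorphXn _ _ _.
have eD (p q : {poly K}) : eval_series K (other l) (p + q) =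
  eval_series K (other l) p + eval_series K (other l) q := rmorphD _ _ _.
by rewrite eX eD eval_seriesC eval_seriesX.
Qed.

(* T - 1 = t E with E a unit, since t -> (w + t)^k - w^k has a simple zero. *)
Lemma root_factor : exists E F : D, [/\ convergent F, F * E = 1 & T - 1 = t * E].
Proof.
pose p : {poly K} := (w%:P + 'X) ^+ k - 1.
have p0 : p`_0 = 0.
  rewrite -horner_coef0 hornerD hornerN hornerC horner_exp hornerD hornerC hornerX.
  by rewrite addr0 wk subrr.
have p1 : p`_1 != 0.
  have -> : p`_1 = (p^`())`_0 by rewrite coef_deriv mulr1n.
  rewrite derivB derivC subr0 deriv_exp derivD derivC derivX add0r mul1r.
  rewrite coefMn -horner_coef0 horner_exp hornerD hornerC hornerX addr0 -mulr_natr.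
  by rewrite mulf_neq0 ?expf_neq0 // pnatr_eq0.
have pE : p = 'X * drop_poly 1 p.
  apply/polyP=> -[|i]; first by rewrite coefXM p0.
  by rewrite coefXM /= coef_drop_poly addn1.
have [|F cF eF] := @poly_inverse K (other l) (drop_poly 1 p).
  by rewrite horner_coef0 coef_drop_poly.
exists (eval_series K (other l) (drop_poly 1 p)), F; split=> //.
have eX (q : {poly K}) m : eval_series K (other l) (q ^+ m) = eval_series K (other l) q ^+ m
  := rmorphXn _ _ _.
have eD (q r : {poly K}) : eval_series K (other l) (q + r) =
  eval_series K (other l) q + eval_series K (other l) r := rmorphD _ _ _.
have eB (q r : {poly K}) : eval_series K (other l) (q - r) =
  eval_series K (other l) q - eval_series K (other l) r := rmorphB _ _ _.
have eM (q r : {poly K}) : eval_series K (other l) (q * r) =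
  eval_series K (other l) q * eval_series K (other l) r := rmorphM _ _ _.
have e1 : eval_series K (other l) 1 = 1 := rmorph1 _.
rewrite -[t]eval_seriesX -eM -pE /p eB eX eD eval_seriesC eval_seriesX e1.
by [].
Qed.

(** The t-derivative is U times 2 k (w + t)^k', a unit because w is nonzero. *)
Lemma local_ideal_U : local_ideal U.
Proof.
have [q cq eq] := natr_inverse 1; have [r cr er] := natr_inverse k'.
have [v cv ev] := shift_inverse k'.
have -> : U = (q * r * v) * series_of g^`M(other l).
  rewrite series_local_t.
  transitivity ((q * 2) * (r * k%:R) * (v * y ^+ k') * U).
    by rewrite eq er ev !mul1r.
  by move: U (y ^+ k') => U' Y; ring.
by apply/local_idealM/local_ideal_deriv; do !apply: convergentM.
Qed.

(** The s-derivative is - 2 k s^k' (U + 2). As U already lies in the ideal, so does 4 k s^k'; [q]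
    and [r] are the inverses of 2 and k. *)
Lemma local_ideal_s : local_ideal (s ^+ k').
Proof.
have [q cq eq] := natr_inverse 1; have [r cr er] := natr_inverse k'.
have cs : convergent (s ^+ k') by apply/convergentX/convergent_svar.
have -> : s ^+ k' = - (q * q * r) * series_of g^`M(l) + (- (q * s ^+ k')) * U.
  rewrite series_local_s.
  transitivity ((q * 2) * (q * 2) * (r * k%:R) * s ^+ k').
    by rewrite eq er !mul1r.
  transitivity ((q * q) * (r * k%:R) * (2 * s ^+ k' * (U + 2)) - (q * s ^+ k') * (q * 2) * (r * k%:R) * U).
    by move: U (s ^+ k') => U' Y; ring.
  rewrite eq er !mulr1; move: U (s ^+ k') => U' Y.
  transitivity (q * q * (r * k%:R) * (2 * Y * (U' + 2)) - q * Y * U'); last by ring.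
  by rewrite er mulr1.
apply: local_idealD.
  apply: local_idealM (local_ideal_deriv _).
  by apply: convergentN; do !apply: convergentM.
by apply: local_idealM local_ideal_U; apply: convergentN; apply: convergentM.
Qed.

(** U + s^k = T - 1 equals t times a unit. *)
Lemma local_ideal_t : local_ideal t.
Proof.
have [E [F [cF eF eT]]] := root_factor.
have -> : t = F * (U + s * s ^+ k').
  rewrite -exprS /U subrK eT mulrCA eF mulr1 //.
apply: local_idealM => //; apply: local_idealD local_ideal_U _.
by apply: local_idealM local_ideal_s; apply: convergent_svar.
Qed.

Lemma axis_null_U : axis_null l k' U.
Proof.
have [E [F [_ _ eT]]] := root_factor; rewrite /U eT.
apply: axis_nullD; first by rewrite mulrC; apply/axis_nullM/axis_null_other.
apply: axis_nullN; rewrite exprS; exact/axis_nullM/axis_null_svarX.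
Qed.

(** All three generators lie in the ideal of s^k' and t: U does, the local equation is U^2 - 4 s^k,
    and the derivatives are multiples of s^k' and of U. This makes the classes of 1, s, ...,
    s^(k'-1) independent. *)
Lemma local_ideal_null (h : D) : local_ideal h -> axis_null l k' h.
Proof.
have zs : axis_null l k' (s ^+ k') := @axis_null_svarX _ _ _.
have eG (a b c : D) : curve_form 1 (a * b) c =
    (c - 1 - a * b) * (c - 1 - a * b) - 4 * a * b by rewrite /curve_form; ring.
have eS (a b c : D) : - (2 * (a * b) * c) = (- (2 * a * c)) * b by ring.
have eT (a b : D) : 2 * (a * b) = 2 * b * a by ring.
move=> [a [b [c [_ _ _ ->]]]]; apply: axis_nullD; first apply: axis_nullD.
- apply: axis_nullM; rewrite series_local.
  have -> : curve_form 1 (s ^+ k) T = U * U - 4 * s * s ^+ k'.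
    by rewrite /U exprS; apply: eG.
  by apply: axis_nullD; [apply/axis_nullM/axis_null_U|apply/axis_nullN/axis_nullM].
- by apply: axis_nullM; rewrite series_local_s eS; apply: axis_nullM.
- by apply: axis_nullM; rewrite series_local_t eT; apply/axis_nullM/axis_null_U.
Qed.

Lemma local_tjurina : tjurina_number g k'.
Proof.
exists (fun i : 'I_k' => s ^+ i); split=> [i|u cu].
  exact/convergentX/convergent_svar.
have [h1 [h2 [c1 c2 eu]]] := series_split l k' cu.
exists (\row_i scoef l u i 0%N); split.
  apply/local_ideal_tjurina.
  have -> : (u : D) - \sum_(i < k') (\row_i0 scoef l u i0 0%N) 0 i *: (s ^+ i : D) =
      h1 * s ^+ k' + h2 * t.
    have -> : \sum_(i < k') (\row_i0 scoef l u i0 0%N) 0 i *: (s ^+ i : D) =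
        \sum_(i < k') scoef l u i 0%N *: (s ^+ i : D).
      by apply: eq_bigr => i _; rewrite mxE.
    have e (c p q a b : D) : c + p * a + q * b - c = a * p + b * q by ring.
    by rewrite {1}eu; apply: e.
  apply: local_idealD; first exact: local_idealM local_ideal_s.
  exact: local_idealM local_ideal_t.
move=> c /local_ideal_tjurina/local_ideal_null H.
apply/rowP=> i; rewrite mxE -(scoef_sum l c i).
have := H i (ltn_ord i).
have e (a b : D) : scoef l (a - b) i 0%N = scoef l a i 0%N - scoef l b i 0%N.
  by rewrite /scoef; case: ifP.
rewrite -[LHS]/(scoef l ((u : D) - \sum_(j < k') c 0 j *: (s ^+ j : D)) i 0%N) e.
by move/eqP; rewrite subr_eq0 => /eqP.
Qed.

End LocalTjurina.

(** * A differentiable branch of the k-th root near w *)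

Section DifferentiableExpr.
Import numFieldNormedType.Exports.
Variables (K : numFieldType) (V : normedModType K).

Lemma differentiable_expr (f : V -> K) n x :
  differentiable f x -> differentiable (fun y => f y ^+ n) x.
Proof.
move=> df; case: n => [|n]; first exact: differentiable_cst.
have -> : (fun y => f y ^+ n.+1) = f ^+ n.+1.
  by apply/funext => y; elim: n => [|n IH]; rewrite ?expr1 // exprS IH.
exact: differentiableX.
Qed.

End DifferentiableExpr.

Section RootBranch.
Variables (K : numClosedFieldType) (k' : nat) (w : K).
Notation k := k'.+1.
Hypothesis wk : w ^+ k = 1.

Lemma norm_root : `|w| = 1.
Proof.
apply/eqP; rewrite -(@eqrXn2 _ k) ?normr_ge0 ?ler01 //.
by rewrite -normrX wk normr1 expr1n.
Qed.

Lemma pow_sub_bound (x v : K) n : `|x| <= 2 -> `|v| <= 2 ->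
  `|x ^+ n - v ^+ n| <= n%:R * 2 ^+ n * `|x - v|.
Proof.
move=> x2 v2; elim: n => [|n IH]; first by rewrite !expr0 subrr normr0 !mul0r.
have -> : x ^+ n.+1 - v ^+ n.+1 = x * (x ^+ n - v ^+ n) + (x - v) * v ^+ n.
  by rewrite !exprS; ring.
apply: le_trans (ler_normD _ _) _; rewrite !normrM.
apply: (@le_trans _ _ (2 * (n%:R * 2 ^+ n * `|x - v|) + `|x - v| * 2 ^+ n)).
  apply: lerD; first by apply: ler_pM.
  by apply: ler_wpM2l => //; rewrite normrX lerXn2r ?nnegrE.
have -> : n.+1%:R * 2 ^+ n.+1 * `|x - v| =
    2 * (n%:R * 2 ^+ n * `|x - v|) + `|x - v| * 2 ^+ n + `|x - v| * 2 ^+ n.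
  by rewrite exprS mulrSr; ring.
by rewrite lerDl mulr_ge0 // exprn_ge0.
Qed.

(* Chosen so that two points within this distance of w satisfy slope_lower. *)
Definition radius : K := (k'%:R * 2 ^+ k + 1)^-1.

Lemma radius_gt0 : 0 < radius.
Proof. by rewrite invr_gt0 ltr_wpDl // mulr_ge0 ?exprn_ge0. Qed.

Lemma radius_le1 : radius <= 1.
Proof. by rewrite invf_le1 ?lerDr ?ltr_wpDl // mulr_ge0 ?exprn_ge0. Qed.

(** The divided difference of the k-th power; on the diagonal it is the derivative k y^k'. *)
Definition slope (y v : K) : K := \sum_(i < k) y ^+ (k' - i) * v ^+ i.

Lemma slopeE y v : y ^+ k - v ^+ k = (y - v) * slope y v.
Proof. by rewrite subrXX; congr (_ * _); apply: eq_bigr => i _. Qed.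

Lemma near_root_le2 y : `|y - w| < radius -> `|y| <= 2.
Proof.
move=> yw; rewrite -[y](subrK w); apply: le_trans (ler_normD _ _) _.
rewrite norm_root -[leRHS]/(1 + 1); apply: lerD => //.
exact: le_trans (ltW yw) radius_le1.
Qed.

(** At y = v = w the slope is k w^k', of modulus k. Near w each of its k terms moves by at most k'
    2^k' [radius] <= 1/2, which leaves at least k/2. *)
Lemma slope_lower y v : `|y - w| < radius -> `|v - w| < radius ->
  1 / 2 <= `|slope y v|.
Proof.
move=> yw vw; have y2 := near_root_le2 yw; have v2 := near_root_le2 vw.
have w2 : `|w| <= 2 by rewrite norm_root ler1n.
have term (i : 'I_k) : `|w ^+ k' - y ^+ (k' - i) * v ^+ i| <= k'%:R * 2 ^+ k' * radius.
  have ik : (i <= k')%N := ltn_ord i.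
  have -> : w ^+ k' - y ^+ (k' - i) * v ^+ i =
     - (y ^+ (k' - i) * (v ^+ i - w ^+ i) + (y ^+ (k' - i) - w ^+ (k' - i)) * w ^+ i).
    by rewrite -{1}(subnK ik) exprD; ring.
  rewrite normrN; apply: le_trans (ler_normD _ _) _; rewrite !normrM.
  have -> : k'%:R * 2 ^+ k' * radius = 2 ^+ (k' - i) * (i%:R * 2 ^+ i * radius) +
      (k' - i)%:R * 2 ^+ (k' - i) * radius * 2 ^+ i.
    by rewrite -{1 2}(subnK ik) exprD natrD; ring.
  have bX (u : K) n : `|u| <= 2 -> `|u ^+ n| <= 2 ^+ n.
    by move=> u2; rewrite normrX lerXn2r ?nnegrE.
  have bS (u : K) n : `|u| <= 2 -> `|u - w| < radius ->
      `|u ^+ n - w ^+ n| <= n%:R * 2 ^+ n * radius.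
    move=> u2 uw; apply: le_trans (pow_sub_bound n u2 w2) _.
    by apply: ler_wpM2l (ltW uw); rewrite mulr_ge0 // exprn_ge0.
  by apply: lerD; apply: ler_pM; rewrite ?bX ?bS.
have dist : `|k%:R * w ^+ k' - slope y v| <= k%:R * (k'%:R * 2 ^+ k' * radius).
  have -> : k%:R * w ^+ k' - slope y v =
      \sum_(i < k) (w ^+ k' - y ^+ (k' - i) * v ^+ i).
    by rewrite sumrB sumr_const card_ord mulr_natl.
  apply: le_trans (ler_norm_sum _ _ _) _.
  apply: le_trans (ler_sum _ (fun i _ => term i)) _.
  by rewrite sumr_const card_ord [leRHS]mulr_natl.
have small : k'%:R * 2 ^+ k' * radius <= 1 / 2.
  have r0 := radius_gt0; rewrite ler_pdivlMr //.
  have -> : k'%:R * 2 ^+ k' * radius * 2 = (k'%:R * 2 ^+ k) / (k'%:R * 2 ^+ k + 1).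
    by rewrite /radius exprS; ring.
  have p0 : 0 < k'%:R * 2 ^+ k + 1 :> K by rewrite ltr_wpDl // mulr_ge0 ?exprn_ge0.
  by rewrite ler_pdivrMr // mul1r lerDl.
have kw : `|k%:R * w ^+ k'| = k%:R.
  by rewrite normrM normrX norm_root expr1n mulr1 normr_nat.
have := lerB_dist (k%:R * w ^+ k') (k%:R * w ^+ k' - slope y v).
rewrite kw opprB addrCA subrr addr0; apply: le_trans.
rewrite lerBrDr; apply: le_trans (lerD (lexx _) (le_trans dist (ler_wpM2l _ small))) _.
  exact: ler0n.
rewrite -{1}[1]mul1r -mulrA -mulrDl mul1r ler_pdivrMr // -[1 + _](natrD K 1 k).
by rewrite -[2]/(2%:R) -natrM ler_nat; lia.
Qed.

(** The distances from w to the k roots of X^k - z multiply to |w^k - z| = |1 - z|, so they cannot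
    all be at least [radius]. *)
Lemma root_near z : `|z - 1| < radius ^+ k -> exists2 y, `|y - w| < radius & y ^+ k = z.
Proof.
move=> zr; have [rs e] := closed_field_poly_normal ('X^k - z%:P : {poly K}).
rewrite (monicP _) ?monicXnsubC // scale1r in e.
have szrs : size rs = k.
  by apply: succn_inj; rewrite -(size_prod_XsubC rs id) -e size_XnsubC.
have [/hasP[y yrs yw]|/hasPn far] := boolP (has (fun y => `|y - w| < radius) rs).
  exists y => //; have : root ('X^k - z%:P) y by rewrite e root_prod_XsubC.
  by rewrite rootE hornerD hornerN hornerXn hornerC subr_eq0 => /eqP.
have ep : `|1 - z| = \prod_(y <- rs) `|y - w|.
  have := congr1 (fun p : {poly K} => `|p.[w]|) e.
  rewrite hornerD hornerN hornerXn hornerC wk horner_prod normr_prod => ->.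
  by apply: eq_bigr => y _; rewrite hornerXsubC distrC.
have : radius ^+ size rs <= \prod_(y <- rs) `|y - w|.
  elim: rs far {e szrs ep} => [|y rs IH] far; first by rewrite big_nil expr0.
  rewrite big_cons /= exprS; apply: ler_pM.
  - exact: ltW radius_gt0.
  - by rewrite exprn_ge0 // ltW // radius_gt0.
  - have := far y (mem_head _ _); rewrite -real_leNgt ?normr_real //.
    by rewrite ger0_real // ltW // radius_gt0.
  by apply: IH => u ur; apply: far; rewrite inE ur orbT.
by rewrite szrs -ep distrC => /le_lt_trans/(_ zr); rewrite ltxx.
Qed.

(** Provides the uniqueness of the root near w as well as the continuity of the branch. *)
Lemma near_root_lipschitz y v : `|y - w| < radius -> `|v - w| < radius ->
  `|y - v| <= 2 * `|y ^+ k - v ^+ k|.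
Proof.
move=> yw vw; rewrite slopeE normrM mulrCA -[leLHS]mulr1; apply: ler_wpM2l => //.
by have := slope_lower yw vw; rewrite ler_pdivrMr // mulrC.
Qed.

Import numFieldNormedType.Exports.
Local Open Scope classical_set_scope.

Definition near_root (y : K) : Prop := `|y - w| < radius.
Definition near_one (z : K) : Prop := `|z - 1| < radius ^+ k.

(** On [near_one] the root near w exists and is unique; the default [w] is taken only where there is
    none. *)
Definition root_branch (z : K) : K := xget w [set y | near_root y /\ y ^+ k = z].
Local Notation r := root_branch.

Lemma root_branchP z : near_one z -> near_root (r z) /\ r z ^+ k = z.
Proof.
move=> /root_near[y yw yz]; rewrite /r; case: xgetP => [u _ //|/(_ y) H].
by case: H.
Qed.

Lemma root_branchK y : near_root y -> near_one (y ^+ k) -> r (y ^+ k) = y.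
Proof.
move=> yw /root_branchP[rw ek]; have := near_root_lipschitz rw yw.
by rewrite ek subrr normr0 mulr0 normr_le0 subr_eq0 => /eqP.
Qed.

Lemma near_dist (z e : K) : 0 < e -> \forall t \near z, `|z - t| < e.
Proof. by move=> e0; exact: nbhsx_ballx. Qed.

Lemma near_oneE z : near_one z -> \forall t \near z, near_one t.
Proof.
move=> zE; have e0 : 0 < radius ^+ k - `|z - 1| by rewrite subr_gt0.
near=> t; rewrite /near_one -[t](subrK z) -addrA.
apply: le_lt_trans (ler_normD _ _) _; rewrite -ltrBrDr distrC.
by near: t; exact: near_dist.
Unshelve. all: by end_near. Qed.

Lemma continuous_root_branch z : near_one z -> {for z, continuous root_branch}.
Proof.
move=> zE; apply: (cvgrPdist_lt (F := nbhs z) root_branch (root_branch z)).2 => e e0; near=> t.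
have tE : near_one t by near: t; exact: near_oneE.
have [rz ez] := root_branchP zE; have [rt et] := root_branchP tE.
apply: le_lt_trans (near_root_lipschitz rz rt) _; rewrite ez et mulrC -ltr_pdivlMr //.
by near: t; apply: near_dist; exact: divr_gt0.
Unshelve. all: by end_near. Qed.

Lemma continuous_slope v : continuous (slope ^~ v).
Proof.
move=> y; apply: differentiable_continuous.
have -> : slope ^~ v = \sum_(i < k) (fun y => y ^+ (k' - i) *: v ^+ i : K).
  by apply/funext => u; rewrite fct_sumE.
apply: differentiable_sum => i; apply: differentiableZl.
exact/differentiable_expr/ex_diff.
Qed.

Lemma differentiable_root_branch z : near_one z -> differentiable root_branch z.
Proof.
move=> zE; apply/derivable1_diffP; apply/cvg_ex.
have [rz ez] := root_branchP zE.
(* By [slopeE] the difference quotient of the branch is the inverse of the slope between r(h + z)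
   and r(z), which tends to the slope on the diagonal. *)
exists (slope (r z) (r z))^-1.
have nz y : near_root y -> slope y (r z) != 0.
  move=> yw; rewrite -normr_gt0; apply: lt_le_trans (slope_lower yw rz).
  by rewrite divr_gt0.
have sh : (fun h : K => h + z) @ 0^' --> z.
  have cz : {for (0 : K), continuous (fun h : K => h + z)}.
    by apply: differentiable_continuous; apply: differentiableD; exact: ex_diff.
  rewrite -[X in _ --> X]add0r; exact: cvg_within_filter cz.
have cs : (fun h : K => (slope (r (h + z)) (r z))^-1) @ 0^' --> (slope (r z) (r z))^-1.
  apply: cvgV; first exact: nz.
  have cr := cvg_comp _ _ sh (continuous_root_branch zE).
  exact: (cvg_comp _ _ cr (@continuous_slope (r z) (r z))).
apply: cvg_trans cs; apply: near_eq_cvg; near=> h.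
have hE : near_one (h + z) by near: h; exact: (sh _ (near_oneE zE)).
have h0 : h != 0 by near: h; exact: nbhs_dnbhs_neq.
have [rh eh] := root_branchP hE.
have := slopeE (r (h + z)) (r z); rewrite eh ez addrK => e.
rewrite /= scaler1 -[RHS]/(h^-1 * _); apply: (mulfI h0).
by rewrite mulrA divff // mul1r {1}e mulfK ?nz.
Unshelve. all: by end_near. Qed.

End RootBranch.

(** * The analytic type of the singular points *)

Section TypeA.
Import numFieldNormedType.Exports.
Local Open Scope classical_set_scope.
Variables (K : numClosedFieldType) (k' : nat) (l : 'I_2) (w : K).
Notation k := k'.+1.
Hypothesis wk : w ^+ k = 1.
Notation V := 'rV[K]_2.

Definition plane_vec (m : 'I_2) (s t : K) : V :=
  s *: delta_mx 0 m + t *: delta_mx 0 (other m).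

Lemma plane_vecE m s t :
  (plane_vec m s t 0 m = s) * (plane_vec m s t 0 (other m) = t).
Proof.
by rewrite /plane_vec !mxE !eqxx !other_neq !mulr1 !mulr0 addr0 add0r.
Qed.

Lemma plane_vec_coord m (v : V) : v = plane_vec m (v 0 m) (v 0 (other m)).
Proof.
have [e1 e2] := plane_vecE m (v 0 m) (v 0 (other m)).
apply/rowP; move: m e1 e2; apply: ord2_cases;
  rewrite ?other0 ?other1 => e1 e2; exact: ord2_cases.
Qed.

Lemma differentiable_plane_vec m (f g : V -> K) v : differentiable f v ->
  differentiable g v -> differentiable (fun v => plane_vec m (f v) (g v)) v.
Proof. by move=> df dg; apply: differentiableD; exact: differentiableZl. Qed.

Lemma open_near_one : open [set z : K | near_one k' z].
Proof. by rewrite openE => z zE; exact: near_oneE. Qed.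

Lemma open_near_root : open [set y : K | near_root k' w y].
Proof.
rewrite openE => y yw; have e0 : 0 < radius K k' - `|y - w| by rewrite subr_gt0.
have := near_dist y e0; apply: filterS => t.
rewrite ltrBrDr => yt; rewrite /near_root /= -[t](subrK y) -addrA.
by apply: le_lt_trans (ler_normD _ _) _; rewrite distrC.
Qed.

Lemma open_preimage (f : V -> K) (D : set K) :
  (forall v, differentiable f v) -> open D -> open (f @^-1` D).
Proof.
by move=> df; apply: open_comp => v _; exact/differentiable_continuous/df.
Qed.

Lemma local_type_A : type_A k' (local_form k' l w).
Proof.
(* Rescales s by a k-th root of 4, so that 4 s^k becomes v^k. *)
pose c : K := k.-root 4%:R.
have ck : c ^+ k = 4 by rewrite rootCK.
have c0 : c != 0 by apply: contra_eq_neq ck => ->; rewrite expr0n eq_sym pnatr_eq0.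
(* In the new coordinates u = U and v = c s, [a] recovers s and [b] recovers (w + t)^k = 1 + U +
   s^k, from which the root branch yields w + t. *)
pose a (v : V) : K := v 0 1 / c.
pose b (v : V) : K := 1 + v 0 0 + a v ^+ k.
pose y (x : V) : K := w + x 0 (other l).
have da v : differentiable a v.
  have -> : a = fun v => v 0 1 *: c^-1 by [].
  by apply: differentiableZl; exact: differentiable_coord.
have db v : differentiable b v.
  apply: differentiableD; last exact: differentiable_expr.
  by apply: differentiableD; [exact: differentiable_cst|exact: differentiable_coord].
have dy v : differentiable y v.
  by apply: differentiableD; [exact: differentiable_cst|exact: differentiable_coord].
(* On the target, closeness of w + t to w lets the branch recover w + t from its k-th power, and
   closeness of that power to 1 puts the image in the source. *)
exists [set v | near_one k' (b v)], [set x | near_root k' w (y x) /\ near_one k' (y x ^+ k)].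
exists (fun v => plane_vec l (a v) (root_branch k' w (b v) - w)).
exists (fun x => plane_vec 0 (y x ^+ k - 1 - x 0 l ^+ k) (c * x 0 l)).
exists (cst 1).
have B (v : V) :
    y (plane_vec l (a v) (root_branch k' w (b v) - w)) = root_branch k' w (b v).
  by rewrite /y plane_vecE addrC subrK.
have a0 : a 0 = 0 by rewrite /a mxE mul0r.
have b0 : b 0 = 1 by rewrite /b a0 mxE expr0n !addr0.
have y0 : y 0 = w by rewrite /y mxE addr0.
have e1 : near_one k' (1 : K) by rewrite /near_one subrr normr0 exprn_gt0 // radius_gt0.
have ew : near_root k' w w by rewrite /near_root subrr normr0 radius_gt0.
have r1 : root_branch k' w 1 = w by rewrite -wk root_branchK // wk.
split.
- split; rewrite /= ?b0 ?y0 ?wk //.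
  + exact: open_preimage db open_near_one.
  + apply: openI; first exact: open_preimage dy open_near_root.
    exact: (open_preimage (fun v => differentiable_expr k (dy v)) open_near_one).
  + by rewrite a0 r1 subrr /plane_vec !scale0r addr0.
- move=> v vU; rewrite /= B //; have [rw er] := root_branchP wk vU.
  rewrite er; split=> //; rewrite plane_vecE [RHS](plane_vec_coord 0); congr plane_vec.
    by rewrite /b; ring.
  by rewrite /a mulrC divfK.
- move=> x [xw xk] /=; set v := plane_vec 0 _ _.
  have av : a v = x 0 l by rewrite /a -other0 plane_vecE mulrC mulKf.
  have bv : b v = y x ^+ k by rewrite /b av plane_vecE; ring.
  rewrite bv; split=> //; rewrite av root_branchK // /y addrC addrA addNr add0r.
  by rewrite -plane_vec_coord.
- split=> [v vU|x xV].
    apply: differentiable_plane_vec => //; apply: differentiableD.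
      by apply: (differentiable_comp (db v)); exact: differentiable_root_branch.
    exact: differentiable_cst.
  apply: differentiable_plane_vec; last first.
    apply: (@differentiable_comp _ _ _ _ (fun x : V => x 0 l) (fun t => c * t)).
      exact: differentiable_coord.
    exact: ex_diff.
  apply: differentiableB; last exact/differentiable_expr/differentiable_coord.
  by apply: differentiableB; [exact: differentiable_expr|exact: differentiable_cst].
- move=> v vU; split; [exact: differentiable_cst|exact: oner_neq0|rewrite /=].
  set x := plane_vec _ _ _; have [rw er] := root_branchP wk vU.
  have -> : (local_form k' l w).@[x 0] = curve_form 1 (x 0 l ^+ k) (y x ^+ k).
    have eX (p : {mpoly K[2]}) n : (p ^+ n).@[x 0] = p.@[x 0] ^+ n := rmorphXn _ _ _.
    have eF (p q r : {mpoly K[2]}) : (curve_form p q r).@[x 0] =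
      curve_form p.@[x 0] q.@[x 0] r.@[x 0] := rmorph_curve_form (meval (x 0)) _ _ _.
    by rewrite eF meval1 !eX mevalD mevalC !mevalXU.
  rewrite /x B er plane_vecE /b mul1r.
  have -> : v 0 1 ^+ k = 4 * a v ^+ k by rewrite -ck -exprMn /a mulrC divfK.
  by rewrite /curve_form; ring.
Qed.

End TypeA.

Lemma curve_total_tjurina (K : numClosedFieldType) k : (0 < k)%N ->
  total_tjurina_number (plane_curve_poly K k) (3 * k * (k - 1))%N.
Proof.
case: k => // -[|k'] _.
  exists [::], (fun _ => 0%N); split=> // [p|]; last by rewrite subnn muln0 big_nil.
  by split=> // /(conic_smooth (erefl _)).
have [//|s [us ss sp]] := @singular_points K k'.+1; exists s, (fun _ => k'.+1).
split=> // [p /sp sing|].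
  have [l [w [wk ->]]] := local_equation_node sing; exact: local_tjurina.
by rewrite big_const_seq count_predT iter_addn_0 mulnC ss subn1.
Qed.

Theorem theorem3p12 (R : realType) (k : nat) (hk : (1 <= k)%N) :
  let f : {mpoly R[i][3]} := plane_curve_poly R[i] k in
  [/\ reduced_curve (2 * k) f,
      (k = 1%N -> forall p, ~ singular_point f p) /\
      ((2 <= k)%N ->
         exists s : seq (P2 R[i]),
           [/\ uniq s, size s = (3 * k)%N,
               (forall p, singular_point f p <-> p \in s) &
               forall p, p \in s -> type_A k.-1 (local_equation f p)]),
      [/\ nearly_free f, nearly_free_exponents (2 * k) f k k k &
          total_tjurina_number f (3 * k * (k - 1))%N] &
      (odd k ->
         irreducible_mpoly f /\
         geometric_genus f (((k - 1) * (k - 2)) %/ 2)%N) /\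
      (~~ odd k ->
         exists q : 'I_4 -> {mpoly R[i][3]},
           irreducible_components f q /\
           forall i, q i \is (k %/ 2).-homog /\
                     forall p, ~ singular_point (q i) p)].
Proof.
move=> f; split.
- by split; [exact: curve_homog|exact: curve_square_free].
- rewrite {}/f; case: k hk => // k' _; split=> [[k0] p|k2].
    exact: conic_smooth.
  have [//|s [us ss sp]] := @singular_points R[i] k'; exists s; split=> // p /sp sing.
  have [l [w [wk ->]]] := local_equation_node sing; exact: local_type_A.
- split; last exact: curve_total_tjurina.
    by rewrite {}/f; case: k hk => // k' _; exact: curve_nearly_free.
  by rewrite {}/f; case: k hk => // k' _; exact: curve_exponents.
- split=> [ok|ek].
    by split; [exact: curve_irreducible|exact: curve_geometric_genus].
  have ke : k = (2 * k./2)%N by rewrite -[LHS]odd_double_half (negPf ek) mul2n.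
  have l0 : (0 < k./2)%N by case: k hk ek {ke f} => [|[]].
  exists (component R[i] k./2); split; first by rewrite {}/f {1}ke; exact: components_irreducible.
  move=> i; split; last by move=> p; exact: component_smooth.
  by rewrite divn2; exact: fermat_homog.
Qed.
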